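(* Fix reals $\alpha,\beta,\gamma,\delta\ge0$ with $\alpha+\beta+\gamma+\delta=1$ satisfying $\alpha+\gamma>0$, $\beta>0$, $\delta>0$. Put $D:=1-4(\alpha\gamma+\alpha\delta+\beta\gamma)$, $\mu:=(1-\sqrt D)/2$ and $\sigma:=\sqrt{(\alpha+\gamma)\beta\delta/D}$ (these are well defined with $D>0$, $\sigma>0$). Consider $n\to\infty$ along integers $n$ for which $l:=\alpha n$, $m:=(\alpha+\beta)n$, $k:=(\alpha+\gamma)n$ are integers, and let $X$ be distributed according to $p(\cdot\mid n,m,k,l)$, with probability $\Pr_n$. Then for all reals $t<u$, \[ \lim_{n\to\infty}\Pr_n\Bigl[t\le\frac{X-n\mu}{\sqrt n\,\sigma}\le u\Bigr]=\frac{1}{\sqrt{2\pi}}\int_t^ue^{-s^2/2}\,ds. \] As a corollary, the pmf behaves as \[ p(x\mid n,m,k,l)=\frac{1}{\sqrt{2\pi n}\,\sigma}\exp\Bigl(-\frac12\Bigl(\frac{x-n\mu}{\sqrt n\,\sigma}\Bigr)^2\Bigr)\bigl(1+o(1)\bigr)\qquad(n\to\infty). \]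
   Context: For non-negative integers $n,m,k,l$ with $m,k\le n$ and $m+k-n\le l\le\min(m,k)$, let $M:=m-l$, $N:=n-m-k+l$. Let $\mathbb{C}^2$ have orthonormal basis $|0\rangle,|1\rangle$ and give $(\mathbb{C}^2)^{\otimes n}$ the induced Hermitian inner product. Define $|\Xi_{n,m|k,l}\rangle:=|1\rangle^{\otimes l}\otimes|0\rangle^{\otimes(k-l)}\otimes\binom{M+N}{M}^{-1/2}\sum_{I}|I\rangle$, the sum over all $I\in\{0,1\}^{n-k}$ with exactly $M$ ones (where $|i_1\cdots i_r\rangle=|i_1\rangle\otimes\cdots\otimes|i_r\rangle$). $\mathfrak S_n$ acts on $(\mathbb{C}^2)^{\otimes n}$ by permuting tensor factors. For $0\le x\le\lfloor n/2\rfloor$, $\mathsf P_{(n-x,x)}$ is the orthogonal projection onto the isotypic component of the irreducible $\mathfrak S_n$-representation labelled by the partition $(n-x,x)$, and $p(x\mid n,m,k,l):=\langle\Xi_{n,m|k,l}|\mathsf P_{(n-x,x)}|\Xi_{n,m|k,l}\rangle$, a probability mass function on $\{0,\dots,\lfloor n/2\rfloor\}$. *)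

(* Defs.v *)
From HB Require Import structures.
From mathcomp Require Import all_boot all_order all_algebra all_fingroup.
From mathcomp Require Import mxrepresentation.
From mathcomp Require Import complex.
From mathcomp Require Import all_classical all_reals all_analysis.
Set Implicit Arguments. Unset Strict Implicit. Unset Printing Implicit Defensive.
Import Order.TTheory GRing.Theory Num.Theory.
Local Open Scope ring_scope.

Section Model.
Variable R : realType.
Local Notation C := (R[i]).

(* Computational basis of (C^2)^{\otimes n}: bit strings b : 'I_n -> bool,
   b i = the label (0 = false, 1 = true) of tensor factor number i+1. *)
Definition Tn (n : nat) := {ffun 'I_n -> bool}.
Definition dimV (n : nat) := #|Tn n|.

Definition actb n (s : {perm 'I_n}) (b : Tn n) : Tn n := [ffun i => b ((s^-1)%g i)].

Lemma actb_inj n (s : {perm 'I_n}) : injective (actb s).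
Proof.
move=> b c /ffunP H; apply/ffunP=> i; have := H (s i).
by rewrite !ffunE permK.
Qed.

Lemma actb1 n (b : Tn n) : actb 1%g b = b.
Proof. by apply/ffunP=> i; rewrite ffunE invg1 perm1. Qed.

Lemma actbM n (s t : {perm 'I_n}) (b : Tn n) : actb (s * t)%g b = actb t (actb s b).
Proof. by apply/ffunP=> i; rewrite !ffunE invMg permM. Qed.

Definition idxf n (s : {perm 'I_n}) (j : 'I_(dimV n)) : 'I_(dimV n) :=
  enum_rank (actb s (enum_val j)).

Lemma idxf_inj n (s : {perm 'I_n}) : injective (idxf s).
Proof.
move=> i j /enum_rank_inj /actb_inj /enum_val_inj; done.
Qed.

Definition idxp n (s : {perm 'I_n}) : 'S_(dimV n) := perm (@idxf_inj n s).

(* Matrix of sigma on (C^2)^{\otimes n} in the computational basis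
   (row-vector convention, as in mxrepresentation). *)
Definition repm n (s : {perm 'I_n}) : 'M[C]_(dimV n) := perm_mx (idxp s).

Lemma repm_mx_repr n : mx_repr [set: {perm 'I_n}] (@repm n).
Proof.
split.
  rewrite /repm -perm_mx1; congr perm_mx; apply/permP=> j.
  by rewrite permE perm1 /idxf actb1 enum_valK.
move=> s t _ _; rewrite /repm -perm_mxM; congr perm_mx; apply/permP=> j.
by rewrite permM !permE /idxf enum_rankK actbM.
Qed.

Definition repV n : mx_representation C [set: {perm 'I_n}] (dimV n) :=
  MxRepresentation (@repm_mx_repr n).

(* Polytabloid e_T for a two-row tableau whose first x columns are the pairs
   (P i).1 (top) / (P i).2 (bottom), realised in the weight-x subspace of
   (C^2)^{\otimes n} (which is the permutation module M^{(n-x,x)}: the tabloid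
   with second row S is the basis vector with ones exactly on S):
     e_T = \prod_i (|0>_{(P i).1}|1>_{(P i).2} - |1>_{(P i).1}|0>_{(P i).2})
           \otimes |0> on all other factors.
   If the 2x entries of P are not pairwise distinct, P is not a tableau and we
   take the zero vector. *)
Definition pairs_ok n x (P : {ffun 'I_x -> 'I_n * 'I_n}) : bool :=
  uniq (flatten [seq [:: (P i).1; (P i).2] | i <- enum 'I_x]).

Definition in_pairs n x (P : {ffun 'I_x -> 'I_n * 'I_n}) (j : 'I_n) : bool :=
  [exists i, (j == (P i).1) || (j == (P i).2)].

Definition polytab n x (P : {ffun 'I_x -> 'I_n * 'I_n}) : 'rV[C]_(dimV n) :=
  \row_j (let b : Tn n := @enum_val (Tn n) (mem predT) j in
          if pairs_ok P then
            (\prod_(i < x) ((nat_of_bool (b (P i).2))%:R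
                             - (nat_of_bool (b (P i).1))%:R))
            * (nat_of_bool [forall j' : 'I_n, ~~ in_pairs P j' ==> ~~ b j'])%:R
          else 0).

Definition specht n x : 'M[C]_(#|{ffun 'I_x -> 'I_n * 'I_n}|, dimV n) :=
  \matrix_(r < #|{ffun 'I_x -> 'I_n * 'I_n}|) polytab (enum_val r).

Definition isotypic n x : 'M[C]_(dimV n) := component_mx (repV n) (<<specht n x>>)%MS.

Definition adjmx p q (A : 'M[C]_(p, q)) : 'M[C]_(q, p) := (map_mx (@conjc R) A)^T.

Definition orth_proj d (U : 'M[C]_d) (v : 'rV[C]_d) : 'rV[C]_d :=
  let B := row_base U in v *m adjmx B *m invmx (B *m adjmx B) *m B.

Definition hdot d (v w : 'rV[C]_d) : C := \sum_j conjc (v 0 j) * w 0 j.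

(* |Xi_{n,m|k,l}> = |1>^{l} |0>^{(k-l)} binom(M+N,M)^{-1/2} sum_{|I|=M} |I>,
   with M+N = n-k and M = m-l. *)
Definition Xi n m k l : 'rV[C]_(dimV n) :=
  \row_j (let b : Tn n := @enum_val (Tn n) (mem predT) j in
          if [forall i : 'I_n, ((i < l)%N ==> b i)
                               && (((l <= i)%N && (i < k)%N) ==> ~~ b i)]
             && (#|[set i : 'I_n | (k <= i)%N && b i]| == m - l)%N
          then ((Num.sqrt ('C(n - k, m - l))%:R)^-1)%:C%C
          else 0).

(* p(x | n,m,k,l) = <Xi| P_{(n-x,x)} |Xi>  (a real number; we take Re). *)
Definition pXi n m k l x : R :=
  complex.Re (hdot (Xi n m k l) (orth_proj (isotypic n x) (Xi n m k l))).

End Model.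

Section Consts.
Variable R : realType.
Variables (a b c d : R).

Definition Dcst : R := 1 - 4 * (a * c + a * d + b * c).
Definition mucst : R := (1 - Num.sqrt Dcst) / 2.
Definition sigmacst : R := Num.sqrt ((a + c) * b * d / Dcst).

Definition zscore (n x : nat) : R :=
  (x%:R - n%:R * mucst) / (Num.sqrt n%:R * sigmacst).

Definition prob_window (n m k l : nat) (t u : R) : R :=
  \sum_(x < (n./2).+1 | (t <= zscore n x) && (zscore n x <= u)) pXi R n m k l x.

Definition gauss_local (n x : nat) : R :=
  (Num.sqrt (2 * pi * n%:R) * sigmacst)^-1 * expR (- (zscore n x ^+ 2) / 2).
End Consts.

Definition gauss_window (R : realType) (t u : R) : R :=
  (Num.sqrt (2 * pi))^-1 *
  Rintegral (@lebesgue_measure R) `[t, u]%classic (fun s : R => expR (- (s ^+ 2) / 2)).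

(* Main.v *)
(* Xi is the tensor product of |1>^l, of |0>^(k-l) and of the Dicke state with M
   ones and N zeros.  The class sum of transpositions acts on the isotypic
   component of shape (n-x,x) by a scalar that determines x, so p is determined
   by the expectations in Xi of polynomials in that class sum.  Ladder operators
   compute them, and they agree with those of two successive SU(2) couplings:
   p(x) is the sum over y of the probability that coupling the Dicke state with
   |0>^(k-l) gives second row y, times the probability that coupling the result
   with |1>^l adds x - y.  Both factors are squared Clebsch-Gordan coefficients
   in product form.  Ratios of consecutive ones are explicit, so their logarithms
   decrease by (w - w0)/v + O(1/n) near the mode w0; Chebyshev's inequality with
   the exact first moments fixes the normalisation, and each factor satisfies a
   local limit theorem.  The centre of the second factor is affine in y up to
   O(1) on the scale sqrt n, so the sum over y is a convolution of two Gaussians,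
   of variance sigma^2 n; summing over x gives the central limit theorem. *)

(* No coupling of representations is ever constructed: the coupled weights enter only as a measure
   with the same moments as [Xi]. Moments are products of (z - casimir) over arbitrary root lists,
   because ladder operators give exact values for special lists and affinity in each root carries
   these to all lists; distinct Casimir values then separate the shapes. Two facts about p come
   first: the eigenvalue on each isotypic component, which rests on lowering killing polytabloids,
   and that the components with x <= n/2 span the space. The analytic obstacle is that the target
   has size 1/sqrt n at each point, while Chebyshev's inequality bounds the tail of y beyond T sqrt
   n only by a constant over T^2. Hence moderate deviations of y are paired with a uniform bound
   C/sqrt n on the second weight; only deviations of order n, of probability O(1/n), meet the
   trivial bound 1. When alpha or gamma vanishes one coupling is trivial and a single local limit
   theorem suffices. The central limit theorem needs no tail estimate: its window is bounded and the
   local theorem is uniform there. *)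
Require Import Defs.
From HB Require Import structures.
From mathcomp Require Import all_boot all_order all_algebra all_fingroup.
From mathcomp Require Import mxrepresentation complex.
From mathcomp Require Import all_classical all_reals all_analysis.
From mathcomp Require Import ring lra zify.
Set Implicit Arguments. Unset Strict Implicit. Unset Printing Implicit Defensive.
Import Order.TTheory GRing.Theory Num.Theory.
Local Open Scope ring_scope.

(** * Coupling weights *)

Ltac natfact := rewrite ?addn0; rewrite ?(addSn, addnS); rewrite ?fact0; rewrite ?factS; rewrite ?natrM.
Ltac nneg := first [exact: ler01 | exact: ler0n | apply: addr_ge0; nneg | apply: mulr_ge0; nneg].
Ltac pos := first [exact: ltr01 | by rewrite ltr0n | apply: ltr_pwDl; [pos | nneg]
  | apply: ltr_wpDl; [nneg | pos]].
Ltac nzsum nf := repeat (apply/andP; split); first [exact: nf | apply: lt0r_neq0; pos].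

Lemma sum_ord_ext (V : nmodType) (f : nat -> V) m n : (m <= n)%N ->
  (forall i, (m <= i)%N -> f i = 0) -> \sum_(i < n) f i = \sum_(i < m) f i.
Proof.
move=> mn f0; rewrite (big_ord_widen n f mn) [LHS](bigID (fun i : 'I_n => (i < m)%N)) /=.
by rewrite [X in _ + X]big1 ?addr0 // => i; rewrite -leqNgt; apply: f0.
Qed.

Section CouplingWeights.
Variable F : numFieldType.
Implicit Types s t d w : nat.

(* Squared Clebsch-Gordan coefficient: the probability of the shape (n-w,w) when
   the Dicke state with s ones and t zeros is tensored with |0>^d. *)
Definition cgw s t d w : F :=
  if (w <= s)%N && (w <= d)%N then
    ((s + t + d - 2 * w).+1 * s`! * d`! * (t + d - w)`! * (s + t - w)`!)%:R
    / (w`! * (s + t + d - w).+1`! * t`! * (d - w)`! * (s - w)`!)%:R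
  else 0.

Lemma factR_neq0 k : (k`!)%:R != 0 :> F.
Proof. by rewrite pnatr_eq0 -lt0n fact_gt0. Qed.

(** Writing s = w + p and d = w + e removes every truncated subtraction, so the recurrences below
    become rational identities within reach of [field]. *)
Lemma cgwE p t e w : cgw (w + p) t (w + e) w =
  ((p + t + e).+1 * (w + p)`! * (w + e)`! * (t + e)`! * (p + t)`!)%:R
    / (w`! * (w + p + t + e).+1`! * t`! * e`! * p`!)%:R.
Proof.
rewrite /cgw !leq_addr /=.
have -> : (w + p + t + (w + e) - 2 * w = p + t + e)%N by lia.
have -> : (t + (w + e) - w = t + e)%N by lia.
have -> : (w + p + t - w = p + t)%N by lia.
have -> : (w + p + t + (w + e) - w = w + p + t + e)%N by lia.
by rewrite !(addnC w) !addnK.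
Qed.

Lemma cgw_ge0 s t d w : 0 <= cgw s t d w.
Proof. by rewrite /cgw; case: ifP => // _; rewrite divr_ge0 ?ler0n. Qed.

Lemma cgw0 s t d w : ~~ ((w <= s)%N && (w <= d)%N) -> cgw s t d w = 0.
Proof. by rewrite /cgw => /negbTE ->. Qed.

Lemma cgw_d0 s t w : cgw s t 0 w = (w == 0%N)%:R.
Proof.
case: w => [|w]; last by rewrite cgw0 ?andbF.
have := cgwE s t 0 0; rewrite !add0n !addn0 => ->.
rewrite fact0 factS !mul1n !muln1 !natrM eqxx /=. field.
by nzsum factR_neq0.
Qed.

(* Passing from d to d+1 couples one more spin-1/2: from w the new index is w
   or w+1, with the Clebsch-Gordan probabilities below. *)
Lemma cgw_dS s t d w :
  cgw s t d.+1 w =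
    cgw s t d w * ((t + d - w).+1)%:R / ((s + t + d - 2 * w).+1)%:R
    + (if w is w'.+1 then
        cgw s t d w' * (s - w')%:R / ((s + t + d - 2 * w').+1)%:R else 0).
Proof.
have nz k : k.+1%:R != 0 :> F by rewrite pnatr_eq0.
have nf := factR_neq0.
have [ws|sw] := leqP w s; last first.
  rewrite cgw0 ?[cgw s t d w]cgw0; [|lia|lia].
  rewrite !mul0r add0r; case: w sw => // w sw.
  have [->|?] := eqVneq w s; first by rewrite subnn mulr0 mul0r.
  by rewrite cgw0 ?mul0r//; lia.
have [p es] : exists p, (s = w + p)%N by exists (s - w)%N; lia.
have [wd|dw] := leqP w d; last first.
  rewrite [cgw s t d w]cgw0 1?andbC; last by lia.
  rewrite !mul0r add0r; case: w ws dw es => // w ws dw es.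
  have [edw|?] := eqVneq w d; last by rewrite !cgw0 ?mul0r//; lia.
  subst.
  have := cgwE p t 0 d.+1; rewrite addn0 => ->.
  have := cgwE p.+1 t 0 d; rewrite addn0 => E.
  rewrite (_ : d.+1 + p = d + p.+1)%N ?E; last by lia.
  rewrite (_ : d + p.+1 - d = p.+1)%N; last by lia.
  rewrite (_ : d + p.+1 + t + d - 2 * d = (p + t).+1)%N; last by lia.
  by natfact; field; nzsum factR_neq0.
case: w ws wd es => [|w] ws wd es.
  subst; rewrite addr0 muln0 !subn0 add0n.
  have := cgwE p t d.+1 0; have := cgwE p t d 0.
  rewrite !add0n => -> ->.
  by natfact; field; nzsum factR_neq0.
have [e ed] : exists p, (d = w.+1 + p)%N by exists (d - w.+1)%N; lia.
subst.
rewrite (_ : (w.+1 + e).+1 = w.+1 + e.+1)%N ?cgwE; last by lia.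
rewrite (_ : w.+1 + p = w + p.+1)%N; last by lia.
rewrite (_ : w.+1 + e = w + e.+1)%N ?cgwE; last by lia.
rewrite (_ : w + p.+1 + t + (w + e.+1) - 2 * w = (p + t + e).+2)%N; last by lia.
rewrite (_ : w + p.+1 + t + (w + e.+1) - 2 * w.+1 = (p + t + e))%N; last by lia.
rewrite (_ : t + (w + e.+1) - w.+1 = t + e)%N; last by lia.
rewrite (_ : w + p.+1 - w = p.+1)%N; last by lia.
by natfact; field; nzsum factR_neq0.
Qed.

(** Induction on d: by [cgw_dS] the mass at w splits into the shares t + d - w + 1 and s - w of s +
    t + d - 2w + 1, so the total is preserved. *)
Lemma sum_cgw s t d n : (minn s d <= n)%N -> \sum_(w < n.+1) cgw s t d w = 1.
Proof.
move=> le_n.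
(* A range at least as long as d leaves room for the index that each induction step adds; indices
   beyond the support carry weight zero. *)
suff sum_max e m : (e <= m)%N -> \sum_(w < m.+1) cgw s t e w = 1.
  rewrite -(sum_max d (maxn n d)) ?leq_maxr //.
  symmetry; apply: sum_ord_ext => [|w]; first by lia.
  by move=> ?; rewrite cgw0 //; lia.
elim: e m => [|e IHe] m em.
  rewrite big_ord_recl cgw_d0 big1 ?addr0 // => i _.
  by rewrite cgw_d0.
case: m em => // m em.
under eq_bigr do rewrite cgw_dS.
rewrite big_split /= [X in X + _]big_ord_recr /= [cgw s t e m.+1]cgw0; last by lia.
rewrite !mul0r addr0 [X in _ + X]big_ord_recl /= add0r -big_split /=.
rewrite -[RHS](IHe m) //; apply: eq_bigr => w _.
have [ws|sw] := leqP w s; last by rewrite cgw0 ?mul0r ?addr0 //; lia.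
have [we|ew] := leqP w e; last by rewrite cgw0 ?mul0r ?addr0 //; lia.
rewrite -mulrDl -mulrDr -natrD.
rewrite (_ : _ + _ = (s + t + e - 2 * w).+1)%N; last by lia.
by rewrite mulfK // pnatr_eq0.
Qed.

(** Weighting by the first moment factor turns a one into a zero, with s + t + d unchanged. This
    drives the induction for the moments. *)
Lemma cgw_shift s t d w :
  cgw s.+1 t d w * ((s.+1%:R - w%:R) * ((t + d).+1%:R - w%:R)) =
  (s.+1 * t.+1)%:R * cgw s t.+1 d w.
Proof.
have [wd|dw] := leqP w d; last by rewrite !cgw0 ?mul0r ?mulr0 //; lia.
have [e ed] : exists p, (d = w + p)%N by exists (d - w)%N; lia.
have [|ws] := leqP w s; last first.
  rewrite [cgw s _ _ _]cgw0; last by lia.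
  have [->|?] := eqVneq w s.+1; first by rewrite subrr !(mul0r, mulr0).
  by rewrite cgw0 ?mul0r ?mulr0 //; lia.
move=> ws; have [p es] : exists p, (s = w + p)%N by exists (s - w)%N; lia.
subst; rewrite (_ : (w + p).+1 = w + p.+1)%N ?cgwE; last by lia.
by natfact; field; nzsum factR_neq0.
Qed.

(** Each factor is (s - h)(t + d + 1 + h) minus w (s + t + d + 1 - w), that is, a root minus a
    Casimir value. The right side is the normalised squared norm of the Dicke state lowered i
    times. *)
Lemma cgw_moment s t d i n : (minn s d <= n)%N ->
  \sum_(w < n.+1) cgw s t d w *
     \prod_(h < i) ((s%:R - h%:R - w%:R) * ((t + d).+1%:R + h%:R - w%:R)) =
  \prod_(h < i) ((s%:R - h%:R) * (t.+1%:R + h%:R)).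
Proof.
elim: i s t => [|i IHi] s t le_n.
  by rewrite big_ord0 -[RHS](sum_cgw t le_n); apply: eq_bigr => w _; rewrite big_ord0 mulr1.
have step (x y z : F) : \prod_(h < i.+1) ((x + 1 - h%:R - z) * (y + h%:R - z)) =
    (x + 1 - z) * (y - z) * \prod_(h < i) ((x - h%:R - z) * (y + 1 + h%:R - z)).
  rewrite big_ord_recl /= subr0 addr0; congr (_ * _); apply: eq_bigr => h _.
  by rewrite /bump /= add1n -natr1; congr (_ * _); ring.
case: s le_n => [|s] le_n.
  rewrite [RHS]big_ord_recl /= subr0 !mul0r big1 // => w _.
  rewrite big_ord_recl /= !mulrA; case: (val w) => [|v].
    by rewrite !subr0 !(mulr0, mul0r).
  by rewrite cgw0 ?mul0r.
under eq_bigr => w _ do rewrite -[s.+1%:R]natr1 step natr1 mulrA cgw_shift -mulrA.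
rewrite -mulr_sumr -[t.+1%:R]subr0 -[s.+1%:R]natr1.
have -> : \prod_(h < i.+1) ((s%:R + 1 - h%:R) * (t.+1%:R - 0 + h%:R)) =
   \prod_(h < i.+1) ((s%:R + 1 - h%:R - 0) * (t.+1%:R + h%:R - 0)) :> F.
  by apply: eq_bigr => h _; rewrite !subr0.
rewrite step !subr0 [s%:R + 1]natr1 -natrM natr1; congr (_ * _).
under eq_bigr => w _ do rewrite -addSn.
rewrite IHi; last by move: le_n; rewrite !geq_min; lia.
by apply: eq_bigr => h _; rewrite !subr0 natr1.
Qed.
End CouplingWeights.

(** * Ladder operators on bit strings *)

(** The newest root comes first, so that [descendingS] peels off the outermost factor of [kprod]. *)
Definition descending (T : Type) (z : nat -> T) j := rev (mkseq z j).

Lemma descendingS T (z : nat -> T) j : descending z j.+1 = z j :: descending z j.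
Proof. by rewrite /descending mkseqS rev_rcons. Qed.

Section Ladder.
Variables (F : numFieldType) (n : nat).
Implicit Types (S : {set 'I_n}) (b : Tn n) (f g : Tn n -> F).

Definition flip (i : 'I_n) b : Tn n := [ffun j => if j == i then ~~ b j else b j].
Definition ones S b := #|[set i in S | b i]|.
Definition zeros S b := #|[set i in S | ~~ b i]|.
Definition raise S f : Tn n -> F := fun b => \sum_(i in S | b i) f (flip i b).
Definition lower S f : Tn n -> F := fun b => \sum_(i in S | ~~ b i) f (flip i b).
(* On all sites this is n(n-1)/2 minus the class sum of the transpositions. *)
Definition kap S f : Tn n -> F := fun b =>
  2^-1 * \sum_(i in S) \sum_(j in S) (f b - f (actb (tperm i j) b)).
Definition dotf f g : F := \sum_b f b * g b.
Definition has_ones S m f := forall b, f b != 0 -> ones S b = m.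

Lemma flipK i : involutive (flip i).
Proof. by move=> b; apply/ffunP=> j; rewrite !ffunE; case: eqP => // _; rewrite negbK. Qed.

Lemma flip_at i b : flip i b i = ~~ b i. Proof. by rewrite ffunE eqxx. Qed.

Lemma flip_ne i j b : j != i -> flip i b j = b j.
Proof. by rewrite ffunE => /negbTE ->. Qed.

Lemma flipC i j b : flip i (flip j b) = flip j (flip i b).
Proof. by apply/ffunP=> h; rewrite !ffunE; case: (h == i); case: (h == j). Qed.

Lemma flip_flip i j b : b i -> ~~ b j -> flip i (flip j b) = actb (tperm i j) b.
Proof.
move=> bi bj; have ij : i != j by apply: contraNneq bj => <-.
apply/ffunP=> h; rewrite !ffunE tpermV.
case: tpermP => [->|->|/eqP/negbTE-> /eqP/negbTE->//]; rewrite ?eqxx.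
  by rewrite (negbTE ij) bi (negbTE bj).
by rewrite eq_sym (negbTE ij) bi (negbTE bj).
Qed.

Lemma actb_tperm_id i j b : b i = b j -> actb (tperm i j) b = b.
Proof. by move=> bij; apply/ffunP=> h; rewrite ffunE tpermV; case: tpermP => [->|->|]. Qed.

Lemma actb_flip (s : {perm 'I_n}) i b : actb s (flip i b) = flip (s i) (actb s b).
Proof. by apply/ffunP=> h; rewrite !ffunE (canF_eq (permKV s)). Qed.

Lemma ones_flip S i b : i \in S -> b i -> ones S b = (ones S (flip i b)).+1.
Proof.
move=> iS bi; rewrite /ones (cardsD1 i) inE iS bi add1n; congr _.+1.
apply: eq_card => j; rewrite !inE; have [->|ji] := eqVneq j i.
  by rewrite flip_at bi andbF.
by rewrite flip_ne.
Qed.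

Lemma ones_zeros S b : (ones S b + zeros S b = #|S|)%N.
Proof.
rewrite /ones /zeros -(cardsID [set i | b i] S).
by congr (_ + _)%N; apply: eq_card => i; rewrite !inE andbC.
Qed.

(** Pairs with equal bits contribute zero and each unequal pair occurs twice, which absorbs the
    factor 1/2. *)
Lemma kapE S f b : kap S f b =
  \sum_(i in S | b i) \sum_(j in S | ~~ b j) (f b - f (actb (tperm i j) b)).
Proof.
rewrite /kap; pose D i j := f b - f (actb (tperm i j) b).
have D0 i j : b i = b j -> D i j = 0 by move=> bij; rewrite /D actb_tperm_id // subrr.
have Dsym i j : D i j = D j i by rewrite /D tpermC.
rewrite -/(D _ _) (bigID (fun i => b i)) /=.
have -> : \sum_(i in S | b i) \sum_(j in S) D i j = \sum_(i in S | b i) \sum_(j in S | ~~ b j) D i j.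
  apply: eq_bigr => i /andP[_ bi]; rewrite [LHS](bigID (fun i => b i)) /= big1 ?add0r //.
  by move=> j /andP[_ bj]; rewrite D0 // bi bj.
have -> : \sum_(i in S | ~~ b i) \sum_(j in S) D i j = \sum_(i in S | b i) \sum_(j in S | ~~ b j) D i j.
  rewrite [RHS]exchange_big /=; apply: eq_bigr => i /andP[_ bi].
  rewrite [LHS](bigID (fun i => b i)) /= [X in _ + X]big1 ?addr0.
    by apply: eq_bigr => j _; rewrite Dsym.
  by move=> j /andP[_ bj]; rewrite D0 // (negbTE bi) (negbTE bj).
by rewrite -[X in X + X]mulr1 -mulrDr mulrCA mulVf ?mulr1 // pnatr_eq0.
Qed.

Lemma sum_ones S b (c : F) : \sum_(i in S | b i) c = (ones S b)%:R * c.
Proof. by rewrite sumr_const -[LHS]mulr_natl; congr (_%:R * _); apply: eq_card => i; rewrite !inE. Qed.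

Lemma sum_zeros S b (c : F) : \sum_(i in S | ~~ b i) c = (zeros S b)%:R * c.
Proof. by rewrite sumr_const -[LHS]mulr_natl; congr (_%:R * _); apply: eq_card => i; rewrite !inE. Qed.

(** Flipping the same site twice returns f b once per zero; flipping two different sites is a
    transposition of a one and a zero, hence f b minus a term of [kapE]. *)
Lemma lower_raise S f b :
  lower S (raise S f) b = (zeros S b)%:R * (ones S b).+1%:R * f b - kap S f b.
Proof.
have -> : lower S (raise S f) b = \sum_(j in S | ~~ b j)
    (f b + \sum_(i in S | b i) f (actb (tperm i j) b)).
  apply: eq_bigr => j /andP[jS bj]; rewrite /raise (bigD1 j) /=; last by rewrite jS flip_at.
  rewrite flipK; congr (_ + _); apply: eq_big => i.
    have [->|ij] := eqVneq i j; first by rewrite (negbTE bj) !andbF.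
    by rewrite flip_ne // andbT.
  by move=> /andP[/andP[_ bi] ij]; rewrite flip_flip //; rewrite flip_ne in bi.
rewrite kapE big_split /= exchange_big /= sum_zeros.
under [X in _ - X]eq_bigr do rewrite sumrB sum_zeros.
by rewrite sumrB sum_ones -natr1; ring.
Qed.

Lemma raise_lower S f b :
  raise S (lower S f) b = (ones S b)%:R * (zeros S b).+1%:R * f b - kap S f b.
Proof.
have -> : raise S (lower S f) b = \sum_(i in S | b i)
    (f b + \sum_(j in S | ~~ b j) f (actb (tperm i j) b)).
  apply: eq_bigr => i /andP[iS bi]; rewrite /lower (bigD1 i) /=; last by rewrite iS flip_at bi.
  rewrite flipK; congr (_ + _); apply: eq_big => j.
    have [->|ji] := eqVneq j i; first by rewrite bi !andbF.
    by rewrite flip_ne // andbT.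
  by move=> /andP[/andP[_ bj] ji]; rewrite flip_ne // in bj; rewrite flipC flip_flip.
rewrite kapE big_split /= sum_ones.
under [X in _ - X]eq_bigr do rewrite sumrB sum_zeros.
by rewrite sumrB sum_ones -natr1; ring.
Qed.

Lemma sum_flip i (P : pred (Tn n)) (h : Tn n -> F) :
  \sum_(b | P (flip i b)) h (flip i b) = \sum_(b | P b) h b.
Proof. by rewrite [RHS](reindex_inj (can_inj (flipK i))). Qed.

Lemma dotf_raise S f g : dotf (raise S f) g = dotf f (lower S g).
Proof.
rewrite /dotf /raise /lower.
under eq_bigr do rewrite mulr_suml.
under [RHS]eq_bigr do rewrite mulr_sumr.
rewrite [LHS](exchange_big_dep (mem S)) /=; last by move=> ? ? _ /andP[].
rewrite [RHS](exchange_big_dep (mem S)) /=; last by move=> ? ? _ /andP[].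
apply: eq_bigr => i iS; rewrite -(sum_flip i) /=.
apply: eq_big => [b|b _]; first by rewrite iS flip_at.
by rewrite flipK.
Qed.

Lemma raise_actb S f (s : {perm 'I_n}) : (forall i, (s i \in S) = (i \in S)) ->
  raise S (fun b => f (actb s b)) = (fun b => raise S f (actb s b)).
Proof.
move=> sS; apply/funext => b; rewrite /raise [RHS](reindex_inj (@perm_inj _ s)) /=.
apply: eq_big => i; first by rewrite sS ffunE permK.
by move=> _; rewrite actb_flip.
Qed.

Lemma lower_actb S f (s : {perm 'I_n}) : (forall i, (s i \in S) = (i \in S)) ->
  lower S (fun b => f (actb s b)) = (fun b => lower S f (actb s b)).
Proof.
move=> sS; apply/funext => b; rewrite /lower [RHS](reindex_inj (@perm_inj _ s)) /=.
apply: eq_big => i; first by rewrite sS ffunE permK.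
by move=> _; rewrite actb_flip.
Qed.

Lemma tperm_stable S i j : i \in S -> j \in S -> forall h, (tperm i j h \in S) = (h \in S).
Proof. by move=> iS jS h; case: tpermP => // ->; rewrite iS jS. Qed.

Lemma kapZD S c f g : kap S (fun b => c * f b + g b) = (fun b => c * kap S f b + kap S g b).
Proof.
apply/funext => b; rewrite /kap mulrCA -mulrDr; congr (_ * _).
rewrite mulr_sumr -big_split; apply: eq_bigr => i _ /=.
by rewrite mulr_sumr -big_split; apply: eq_bigr => j _ /=; ring.
Qed.

(** [kap] is built from transpositions inside S, and [lower] commutes with every permutation
    preserving S. *)
Lemma kap_lower S f : kap S (lower S f) = lower S (kap S f).
Proof.
apply/funext => b; rewrite /kap [RHS]/lower -mulr_sumr; congr (_ * _).
rewrite [RHS]exchange_big /=; apply: eq_bigr => i iS; rewrite [RHS]exchange_big /=.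
apply: eq_bigr => j jS; rewrite sumrB; congr (_ - _).
have /(congr1 (@^~ b)) := lower_actb f (tperm_stable iS jS).
by rewrite /= => <-.
Qed.

Lemma kap_raise S f : kap S (raise S f) = raise S (kap S f).
Proof.
apply/funext => b; rewrite /kap [RHS]/raise -mulr_sumr; congr (_ * _).
rewrite [RHS]exchange_big /=; apply: eq_bigr => i iS; rewrite [RHS]exchange_big /=.
apply: eq_bigr => j jS; rewrite sumrB; congr (_ - _).
have /(congr1 (@^~ b)) := raise_actb f (tperm_stable iS jS).
by rewrite /= => <-.
Qed.

Lemma has_ones_raise S m f : has_ones S m f -> has_ones S m.+1 (raise S f).
Proof.
move=> fm b; apply: contra_neq_eq => bm; apply: big1 => i /andP[iS bi].
by apply: contra_neq_eq bm => /fm <-; rewrite (ones_flip iS bi).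
Qed.

Lemma has_ones_lower S m f : has_ones S m.+1 f -> has_ones S m (lower S f).
Proof.
move=> fm b; apply: contra_neq_eq => bm; apply: big1 => i /andP[iS bi].
apply: contra_neq_eq bm => /fm; rewrite (ones_flip (i := i)) ?flip_at //.
by rewrite flipK => -[].
Qed.

Lemma lower_0 S f : has_ones S 0 f -> lower S f = fun=> 0.
Proof.
move=> f0; apply/funext => b; apply: big1 => i /andP[iS bi]; apply/eqP; apply: contraTT isT.
by move=> /f0; rewrite (ones_flip (i := i)) ?flip_at.
Qed.

(** A polynomial in [kap] given by its roots; in this form expectations are affine in each root. *)
Definition kprod S (zs : seq F) f := foldr (fun z g b => z * g b - kap S g b) f zs.

Lemma kprodZD S zs c f g :
  kprod S zs (fun b => c * f b + g b) = (fun b => c * kprod S zs f b + kprod S zs g b).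
Proof.
elim: zs => //= z zs ->; apply/funext => b; rewrite kapZD /=; ring.
Qed.

Lemma kprod_cat S zs1 zs2 f : kprod S (zs1 ++ zs2) f = kprod S zs1 (kprod S zs2 f).
Proof. by rewrite /kprod foldr_cat. Qed.

(** The scalar of [lower_raise] after h raisings of a state with m ones: its zeros times its ones
    plus one. [muL] is the scalar of [raise_lower] after h lowerings. *)
Definition muR S m h : F := (#|S|%:R - m%:R - h%:R) * (m.+1%:R + h%:R).
Definition muL S m h : F := (m%:R - h%:R) * ((#|S|%:R - m%:R + 1) + h%:R).

Lemma kap_iter_lower S f j : kap S (iter j (lower S) f) = iter j (lower S) (kap S f).
Proof. by elim: j => //= j IH; rewrite kap_lower IH. Qed.

Lemma kap_iter_raise S f j : kap S (iter j (raise S) f) = iter j (raise S) (kap S f).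
Proof. by elim: j => //= j IH; rewrite kap_raise IH. Qed.

Lemma iter_lowerZB S j c f g : iter j (lower S) (fun b => c * f b - g b) =
  (fun b => c * iter j (lower S) f b - iter j (lower S) g b).
Proof.
elim: j => //= j ->; apply/funext => b.
by rewrite /lower mulr_sumr -sumrB.
Qed.

Lemma iter_raiseZB S j c f g : iter j (raise S) (fun b => c * f b - g b) =
  (fun b => c * iter j (raise S) f b - iter j (raise S) g b).
Proof.
elim: j => //= j ->; apply/funext => b.
by rewrite /raise mulr_sumr -sumrB.
Qed.

Lemma has_ones_iter_raise S m f j : has_ones S m f -> has_ones S (m + j) (iter j (raise S) f).
Proof. by move=> fm; elim: j => [|j IH]; rewrite ?addn0 // addnS; apply: has_ones_raise. Qed.

(** The innermost [lower] after [raise] acts on m + j ones, so it is [muR S m j] minus [kap]; since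
    [kap] commutes with the ladder operators, this factor moves outside. *)
Lemma kprod_raise S m f j : has_ones S m f ->
  iter j (lower S) (iter j (raise S) f) = kprod S (descending (muR S m) j) f.
Proof.
move=> fm; elim: j => // j IH; rewrite descendingS /= -IH kap_iter_lower.
set g := iter j (raise S) f; have gm : has_ones S (m + j) g by exact: has_ones_iter_raise.
rewrite -iterS iterSr -/g.
have -> : lower S (raise S g) = fun b => muR S m j * g b - kap S g b.
  apply/funext => b; rewrite lower_raise; congr (_ - _).
  have [->|/gm gb] := eqVneq (g b) 0; first by rewrite !mulr0.
  by rewrite /muR -(ones_zeros S b) gb -!natr1 !natrD; ring.
by rewrite iter_lowerZB; apply/funext => b; rewrite /g kap_iter_raise.
Qed.

Lemma kprod_lower S m f j : has_ones S m f ->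
  iter j (raise S) (iter j (lower S) f) = kprod S (descending (muL S m) j) f.
Proof.
move=> fm; elim: j => // j IH; rewrite descendingS /= -IH kap_iter_raise.
set g := iter j (lower S) f.
have gm : forall b, g b != 0 -> (ones S b + j)%N = m.
  rewrite /g; elim: j {IH g} => [|j IH] b /=; first by rewrite addn0; apply: fm.
  apply: contra_neq_eq => bm; apply: big1 => i /andP[iS bi].
  apply: contra_neq_eq bm => /IH; rewrite (ones_flip (i := i)) ?flip_at //.
  by rewrite flipK addSnnS.
rewrite -iterS iterSr -/g.
have -> : raise S (lower S g) = fun b => muL S m j * g b - kap S g b.
  apply/funext => b; rewrite raise_lower; congr (_ - _).
  have [->|/gm gb] := eqVneq (g b) 0; first by rewrite !mulr0.
  by rewrite /muL -(ones_zeros S b) -gb -!natr1 !natrD; ring.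
by rewrite iter_raiseZB; apply/funext => b; rewrite /g kap_iter_lower.
Qed.

Lemma dotf_iter_raise S f g j :
  dotf (iter j (raise S) f) g = dotf f (iter j (lower S) g).
Proof. by elim: j g => // j IH g; rewrite iterS dotf_raise IH -iterSr. Qed.

Lemma dotfC f g : dotf f g = dotf g f.
Proof. by apply: eq_bigr => b _; rewrite mulrC. Qed.

Lemma dotf_kprod_raise S m f j : has_ones S m f ->
  dotf f (kprod S (descending (muR S m) j) f) = dotf (iter j (raise S) f) (iter j (raise S) f).
Proof. by move=> fm; rewrite -(kprod_raise j fm) dotf_iter_raise. Qed.

Lemma dotf_kprod_lower S m f j : has_ones S m f ->
  dotf f (kprod S (descending (muL S m) j) f) = dotf (iter j (lower S) f) (iter j (lower S) f).
Proof. by move=> fm; rewrite -(kprod_lower j fm) dotfC dotf_iter_raise. Qed.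

(** Affinity in one root, with slope the value of the list without it: the hypothesis of
    [root_functional_eq]. *)
Lemma dotf_kprod_swap S f zs1 zs2 z z' :
  dotf f (kprod S (zs1 ++ z :: zs2) f) =
  dotf f (kprod S (zs1 ++ z' :: zs2) f) + (z - z') * dotf f (kprod S (zs1 ++ zs2) f).
Proof.
rewrite !kprod_cat /=; set g := kprod S zs2 f.
have -> : (fun b => z * g b - kap S g b) =
    (fun b => (z - z') * g b + (z' * g b - kap S g b)) by apply/funext => b; ring.
rewrite kprodZD /dotf mulr_sumr -big_split; apply: eq_bigr => b _ /=; ring.
Qed.

End Ladder.

(* Newton interpolation: a functional on root lists that is affine in each root
   is determined by its values on the lists z_0, ..., z_(j-1). *)
Lemma root_functional_eq (F : nzRingType) (phi psi : seq F -> F) (nu : nat -> F) :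
  (forall s1 s2 z z', phi (s1 ++ z :: s2) = phi (s1 ++ z' :: s2) + (z - z') * phi (s1 ++ s2)) ->
  (forall s1 s2 z z', psi (s1 ++ z :: s2) = psi (s1 ++ z' :: s2) + (z - z') * psi (s1 ++ s2)) ->
  (forall j, phi (descending nu j) = psi (descending nu j)) -> phi =1 psi.
Proof.
move=> phiS psiS eq_nu zs; rewrite -[zs]cats0 -[[::]]/(descending nu 0).
(* The list is a free prefix followed by j nodes. Exchanging the last free root for [nu j] lengthens
   the nodes, and the correction term has the shorter prefix, so the induction covers both. *)
elim/last_ind: zs 0%N => [|zs z IH] j; first exact: eq_nu.
by rewrite cat_rcons (phiS _ _ _ (nu j)) (psiS _ _ _ (nu j)) -descendingS !IH.
Qed.

Lemma sum_roots_swap (F : comNzRingType) (I : finType) (p e : I -> F) zs1 zs2 z z' :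
  \sum_i p i * \prod_(y <- zs1 ++ z :: zs2) (y - e i) =
  \sum_i p i * \prod_(y <- zs1 ++ z' :: zs2) (y - e i)
  + (z - z') * \sum_i p i * \prod_(y <- zs1 ++ zs2) (y - e i).
Proof.
rewrite mulr_sumr -big_split; apply: eq_bigr => i _ /=.
rewrite !big_cat /= !big_cons; ring.
Qed.

Lemma prod_descending (F : comNzRingType) (nu : nat -> F) (e : F) j :
  \prod_(y <- descending nu j) (y - e) = \prod_(h < j) (nu h - e).
Proof.
elim: j => [|j IH]; first by rewrite big_nil big_ord0.
by rewrite descendingS big_cons IH big_ord_recr /= mulrC.
Qed.

(** * The Dicke state *)

Lemma sum_triangle (V : nmodType) (f : nat -> nat -> V) X :
  \sum_(x < X) \sum_(y < x.+1) f y (x - y)%N = \sum_(y < X) \sum_(w < X - y) f y w.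
Proof.
under eq_bigr => x _ do rewrite (big_ord_widen X (fun y => f y (x - y)%N)) //.
rewrite (exchange_big_dep xpredT) //=; apply: eq_bigr => y _.
rewrite -(big_mkord (fun x => (y < x.+1)%N) (fun x => f y (x - y)%N)).
rewrite -(big_mkord xpredT (f y)) (big_cat_nat (n := y)) //=; last exact: ltnW.
rewrite [X in X + _]big_nat_cond big1 ?add0r; last by move=> i; lia.
rewrite big_nat_cond (eq_bigl (fun i => (y <= i < X)%N)); last by move=> i; lia.
rewrite -big_nat -{1}[val y]add0n big_addn; apply: eq_bigr => w _.
by rewrite addnK.
Qed.

(* After the first coupling to shape (_,y), the state left is a Dicke state with
   M - y ones and N + q - y zeros; coupling it with |1>^l exchanges 0 and 1. *)
Definition coupled_weight (F : numFieldType) l q M N x : F :=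
  \sum_(y < x.+1) cgw F M N q y * cgw F (N + q - y) (M - y) l (x - y).

(** The eigenvalue of [kap] on shape (n-x,x): with spin j = n/2 - x it is (n/2)(n/2 + 1) - j(j +
    1). *)
Definition casimir (F : numFieldType) n (x : nat) : F := x%:R * (n%:R + 1 - x%:R).

Lemma sum_coupled_weight (F : numFieldType) l q M N X (g : nat -> F) :
  (minn (M + l) (N + q) < X)%N ->
  \sum_(x < X) coupled_weight F l q M N x * g x =
  \sum_(y < X) cgw F M N q y * \sum_(w < X) cgw F (N + q - y) (M - y) l w * g (y + w)%N.
Proof.
move=> leX; pose f y w := cgw F M N q y * cgw F (N + q - y) (M - y) l w * g (y + w)%N.
transitivity (\sum_(x < X) \sum_(y < x.+1) f y (x - y)%N).
  apply: eq_bigr => x _; rewrite /coupled_weight mulr_suml; apply: eq_bigr => y _.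
  by rewrite /f subnKC // -ltnS.
rewrite sum_triangle; apply: eq_bigr => y _; rewrite mulr_sumr.
transitivity (\sum_(w < X) f y w); last by apply: eq_bigr => w _; rewrite mulrA.
symmetry; apply: (@sum_ord_ext _ (f y)) => [|w]; first exact: leq_subr.
rewrite /f; have [?|?] := boolP ((y <= M) && (y <= q))%N; last by rewrite cgw0 ?mul0r.
by move=> ?; rewrite [X in _ * X * _]cgw0 ?mulr0 ?mul0r //; lia.
Qed.

Definition suffix n h : {set 'I_n} := [set i : 'I_n | (h <= i)%N].

Lemma card_suffix n h : (h <= n)%N -> #|suffix n h| = (n - h)%N.
Proof.
move=> hn; have card_prefix : #|~: suffix n h| = h.
  rewrite -sum1_card (eq_bigl (fun i : 'I_n => (i < h)%N)); last first.
    by move=> i; rewrite !inE -ltnNge.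
  by rewrite -(big_ord_widen n (fun=> 1%N) hn) sum1_card card_ord.
have := cardsC (suffix n h); rewrite card_prefix card_ord; lia.
Qed.

Section DickeState.
Variables (F : numFieldType) (n l k M : nat).
Hypotheses (lk : (l <= k)%N) (kn : (k <= n)%N) (Mr : (M <= n - k)%N).
Implicit Types b : Tn n.

Local Notation suffix := (suffix n).

Definition prefix_ok b :=
  [forall i : 'I_n, ((i < l)%N ==> b i) && (((l <= i)%N && (i < k)%N) ==> ~~ b i)].
(** [Xi] without its normalising constant, for any number j of ones on the last n - k sites. *)
Definition dicke j b : F :=
  (prefix_ok b && (#|[set i : 'I_n | (k <= i)%N && b i]| == j)%N)%:R.
Lemma dickeE j b : dicke j b = (prefix_ok b && (ones (suffix k) b == j))%:R.
Proof.
rewrite /dicke /ones; congr (nat_of_bool (_ && (_ == _)))%:R.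
by apply: eq_card => i; rewrite !inE.
Qed.

Lemma prefix_okP b : reflect
  ((forall i : 'I_n, (i < l)%N -> b i) /\ (forall i : 'I_n, (l <= i < k)%N -> ~~ b i)) (prefix_ok b).
Proof.
apply: (iffP forallP) => [H|[H1 H2] i].
  by split=> i Hi; have /andP[/implyP a1 /implyP a2] := H i; [apply: a1|apply: a2].
by apply/andP; split; apply/implyP; [apply: H1|apply: H2].
Qed.

Lemma prefix_ok_flip (i : 'I_n) b : (k <= i)%N -> prefix_ok (flip i b) = prefix_ok b.
Proof.
move=> ki; have ne (j : 'I_n) : (j < k)%N -> j != i by apply: contraTneq => ->; rewrite -leqNgt.
apply/prefix_okP/prefix_okP => -[H1 H2]; split=> j jl.
- by rewrite -(flip_ne _ (ne j _)) ?H1 //; apply: leq_trans lk.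
- by rewrite -(flip_ne _ (ne j _)) ?H2 //; case/andP: jl.
- by rewrite flip_ne ?H1 // ne //; apply: leq_trans lk.
by rewrite flip_ne ?H2 // ne //; case/andP: jl.
Qed.

(** Sites between l and k contribute nothing, because a one there leaves the support; lowering on
    the suffix from l thus only counts the zeros among the last n - k sites. *)
Lemma lower_dicke j : lower (suffix l) (dicke j.+1) = fun b => (n - k - j)%:R * dicke j b.
Proof.
apply/funext => b.
transitivity (\sum_(i in suffix k | ~~ b i) dicke j b); last first.
  rewrite sum_zeros dickeE; case: andP => [[_ /eqP onesb]|]; last by rewrite !mulr0.
  by rewrite !mulr1 -(card_suffix kn) -(ones_zeros (suffix k) b) onesb addKn.
rewrite /lower [RHS]big_mkcond [LHS]big_mkcond; apply: eq_bigr => i _ /=; rewrite !inE.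
have [bi|nbi] := boolP (b i); first by rewrite !andbF.
rewrite !andbT; have [ki|ik] := leqP k i; last first.
  case: ifP => // li; rewrite /dicke; case: prefix_okP => // -[_ /(_ i)].
  by rewrite li ik flip_at nbi => /(_ isT).
rewrite (leq_trans lk ki) !dickeE prefix_ok_flip // (ones_flip (i := i) (b := flip i b)).
- by rewrite flipK eqSS.
- by rewrite inE.
- by rewrite flip_at.
Qed.

Lemma prefix_ones b : prefix_ok b ->
  ones (suffix l) b = ones (suffix k) b /\ ones (suffix 0) b = (l + ones (suffix k) b)%N.
Proof.
move=> /prefix_okP[H1 H2].
have e : ones (suffix l) b = ones (suffix k) b.
  apply: eq_card => i; rewrite !inE; have [bi|] := boolP (b i); last by rewrite !andbF.
  rewrite !andbT; apply/idP/idP => [li|]; last exact: leq_trans.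
  by rewrite leqNgt; apply: contraL bi => ik; apply: H2; rewrite li.
split=> //; rewrite -e /ones -(cardsID (suffix l) [set i in suffix 0 | b i]) addnC.
have ln := leq_trans lk kn.
congr (_ + _)%N; last by apply: eq_card => i; rewrite !inE andbC.
transitivity #|~: suffix l|.
  apply: eq_card => i; rewrite !inE; case: (leqP l i) => //= /H1 ->//.
by have := cardsC (suffix l); rewrite card_suffix // card_ord; lia.
Qed.

Lemma dicke_ones j : has_ones (suffix l) j (dicke j).
Proof.
move=> b; rewrite dickeE; case: andP => [[/prefix_ones[-> _] /eqP->]//|].
by rewrite eqxx.
Qed.

Lemma dicke_onesT j : has_ones (suffix 0) (l + j) (dicke j).
Proof.
move=> b; rewrite dickeE; case: andP => [[/prefix_ones[_ ->] /eqP->]//|].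
by rewrite eqxx.
Qed.

(** This is where |1>^l enters: raising kills a site that already holds a one, so raising on all
    sites reduces to raising on the last n - l. *)
Lemma iter_raise_prefix (f : Tn n -> F) j : (forall b, f b != 0 -> forall i : 'I_n, (i < l)%N -> b i) ->
  iter j (raise (suffix 0)) f = iter j (raise (suffix l)) f.
Proof.
move=> f0; elim: j => //= j ->; set g := iter j _ _.
have g0 : forall b, g b != 0 -> forall i : 'I_n, (i < l)%N -> b i.
  rewrite /g; elim: j {g} => //= j IH b; set h := iter j _ _ in IH *.
  move=> gb i il; apply: contraNT gb => bi; apply/eqP/big1 => i' /andP[].
  rewrite inE => li' bi'; apply/eqP; apply: contraNT bi => /IH /(_ i il).
  by rewrite flip_ne //; apply: contraTneq il => ->; rewrite -leqNgt.
apply/funext => b; rewrite /raise (bigID [in suffix l]) /= [X in _ + X]big1 ?addr0.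
  by apply: eq_bigl => i; rewrite !inE andbC.
move=> i /andP[/andP[_ bi]]; rewrite inE -ltnNge => il.
by apply/eqP; apply: contraTT bi => /g0 /(_ i il); rewrite flip_at.
Qed.

Lemma dotf_dicke j : dotf (dicke j) (dicke j) = 'C(n - k, j)%:R.
Proof.
rewrite -(card_suffix kn) -cards_draws -sum1_card natr_sum.
pose B (A : {set 'I_n}) : Tn n := [ffun i : 'I_n => (i < l)%N || (i \in A)].
rewrite /dotf (bigID (fun b => prefix_ok b && (ones (suffix k) b == j))) /=.
rewrite [X in _ + X]big1 ?addr0; last by move=> b /negbTE nb; rewrite dickeE nb mul0r.
rewrite (reindex_onto B (fun b => [set i in suffix k | b i])) /=; last first.
  move=> b /andP[/prefix_okP[H1 H2] _]; apply/ffunP => i; rewrite ffunE !inE.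
  have [/H1->//|li] := ltnP i l; have [//|ik] := leqP k i.
  by rewrite (negbTE (H2 i _)) // li.
apply: eq_big => [A|A]; last by move=> /andP[/andP[p o] _]; rewrite dickeE p o mulr1.
rewrite !inE; apply/idP/idP => [/andP[/andP[p /eqP o] /eqP eA]|/andP[sA /eqP cA]].
  rewrite -o /ones eA eqxx andbT -eA; apply/fintype.subsetP => i; by rewrite !inE => /andP[].
have eA : [set i in suffix k | B A i] = A.
  apply/setP => i; rewrite !inE ffunE; have [iA|] := boolP (i \in A).
    by have := fintype.subsetP sA i iA; rewrite inE => ->; rewrite orbT.
  by rewrite orbF; have [ki|//] := leqP k i; rewrite ltnNge (leq_trans lk ki).
rewrite eA /ones eA cA !eqxx !andbT; apply/prefix_okP; split=> i; rewrite ffunE; first by move=> ->.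
move=> /andP[li ik]; rewrite ltnNge li /=; apply/negP => /(fintype.subsetP sA).
by rewrite inE leqNgt ik.
Qed.

Local Notation r := (n - k)%N.
Local Notation q := (k - l)%N.
Local Notation N := (n - k - M)%N.

Lemma iter_lower_dicke j : (j <= M)%N -> iter j (lower (suffix l)) (dicke M) =
  fun b => (\prod_(h < j) (N.+1%:R + h%:R) : F) * dicke (M - j)%N b.
Proof.
elim: j => [|j IH] jM; first by apply/funext => b; rewrite big_ord0 mul1r subn0.
have Mj : (M - j = (M - j.+1).+1)%N by clear -jM; lia.
rewrite iterS IH 1?ltnW // Mj.
apply/funext => b; rewrite {1}/lower -mulr_sumr big_ord_recr -mulrA /=.
congr (_ * _); rewrite -/(lower _ _ _) lower_dicke -natrD; congr (_%:R * _); lia.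
Qed.

Lemma iter_lower_dicke0 j : (M < j)%N -> iter j (lower (suffix l)) (dicke M) = fun=> 0.
Proof.
move=> Mj; rewrite -(subnK Mj) iterD iterS iter_lower_dicke //.
set f := (X in lower _ X); have -> : lower (suffix l) f = fun=> 0.
  apply: lower_0 => b; rewrite /f subnn mulf_eq0 negb_or => /andP[_].
  exact: dicke_ones.
by elim: (j - M.+1)%N => //= i ->; apply/funext => b; apply: big1.
Qed.

(** The product is the right side of [cgw_moment] for s = M and t = N. For j > M both sides vanish,
    the product through its factor h = M. *)
Lemma dotf_lower_dicke j :
  dotf (iter j (lower (suffix l)) (dicke M)) (iter j (lower (suffix l)) (dicke M)) =
  'C(r, M)%:R * \prod_(h < j) ((M%:R - h%:R) * (N.+1%:R + h%:R)).
Proof.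
have [jM|Mj] := leqP j M; last first.
  rewrite iter_lower_dicke0 // /dotf big1 => [|b _]; last by rewrite mul0r.
  by rewrite (bigD1 (Ordinal Mj)) //= subrr !mul0r mulr0.
rewrite iter_lower_dicke // /dotf.
transitivity ((\prod_(h < j) (N.+1%:R + h%:R)) ^+ 2 * 'C(r, M - j)%:R : F).
  rewrite -(dotf_dicke (M - j)%N) mulr_sumr; apply: eq_bigr => b _; ring.
rewrite big_split /= expr2 -mulrA mulrA [X in _ = X]mulrA -[RHS]mulrC -!mulrA; congr (_ * _).
suff -> : \prod_(h < j) (N.+1%:R + h%:R) * 'C(r, M - j)%:R =
  'C(r, M)%:R * \prod_(h < j) (M%:R - h%:R) :> F by [].
elim: j jM => [|j IH] jM; first by rewrite !big_ord0 subn0 mul1r mulr1.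
rewrite !big_ord_recr /= mulrA -IH; last exact: ltnW.
rewrite -!mulrA; congr (_ * _); rewrite -natrB 1?ltnW // -natrD -!natrM; congr _%:R.
have -> : (M - j = (M - j.+1).+1)%N by lia.
rewrite [RHS]mulnC mul_bin_left; congr (_ * _)%N; lia.
Qed.

Definition dicke_moment S zs : F := dotf (dicke M) (kprod S zs (dicke M)).

(** On the nodes [muL] the left side is the squared norm of a lowered Dicke state and the right side
    a moment of [cgw]; affinity in the roots does the rest. *)
Lemma dicke_moment_suffix zs :
  dicke_moment (suffix l) zs = 'C(r, M)%:R *
    \sum_(y < M.+1) cgw F M N q y * \prod_(z <- zs) (z - casimir F (n - l) y).
Proof.
have ln := leq_trans lk kn.
pose psi zs := 'C(r, M)%:R *
    \sum_(y < M.+1) cgw F M N q y * \prod_(z <- zs) (z - casimir F (n - l) y).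
apply: (@root_functional_eq _ _ psi (muL F (suffix l) M)) zs => [s1 s2 z z'|s1 s2 z z'|j].
- exact: dotf_kprod_swap.
- by rewrite /psi (sum_roots_swap _ _ _ _ z z') mulrDr mulrCA.
rewrite /dicke_moment (dotf_kprod_lower j (dicke_ones (j := M))) dotf_lower_dicke.
rewrite /psi; congr (_ * _); rewrite -(@cgw_moment _ _ _ q _ M) ?geq_minl //.
apply: eq_bigr => y _; rewrite prod_descending; congr (_ * _); apply: eq_bigr => h _.
rewrite /muL /casimir card_suffix //.
have -> : (n - l = M + N + q)%N by lia.
rewrite -natr1 !natrD; ring.
Qed.

(** Raising serves here, and lowering for the first coupling, because raising kills |1>^l as
    lowering kills |0>^(k-l). Squared norms on all sites become squared norms on the last n - l
    sites, already expressed through the first coupling. *)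
Lemma dicke_moment_all zs X : (minn (M + l) (N + q) < X)%N ->
  dicke_moment (suffix 0) zs = 'C(r, M)%:R *
    \sum_(x < X) coupled_weight F l q M N x * \prod_(z <- zs) (z - casimir F n x).
Proof.
have ln := leq_trans lk kn; move=> leX.
pose psi zs := 'C(r, M)%:R *
    \sum_(x < X) coupled_weight F l q M N x * \prod_(z <- zs) (z - casimir F n x).
apply: (@root_functional_eq _ _ psi (muR F (suffix 0) (l + M))) zs => [s1 s2 z z'|s1 s2 z z'|j].
- exact: dotf_kprod_swap.
- by rewrite /psi (sum_roots_swap _ _ _ _ z z') mulrDr mulrCA.
rewrite /dicke_moment (dotf_kprod_raise j (dicke_onesT (j := M))) iter_raise_prefix; last first.
  by move=> b; rewrite dickeE; case: prefix_okP => [[H _] _|]; [exact: H | rewrite eqxx].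
rewrite -(dotf_kprod_raise j (dicke_ones (j := M))) -/(dicke_moment _ _) dicke_moment_suffix /psi.
congr (_ * _).
rewrite (sum_coupled_weight (fun x => \prod_(z <- descending (muR F (suffix 0) (l + M)) j) (z - casimir F n x)) leX).
have ext (g : nat -> F) Y : (minn M q < Y)%N ->
    \sum_(y < Y) cgw F M N q y * g y = \sum_(y < (minn M q).+1) cgw F M N q y * g y.
  move=> lY; apply: (@sum_ord_ext _ (fun y => cgw F M N q y * g y)) => // y ?.
  by rewrite cgw0 ?mul0r //; lia.
etransitivity.
  apply: (ext (fun y => \prod_(z <- _) (z - casimir F (n - l) y))).
  by rewrite ltnS geq_minl.
etransitivity; last first.
  apply/esym/(ext (fun y => \sum_(w < X) cgw F (N + q - y) (M - y) l w *
    \prod_(z <- _) (z - casimir F n (y + w)))).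
  by apply: leq_trans leX; rewrite ltnS; lia.
apply: eq_bigr => -[y /= +] _; rewrite ltnS leq_min => /andP[yM yq]; congr (_ * _).
(* For fixed y, node minus Casimir value factorises into the right side of [cgw_moment] with N + q -
   y in place of s and M - y in place of t: the second coupling. *)
transitivity (\prod_(h < j) (((N + q - y)%:R - h%:R) * ((M - y).+1%:R + h%:R)) : F).
  rewrite prod_descending; apply: eq_bigr => h _.
  rewrite /muR /casimir card_suffix // (_ : n - l = M + N + q)%N; last by lia.
  have -> : (N + q - y)%:R = N%:R + q%:R - y%:R :> F by rewrite natrB ?natrD //; lia.
  rewrite -!natr1 (natrB _ yM) !natrD. ring.
rewrite -(@cgw_moment _ _ _ l _ X.-1); last by lia.
rewrite prednK; last by apply: leq_ltn_trans leX.
apply: eq_bigr => w _; rewrite prod_descending; congr (_ * _); apply: eq_bigr => h _.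
rewrite /muR /casimir card_suffix // (_ : n - 0 = M + N + q + l)%N; last by lia.
have -> : (N + q - y)%:R = N%:R + q%:R - y%:R :> F by rewrite natrB ?natrD //; lia.
have -> : n%:R = M%:R + N%:R + q%:R + l%:R :> F by rewrite -!natrD; congr _%:R; lia.
by rewrite -!natr1 !natrD (natrB _ yM); ring.
Qed.

End DickeState.

(** * Polytabloids *)

Section Polytabloids.
Variables (F : numFieldType) (n x : nat).
Implicit Types (P : {ffun 'I_x -> 'I_n * 'I_n}) (b c : Tn n) (f g : Tn n -> F).

Definition site P (p : 'I_x * bool) : 'I_n := if p.2 then (P p.1).2 else (P p.1).1.

Lemma pairs_okP P : reflect (injective (site P)) (pairs_ok P).
Proof.
have -> : pairs_ok P = uniq (map (site P) [seq (i, d) | i <- enum 'I_x, d <- [:: false; true]]).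
  by rewrite map_allpairs.
set s := (X in map (site P) X); have sP : perm_eq s (enum {: 'I_x * bool}).
  apply: uniq_perm; rewrite ?enum_uniq //.
    by rewrite allpairs_uniq ?enum_uniq // => -[? ?] [? ?].
  case=> i b; rewrite mem_enum inE; apply/allpairsP; exists (i, b).
  by rewrite mem_enum !inE; case: b.
rewrite (perm_uniq (perm_map (site P) sP)); exact: (iffP (injectiveP _)).
Qed.

Definition halves P (k : 'I_x) := tperm (P k).1 (P k).2.
Definition antisym P f := forall k b, f (actb (halves P k) b) = - f b.
Definition splits P b := forall k, b (P k).1 != b (P k).2.
Definition pair_sign P b : F := \prod_(k < x) ((b (P k).2)%:R - (b (P k).1)%:R).
(* The polytabloid of P on the pairs, tensored with the basis vector c on the
   remaining sites. *)
Definition singlets P c b : F :=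
  pair_sign P b * [forall j, ~~ in_pairs P j ==> (b j == c j)]%:R.
Definition zero_bits : Tn n := [ffun=> false].
Definition bottoms P : Tn n := [ffun j => [exists k, j == (P k).2]].

Lemma pair_sign_splits P b : pair_sign P b != 0 -> splits P b.
Proof.
move=> /prodf_neq0 H k; have := H k isT; apply: contra => /eqP ->.
by rewrite subrr.
Qed.

Lemma antisym_splits P f b : antisym P f -> f b != 0 -> splits P b.
Proof.
move=> fP fb k; apply: contraNneq fb => bk.
have := fP k b; rewrite /halves actb_tperm_id // => /eqP.
by rewrite -addr_eq0 -mulr2n mulrn_eq0.
Qed.

Section Ok.
Variable P : {ffun 'I_x -> 'I_n * 'I_n}.
Hypothesis Pok : injective (site P).

Lemma in_pairsP j : reflect (exists p, j = site P p) (in_pairs P j).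
Proof.
apply: (iffP existsP) => [[k /orP[] /eqP ->]|[[k []] ->]].
- by exists (k, false).
- by exists (k, true).
- by exists k; rewrite eqxx orbT.
by exists k; rewrite eqxx.
Qed.

Lemma halves_site k p : halves P k (site P p) =
  site P (if p.1 == k then (p.1, ~~ p.2) else p).
Proof.
rewrite /halves -[(P k).1]/(site P (k, false)) -[(P k).2]/(site P (k, true)).
case: p => i b /=; have [->|ik] := eqVneq i k; first by case: b; rewrite ?tpermL ?tpermR.
by rewrite tpermD //; apply: contra_neq ik => /Pok[].
Qed.

Lemma halves_out k j : ~~ in_pairs P j -> halves P k j = j.
Proof.
move=> jP; rewrite /halves tpermD //; apply: contraNneq jP => <-; apply/in_pairsP.
  by exists (k, false).
by exists (k, true).
Qed.

Lemma actb_halves k b j : actb (halves P k) b j = b (halves P k j).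
Proof. by rewrite ffunE tpermV. Qed.

Lemma pair_sign_antisym : antisym P (pair_sign P).
Proof.
move=> k b; rewrite /pair_sign (bigD1 k) //= [in RHS](bigD1 k) //= -mulNr.
rewrite !actb_halves -[(P k).1]/(site P (k, false)) -[(P k).2]/(site P (k, true)).
rewrite !halves_site /= eqxx opprB; congr (_ * _); apply: eq_bigr => i ik.
rewrite !actb_halves -[(P i).1]/(site P (i, false)) -[(P i).2]/(site P (i, true)).
by rewrite !halves_site /= (negbTE ik).
Qed.

Lemma singlets_antisym c : antisym P (singlets P c).
Proof.
move=> k b; rewrite /singlets pair_sign_antisym mulNr; congr (- (_ * (nat_of_bool _)%:R)).
apply: eq_forallb => j; case: (boolP (in_pairs P j)) => //= jP.
by rewrite actb_halves halves_out.
Qed.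

Definition outer b := #|[set j | ~~ in_pairs P j & b j]|.

Lemma ones_splits b : splits P b -> ones (suffix n 0) b = (x + outer b)%N.
Proof.
move=> bP; rewrite /ones -(cardsID [set j | in_pairs P j]); congr (_ + _)%N; last first.
  by apply: eq_card => j; rewrite !inE.
rewrite -[RHS]card_ord -(card_imset 'I_x (f := fun k => site P (k, b (P k).2))); last first.
  by move=> k k' /Pok[].
apply: eq_card => j; rewrite !inE /=; apply/andP/imsetP => [[bj /in_pairsP[[k d] ej]]|[k _ ->]].
  exists k => //; rewrite ej; congr site; congr pair; move: bj (bP k); rewrite ej /site.
  by case: (d) => /= ->//; case: (b _).
split; last by apply/in_pairsP; exists (k, b (P k).2).
by have := bP k; rewrite /site /=; case: ifP => //; case: (b (P k).1).
Qed.

Lemma singlets_ones c : has_ones (suffix n 0) (x + outer c) (singlets P c).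
Proof.
move=> b; rewrite mulf_eq0 negb_or => /andP[/pair_sign_splits bP].
rewrite pnatr_eq0 eqb0 negbK => /forallP bc; rewrite ones_splits //; congr (_ + _)%N.
apply: eq_card => j; rewrite !inE; have := bc j.
by case: in_pairs => //= /eqP ->.
Qed.

Lemma outer0 : outer zero_bits = 0%N.
Proof. by apply: eq_card0 => j; rewrite !inE ffunE andbF. Qed.

(** Lowering commutes with permutations, so the result is still antisymmetric in each pair and would
    need at least x ones, but it has x - 1. *)
Lemma lower_singlets : lower (suffix n 0) (singlets P zero_bits) = fun=> 0.
Proof.
have := singlets_ones (c := zero_bits); rewrite outer0 addn0; case ex : x => [|x'] e1.
  exact: lower_0.
apply/funext => b; apply/eqP; apply: contraT => lb.
have := has_ones_lower e1 lb; rewrite ones_splits ?ex; first by lia.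
apply: (antisym_splits (f := lower (suffix n 0) (singlets P zero_bits))) lb => k b'.
rewrite -[LHS]/((fun c => lower (suffix n 0) (singlets P zero_bits) (actb (halves P k) c)) b').
rewrite -lower_actb; last by move=> i; rewrite !inE.
by rewrite /lower -sumrN; apply: eq_bigr => i _; rewrite singlets_antisym.
Qed.

(** Since lowering kills the state, [raise_lower] leaves only its scalar, x (n - x + 1). *)
Lemma kap_singlets : kap (suffix n 0) (singlets P zero_bits) =
  fun b => casimir F n x * singlets P zero_bits b.
Proof.
apply/funext => b; have := raise_lower (suffix n 0) (singlets P zero_bits) b.
rewrite lower_singlets /raise big1 // => /esym/eqP; rewrite subr_eq0 => /eqP <-.
have [->|/[dup] sb /singlets_ones e] := eqVneq (singlets P zero_bits b) 0; first by rewrite !mulr0.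
have := ones_zeros (suffix n 0) b; rewrite card_suffix // subn0 e outer0 addn0 => nE.
by rewrite /casimir -[in RHS]nE -natr1 natrD; ring.
Qed.

Lemma halvesC k k' : (halves P k * halves P k' = halves P k' * halves P k)%g.
Proof.
apply/permP => j; rewrite !permM; case: (boolP (in_pairs P j)) => [/in_pairsP[[i d] ->]|jP].
  case Ek: (i == k); case Ek': (i == k');
  by rewrite !halves_site /= ?Ek ?Ek' /= ?Ek ?Ek'.
by rewrite !halves_out.
Qed.

Lemma bottoms_site p : bottoms P (site P p) = p.2.
Proof.
rewrite ffunE; apply/existsP/idP => [[k /eqP]|]; case: p => i [] //=.
  by move=> /(Pok (x2 := (k, true))).
by move=> _; exists i.
Qed.

Lemma bottoms_out j : ~~ in_pairs P j -> bottoms P j = false.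
Proof.
move=> jP; rewrite ffunE; apply: contraNF jP => /existsP[k /eqP ->].
by apply/in_pairsP; exists (k, true).
Qed.

(** With x ones in all, each pair holds exactly one and the other sites none. Such strings are
    linked to [bottoms P] by swaps within pairs, so f is determined by one value; the induction is
    on the number of pairs with their one on top. *)
Lemma antisym_singlets f : antisym P f -> has_ones (suffix n 0) x f ->
  forall b, f b = f (bottoms P) * singlets P zero_bits b.
Proof.
move=> fP fx b; have [bP|nbP] := boolP [forall k, b (P k).1 != b (P k).2]; last first.
  have z g : antisym P g -> g b = 0.
    move=> gP; apply/eqP; apply: contraNT nbP => gb.
    by apply/forallP; exact: antisym_splits gP gb.
  by rewrite !z ?mulr0 //; apply: singlets_antisym.
move/forallP: bP => bP; have [ob|ob] := eqVneq (outer b) 0%N; last first.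
  have z g : has_ones (suffix n 0) x g -> g b = 0.
    move=> gx; apply/eqP; apply: contraT => /gx; rewrite ones_splits //.
    by move: ob; lia.
  by rewrite !z ?mulr0 //; have := singlets_ones (c := zero_bits); rewrite outer0 addn0.
have boff j : ~~ in_pairs P j -> b j = false.
  move=> jP; apply: contraTF (eq_refl 0%N) => bj; rewrite -{1}ob -lt0n.
  by rewrite lt0n; apply/eqP => /eqP; rewrite cards_eq0 => /eqP/setP/(_ j); rewrite !inE jP bj.
have [d] := ubnP #|[set k | b (P k).1]|; elim: d => // d IH in b bP ob boff *.
rewrite ltnS => bd; have [/eqP b0|] := boolP (#|[set k | b (P k).1]| == 0%N).
  have -> : b = bottoms P.
    apply/ffunP => j; have [/in_pairsP[[k e] ->]|jP] := boolP (in_pairs P j); last first.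
      by rewrite boff // bottoms_out.
    rewrite bottoms_site; have bk : b (P k).1 = false.
      by move/eqP: b0; rewrite cards_eq0 => /eqP/setP/(_ k); rewrite !inE.
    by case: e; rewrite /site //=; have := bP k; rewrite bk; case: (b _).
  rewrite /singlets [pair_sign _ _]big1 ?mul1r; last first.
    move=> k _; rewrite -[(P k).1]/(site P (k, false)) -[(P k).2]/(site P (k, true)).
    by rewrite !bottoms_site subr0.
  rewrite (_ : [forall _, _]) ?mulr1 //; apply/forallP => j; apply/implyP => jP.
  by rewrite bottoms_out // ffunE.
rewrite cards_eq0 => /set0Pn[k]; rewrite inE => bk.
have ab i e : actb (halves P k) b (site P (i, e)) = b (site P (if i == k then (i, ~~ e) else (i, e))).
  by rewrite actb_halves halves_site.
have aP : splits P (actb (halves P k) b).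
  move=> i; rewrite -[(P i).1]/(site P (i, false)) -[(P i).2]/(site P (i, true)) !ab.
  by case: (i == k); [rewrite eq_sym|]; exact: (bP i).
have aoff j : ~~ in_pairs P j -> actb (halves P k) b j = false.
  by move=> jP; rewrite actb_halves halves_out // boff.
apply: oppr_inj; rewrite -mulrN -(fP k) -(@singlets_antisym zero_bits k b); apply: IH => //.
  by apply: eq_card0 => j; rewrite !inE; case: (boolP (in_pairs P j)) => //= /aoff->.
apply: leq_trans bd; apply: proper_card; apply/properP; split.
  apply/fintype.subsetP => i; rewrite !inE -[(P i).1]/(site P (i, false)) ab.
  by case: (eqVneq i k) => // ->; rewrite /site /= bk.
exists k; rewrite inE // -[(P k).1]/(site P (k, false)) ab eqxx /site /=.
by have := bP k; rewrite bk; case: (b _).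
Qed.

Definition sub_bits c b := [forall j, c j ==> b j].
(** Equal to the sum over j of the j-th power of [raise] on all sites divided by j!; it commutes
    with all permutations. *)
Definition upto f b : F := \sum_(c | sub_bits c b) f c.

Lemma upto_actb f (s : {perm 'I_n}) b : upto f (actb s b) = upto (fun c => f (actb s c)) b.
Proof.
rewrite /upto (reindex_inj (@actb_inj _ s)) /=; apply: eq_bigl => c.
apply/forallP/forallP => H j; first by have := H (s j); rewrite !ffunE permK.
by have := H ((s^-1)%g j); rewrite !ffunE.
Qed.

(** Summation replaces |0> outside the pairs by |0> + |1>, so no condition on those sites remains; a
    pair holding two ones still gives zero by antisymmetry. *)
Lemma upto_singlets b : upto (singlets P zero_bits) b = pair_sign P b.
Proof.
have [bP|nbP] := boolP [forall k, b (P k).1 != b (P k).2]; last first.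
  have z g : antisym P g -> g b = 0.
    move=> gP; apply/eqP; apply: contraNT nbP => gb.
    by apply/forallP; exact: antisym_splits gP gb.
  rewrite !z // => [|k c]; first exact: pair_sign_antisym.
  by rewrite upto_actb /upto -sumrN; apply: eq_bigr => c' _; rewrite singlets_antisym.
move/forallP: bP => bP.
pose r : Tn n := [ffun j => in_pairs P j && b j].
have rP p : r (site P p) = b (site P p).
  by rewrite ffunE; case: in_pairsP => // -[]; exists p.
rewrite /upto (bigD1 r) /=; last by apply/forallP => j; rewrite ffunE; apply/implyP => /andP[].
rewrite big1 ?addr0 => [|c /andP[/forallP cb]].
  rewrite /singlets (_ : [forall _, _]) ?mulr1; last first.
    by apply/forallP => j; apply/implyP => /negbTE jP; rewrite !ffunE jP.
  apply: eq_bigr => k _; rewrite -[(P k).1]/(site P (k, false)) -[(P k).2]/(site P (k, true)).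
  by rewrite !rP.
apply: contra_neq_eq; rewrite mulf_eq0 negb_or pnatr_eq0 eqb0 negbK.
move=> /andP[/pair_sign_splits cP /forallP c0]; apply/ffunP => j; rewrite ffunE.
have [/in_pairsP[[k e] ->]|jP] := boolP (in_pairs P j); last first.
  by have := c0 j; rewrite jP ffunE /= => /eqP ->.
have := cb (P k).1; have := cb (P k).2; have := cP k; have := bP k; rewrite /site.
by case: e => /=; case: (c (P k).1); case: (c (P k).2); case: (b (P k).1); case: (b (P k).2).
Qed.

End Ok.

End Polytabloids.

Section Extend.
Variables (F : numFieldType) (n x : nat) (P : {ffun 'I_x -> 'I_n * 'I_n}) (i j : 'I_n).
Hypotheses (Pok : injective (site P)) (iP : ~~ in_pairs P i) (jP : ~~ in_pairs P j) (ij : i != j).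

Definition extend : {ffun 'I_x.+1 -> 'I_n * 'I_n} :=
  [ffun k => if unlift ord_max k is Some k' then P k' else (i, j)].

Lemma extend_lift k : extend (lift ord_max k) = P k.
Proof. by rewrite ffunE liftK. Qed.

Lemma extend_max : extend ord_max = (i, j).
Proof. by rewrite ffunE unlift_none. Qed.

Lemma extend_ok : injective (site extend).
Proof.
have out p : (site P p != i) && (site P p != j).
  by apply/andP; split; [apply: contraNneq iP => <-|apply: contraNneq jP => <-];
     apply/in_pairsP; exists p.
move=> [k e] [k' e']; rewrite /site /=.
have [k1 ->|->] := unliftP ord_max k; have [k2 ->|->] := unliftP ord_max k';
  rewrite ?extend_lift ?extend_max.
- by move=> eP; have /Pok[-> ->] : site P (k1, e) = site P (k2, e') by [].
- move=> eP; have /andP[] := out (k1, e); rewrite /site /= eP.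
  by case: e' {eP} => /=; rewrite eqxx.
- move=> eP; have /andP[] := out (k2, e'); rewrite /site /= -eP.
  by case: e {eP} => /=; rewrite eqxx.
by case: e; case: e' => //= /eqP; rewrite ?(eq_sym j) (negbTE ij).
Qed.

Lemma in_pairs_extend h : in_pairs extend h = [|| in_pairs P h, h == i | h == j].
Proof.
apply/existsP/or3P => [[k]|].
  have [k' ->|->] := unliftP ord_max k; rewrite ?extend_lift ?extend_max.
    by move=> hk; constructor 1; apply/existsP; exists k'.
  by case/orP => hk; [constructor 2|constructor 3].
case=> [/existsP[k hk]|hi|hj]; first by exists (lift ord_max k); rewrite extend_lift.
  by exists ord_max; rewrite extend_max hi.
by exists ord_max; rewrite extend_max hj orbT.
Qed.

(** Exchanging a zero at i with a one at j and subtracting creates a singlet on the pair (i, j). *)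
Lemma singlets_extend (c b : Tn n) : ~~ c i -> c j ->
  singlets F P c b - singlets F P (actb (tperm i j) c) b = singlets F extend c b.
Proof.
move=> ci cj; rewrite /singlets -mulrBr /pair_sign big_ord_recr /= extend_max.
rewrite -mulrA; congr (_ * _).
  apply: eq_bigr => k _; rewrite (_ : widen_ord _ k = lift ord_max k) ?extend_lift //.
  by apply: val_inj; rewrite /= /bump leqNgt ltn_ord.
have acE h : actb (tperm i j) c h = c (tperm i j h) by rewrite ffunE tpermV.
pose Q := [forall h, ~~ in_pairs extend h ==> (b h == c h)].
have Qc : [forall h, ~~ in_pairs P h ==> (b h == c h)] = [&& Q, ~~ b i & b j].
  apply/forallP/and3P => [H|[/forallP Q1 bi bj] h].
    split; last 2 first.
    - by have := H i; rewrite iP /= (negbTE ci) => /eqP ->.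
    - by have := H j; rewrite jP /= cj => /eqP ->.
    apply/forallP => h; rewrite in_pairs_extend !negb_or; apply/implyP => /and3P[hP _ _].
    exact: (implyP (H h)).
  apply/implyP => hP; have := Q1 h; rewrite in_pairs_extend (negbTE hP) /=.
  have [->|_] := eqVneq h i; first by rewrite (negbTE bi) (negbTE ci).
  by have [->|_] := eqVneq h j; first by rewrite bj cj.
have Qa : [forall h, ~~ in_pairs P h ==> (b h == actb (tperm i j) c h)] = [&& Q, b i & ~~ b j].
  apply/forallP/and3P => [H|[/forallP Q1 bi bj] h].
    split; last 2 first.
    - by have := H i; rewrite iP /= acE tpermL cj => /eqP ->.
    - by have := H j; rewrite jP /= acE tpermR (negbTE ci) => /eqP ->.
    apply/forallP => h; rewrite in_pairs_extend !negb_or; apply/implyP => /and3P[hP hi hj].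
    by have := implyP (H h) hP; rewrite acE tpermD // eq_sym.
  apply/implyP => hP; have := Q1 h; rewrite in_pairs_extend (negbTE hP) /= acE.
  have [->|hi] := eqVneq h i; first by rewrite tpermL bi cj.
  have [->|hj] := eqVneq h j; first by rewrite tpermR (negbTE bj) (negbTE ci).
  by rewrite tpermD // eq_sym.
rewrite Qc Qa -/Q; case: (Q); case: (b i); case: (b j);
  by rewrite /= ?(mulr1, mulr0, subrr, subr0, sub0r).
Qed.

End Extend.

(** * Polytabloids and their raised images span the tensor power *)

Section Span.
Variables (F : numFieldType) (n : nat) (W : (Tn n -> F) -> Prop).
Hypotheses (W0 : W (fun=> 0)) (WZD : forall a f g, W f -> W g -> W (fun b => a * f b + g b)).

Lemma span_sum (I : finType) (p : pred I) (f : I -> Tn n -> F) :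
  (forall i, p i -> W (f i)) -> W (fun b => \sum_(i | p i) f i b).
Proof.
move=> Wf; rewrite (_ : (fun b => _) = fun b => \sum_(i <- index_enum I) (if p i then f i b else 0)).
  elim: index_enum => [|i s IH].
    by rewrite (_ : (fun b => _) = fun=> 0) //; apply/funext => b; rewrite big_nil.
  rewrite (_ : (fun b => _) = fun b => (p i)%:R * (if p i then f i b else 0)
     + \sum_(i0 <- s) (if p i0 then f i0 b else 0)).
    apply: WZD => //; case pi: (p i); [exact: Wf|exact: W0].
  by apply/funext => b; rewrite big_cons; case: ifP; rewrite ?mul1r ?mul0r.
by apply/funext => b; rewrite big_mkcond.
Qed.

(** Modulo states with one more singlet only the number of ones outside the pairs matters:
    [singlets_extend] moves a misplaced one to a site where c' has it. *)
Lemma span_equiv x (P : {ffun 'I_x -> 'I_n * 'I_n}) : injective (site P) ->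
  (forall P' : {ffun 'I_x.+1 -> 'I_n * 'I_n}, injective (site P') ->
    forall c, W (singlets F P' c)) ->
  forall c c', outer P c = outer P c' -> W (fun b => singlets F P c b - singlets F P c' b).
Proof.
move=> Pok WP c c'; pose A (c : Tn n) := [set j | ~~ in_pairs P j & c j].
have [d] := ubnP #|A c :\: A c'|; elim: d c => // d IH c; rewrite ltnS => lt_d eq_o.
have [sub|/fintype.subsetPn[j jc jc']] := boolP (A c \subset A c').
  have /eqP eA : A c == A c' by rewrite eqEcard sub /= -/(outer P c) -/(outer P c') eq_o.
  rewrite (_ : (fun b => _) = fun=> 0) //; apply/funext => b; rewrite /singlets.
  rewrite (_ : [forall h, _ ==> (b h == c h)] = [forall h, ~~ in_pairs P h ==> (b h == c' h)]) ?subrr //.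
  apply: eq_forallb => h; case: (boolP (in_pairs P h)) => //= hP.
  by have /setP/(_ h) := eA; rewrite !inE hP /= => ->.
have /fintype.subsetPn[i ic' ic] : ~~ (A c' \subset A c).
  apply: contra jc' => sub; suff -> : A c' = A c by exact: jc.
  by apply/eqP; rewrite eqEcard sub /= -/(outer P c) -/(outer P c') eq_o.
rewrite !inE in jc jc' ic ic'.
case/andP: jc => jP cj; case/andP: ic' => iP c'i; rewrite jP /= in jc'; rewrite iP /= in ic.
have ij : i != j by apply: contraNneq ic => ->.
pose c1 := actb (tperm i j) c.
have c1E h : c1 h = c (tperm i j h) by rewrite ffunE tpermV.
have W1 : W (fun b => singlets F P c1 b - singlets F P c' b).
  apply: IH; last first.
    rewrite -eq_o -[RHS](card_imset _ (@perm_inj _ (tperm i j))).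
    apply: eq_card => h; rewrite -{2}[h](tpermK i j) mem_imset; last exact: perm_inj.
    rewrite !inE c1E; congr (~~ _ && _); case: tpermP => [->|->|//];
    by rewrite ?(negbTE iP) ?(negbTE jP).
  apply: leq_trans lt_d; apply: proper_card; apply/properP; split.
    apply/fintype.subsetP => h; rewrite !inE c1E; case: tpermP => [->|->|//].
      by rewrite c'i iP.
    by rewrite (negbTE ic) !andbF.
  by exists j; rewrite !inE ?jP ?c1E ?tpermR ?(negbTE ic) ?(negbTE jc') ?cj.
have := WZD 1 (WP _ (extend_ok Pok iP jP ij) c) W1.
rewrite (_ : (fun b => 1 * _ + _) = fun b => singlets F P c b - singlets F P c' b) //.
by apply/funext => b; rewrite mul1r -singlets_extend //; ring.
Qed.

Lemma pairs_bound x (P : {ffun 'I_x -> 'I_n * 'I_n}) : injective (site P) -> (2 * x <= n)%N.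
Proof.
by move=> /leq_card; rewrite card_prod card_bool !card_ord mulnC.
Qed.

Hypothesis WP : forall x (P : {ffun 'I_x -> 'I_n * 'I_n}) m, injective (site P) ->
  W (fun b => (ones (suffix n 0) b == m)%:R * upto (singlets F P (zero_bits n)) b).

(** Downward induction on the number of free sites. [WP] supplies the sum over all outer
    configurations with a given number of ones; by [span_equiv] they agree modulo W, so each is
    their average modulo W. *)
Lemma span_singlets x (P : {ffun 'I_x -> 'I_n * 'I_n}) c : injective (site P) ->
  W (singlets F P c).
Proof.
have [d] := ubnP (n - x); elim: d => // d IH in x P c *; rewrite ltnS => xd Pok.
have WS : forall P' : {ffun 'I_x.+1 -> 'I_n * 'I_n}, injective (site P') ->
    forall c, W (singlets F P' c).
  by move=> P' P'ok c'; apply: IH => //; have := pairs_bound P'ok; lia.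
(* Strings vanishing on the pairs represent the outer configurations once each. *)
pose inner0 (c' : Tn n) := [forall j, in_pairs P j ==> ~~ c' j].
pose B := [pred c' : Tn n | inner0 c' & outer P c' == outer P c].
pose r (b : Tn n) : Tn n := [ffun j => ~~ in_pairs P j && b j].
have r0 b : inner0 (r b) by apply/forallP => j; apply/implyP => jP; rewrite ffunE jP.
have or b : outer P (r b) = outer P b.
  by apply: eq_card => j; rewrite !inE ffunE; case: in_pairs.
have B_gt0 : (0 < #|B|)%N by apply/card_gt0P; exists (r c); rewrite inE r0 or eqxx.
have sumB : (fun b => (ones (suffix n 0) b == x + outer P c)%N%:R * upto (singlets F P (zero_bits n)) b)
    = (fun b => \sum_(c' in B) singlets F P c' b).
  apply/funext => b; rewrite upto_singlets // /singlets -mulr_sumr.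
  have [->|/pair_sign_splits bP] := eqVneq (pair_sign F P b) 0; first by rewrite mulr0 mul0r.
  rewrite mulrC (ones_splits Pok bP) eqn_add2l; congr (_ * _).
  rewrite (eq_bigr (fun c' => (c' == r b)%:R)) => [|c']; last first.
    rewrite inE => /andP[/forallP c'0 _]; congr (nat_of_bool _)%:R.
    apply/forallP/eqP => [H|-> j]; last by rewrite ffunE; apply/implyP => ->.
    apply/ffunP => j; rewrite ffunE; have := H j; have := c'0 j.
    by case: in_pairs => /=; [move/negbTE-> | move=> _ /eqP->].
  rewrite -natr_sum; congr _%:R; have [rB|rB] := boolP (r b \in B).
    rewrite (bigD1 (r b)) //= eqxx big1 ?addn0; last by move=> c' /andP[_ /negbTE ->].
    by move: rB; rewrite inE or => /andP[_ ->].
  rewrite big1 => [|c' c'B]; last by case: eqP => // ec; rewrite -ec c'B in rB.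
  by move: rB; rewrite inE r0 or /= => /negbTE ->.
have := WP (x + outer P c)%N Pok; rewrite sumB => W1.
have W2 : W (fun b => \sum_(c' in B) (singlets F P c b - singlets F P c' b)).
  by apply: span_sum => c' /andP[_ /eqP ec']; apply: span_equiv.
have := WZD (#|B|%:R^-1) (WZD 1 W1 W2) W0; congr W; apply/funext => b.
rewrite addr0 mul1r -big_split /=; under eq_bigr do rewrite addrC subrK.
rewrite sumr_const -[X in _ * X]mulr_natl mulKf //.
by rewrite pnatr_eq0 -lt0n.
Qed.

Lemma span_delta c : W (fun b => (b == c)%:R).
Proof.
pose P : {ffun 'I_0 -> 'I_n * 'I_n} := [ffun i : 'I_0 => False_rect _ (notF (ltn_ord i))].
have Pok : injective (site P) by move=> [[]].
have := span_singlets c Pok; congr W; apply/funext => b.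
rewrite /singlets /pair_sign big_ord0 mul1r; congr (nat_of_bool _)%:R.
apply/forallP/eqP => [H|-> j]; last by rewrite eqxx implybT.
apply/ffunP => j; have := H j; rewrite (_ : in_pairs P j = false); first by move=> /eqP.
by apply/existsP => -[[]].
Qed.

End Span.

(** * Isotypic components *)

Section Isotypic.
Variables (R : realType) (n : nat).
Local Notation C := (R[i]).
Implicit Types (f g : Tn n -> C).

Definition vec f : 'rV[C]_(dimV n) := \row_j f (enum_val j).
Definition unvec (v : 'rV[C]_(dimV n)) : Tn n -> C := fun b => v 0 (enum_rank b).

Lemma vecK f : unvec (vec f) = f.
Proof. by apply/funext => b; rewrite /unvec mxE enum_rankK. Qed.

Lemma unvecK v : vec (unvec v) = v.
Proof. by apply/rowP => j; rewrite mxE /unvec enum_valK. Qed.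

Lemma vec_repm f s : vec f *m repm R s = vec (fun b => f (actb (s^-1)%g b)).
Proof.
rewrite /repm -[idxp s]invgK -col_permE; apply/rowP => j; rewrite !mxE; congr f.
suff -> : ((idxp s)^-1)%g j = idxf (s^-1)%g j by rewrite /idxf enum_rankK.
apply: (@perm_inj _ (idxp s)); rewrite permKV permE /idxf enum_rankK -actbM mulVg actb1.
by rewrite enum_valK.
Qed.

Lemma vecZD a f g : vec (fun b => a * f b + g b) = a *: vec f + vec g.
Proof. by apply/rowP => j; rewrite !mxE. Qed.

Lemma vecZ a f : vec (fun b => a * f b) = a *: vec f.
Proof. by apply/rowP => j; rewrite !mxE. Qed.

Definition kapm : 'M[C]_(dimV n) :=
  2^-1 *: \sum_(i in suffix n 0) \sum_(j in suffix n 0) (1%:M - repm R (tperm i j)).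

Lemma vec_kapm f : vec f *m kapm = vec (kap (suffix n 0) f).
Proof.
rewrite /kapm -scalemxAr mulmx_sumr; apply/rowP => h; rewrite !mxE /kap; congr (_ * _).
rewrite summxE; apply: eq_bigr => i _; rewrite mulmx_sumr summxE; apply: eq_bigr => j _.
by rewrite mulmxBr mulmx1 vec_repm tpermV !mxE.
Qed.

Local Notation G := [set: {perm 'I_n}].

Lemma kap_actb (s : {perm 'I_n}) f :
  kap (suffix n 0) (fun b => f (actb s b)) = fun b => kap (suffix n 0) f (actb s b).
Proof.
apply/funext => b; rewrite /kap; congr (_ * _).
rewrite [RHS](reindex_inj (@perm_inj _ s)); apply: eq_big => [i|i _]; first by rewrite !inE.
rewrite [RHS](reindex_inj (@perm_inj _ s)); apply: eq_big => [j|j _]; first by rewrite !inE.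
by congr (_ - f _); rewrite -!actbM -tpermJ /conjg mulKVg.
Qed.

Lemma repm_kapm s : repm R s *m kapm = kapm *m repm R s.
Proof.
apply/row_matrixP => h; rewrite !rowE !mulmxA -[delta_mx _ _]unvecK.
by rewrite vec_repm !vec_kapm vec_repm kap_actb.
Qed.

Lemma kapm_envelop : (kapm \in enveloping_algebra_mx (repV R n))%MS.
Proof.
have E s : (repm R s \in enveloping_algebra_mx (repV R n))%MS.
  by apply: (envelop_mx_id (repV R n)); rewrite inE.
rewrite /kapm linearZ scalemx_sub // linear_sum summx_sub // => i _.
rewrite linear_sum summx_sub // => j _; rewrite linearB addmx_sub //.
  by have := E 1%g; have := repr_mx1 (repV R n) => /= ->.
by rewrite eqmx_opp; apply: E.
Qed.

Lemma polytabE x (P : {ffun 'I_x -> 'I_n * 'I_n}) :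
  polytab R P = if pairs_ok P then vec (singlets C P (zero_bits n)) else 0.
Proof.
apply/rowP => j; rewrite !mxE; case: ifP => ok; rewrite !mxE //.
congr (_ * (nat_of_bool _)%:R); apply: eq_forallb => h.
by rewrite ffunE; case: in_pairs => //=; case: (_ h).
Qed.

Lemma specht_eigen x : (<<specht R n x>> <= eigenspace kapm (casimir C n x))%MS.
Proof.
rewrite genmxE; apply/row_subP => i; rewrite rowK polytabE.
case: pairs_okP => [ok|_]; last exact: sub0mx.
by apply/eigenspaceP; rewrite vec_kapm kap_singlets // vecZ.
Qed.

(** The component is generated by images of a Specht vector under homomorphisms, and these commute
    with [kapm], which lies in the enveloping algebra. *)
Lemma isotypic_eigen x : (isotypic R n x <= eigenspace kapm (casimir C n x))%MS.
Proof.
rewrite /isotypic /component_mx locked_withE /component_mx_expr; apply/sumsmx_subP => i _.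
apply: cyclic_mx_sub.
  apply/mxmoduleP => s _; apply/eigenspaceP.
  by rewrite /= -mulmxA repm_kapm mulmxA (eigenspaceP (submx_refl _)) -scalemxAl.
set u := nz_row _; set v := row i _.
have /row_hom_mxP[f uf <-] : (v <= row_hom_mx (repV R n) u)%MS by exact: row_sub.
apply/eigenspaceP; rewrite -(hom_envelop_mxC uf kapm_envelop) scalemxAl; congr (_ *m _).
by apply/eigenspaceP; apply: submx_trans (specht_eigen x); apply: nz_row_sub.
Qed.

Lemma adjmxM p q r (A : 'M[C]_(p, q)) (B : 'M[C]_(q, r)) : adjmx (A *m B) = adjmx B *m adjmx A.
Proof. by rewrite /adjmx map_mxM trmx_mul. Qed.

Lemma adjmxZ p q (a : C) (A : 'M[C]_(p, q)) : adjmx (a *: A) = conjc a *: adjmx A.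
Proof. by apply/matrixP => i j; rewrite !mxE rmorphM. Qed.

Lemma adj_row_eq0 p (v : 'rV[C]_p) : v *m adjmx v = 0 -> v = 0.
Proof.
move=> /matrixP /(_ 0 0); rewrite !mxE => v0; apply/rowP => j; rewrite mxE.
have E (x : C) : x * conjc x = (complex.Re x ^+ 2 + complex.Im x ^+ 2)%:C%C.
  by case: x => a b; simpc; congr Complex; rewrite /= ?expr2; ring.
have : (\sum_j (complex.Re (v 0 j) ^+ 2 + complex.Im (v 0 j) ^+ 2))%:C%C = 0 :> C.
  by rewrite -v0 rmorph_sum; apply: eq_bigr => h _; rewrite /adjmx !mxE; apply: esym; exact: E.
move=> [] /eqP; rewrite psumr_eq0 => [/allP /(_ j)|h _]; last by rewrite addr_ge0 ?sqr_ge0.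
rewrite mem_index_enum => /(_ isT) /=; rewrite paddr_eq0 ?sqr_ge0 // !sqrf_eq0.
by case: (v 0 j) => a b /= /andP[/eqP -> /eqP ->].
Qed.

Lemma gram_unit p q (B : 'M[C]_(p, q)) : row_free B -> B *m adjmx B \in unitmx.
Proof.
move=> fB; rewrite -row_free_unit; apply: inj_row_free => v vB0.
apply: (row_free_inj fB); rewrite mul0mx; apply: adj_row_eq0.
by rewrite adjmxM mulmxA -(mulmxA v) vB0 mul0mx.
Qed.

Lemma orth_proj_decomp d (U : 'M[C]_d) (w w' : 'rV[C]_d) :
  (w <= U)%MS -> w' *m adjmx U = 0 -> orth_proj U (w + w') = w.
Proof.
move=> wU w'U; rewrite /orth_proj; set B := row_base U.
have /submxP[A ->] : (w <= B)%MS by rewrite eq_row_base.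
have /submxP[D BD] : (B <= U)%MS by rewrite eq_row_base.
have w'B : w' *m adjmx B = 0 by rewrite BD adjmxM mulmxA w'U mul0mx.
rewrite !mulmxDl w'B !mul0mx addr0.
by rewrite -(mulmxA A) mulmxK // gram_unit // row_base_free.
Qed.

Lemma adjmx_kapm : adjmx kapm = kapm.
Proof.
have E s : adjmx (repm R (n := n) s) = repm R (s^-1)%g.
  rewrite /adjmx map_perm_mx tr_perm_mx /repm; congr perm_mx; apply/permP => j.
  apply: (@perm_inj _ (idxp s)); rewrite permKV !permE /idxf enum_rankK -actbM mulVg actb1.
  by rewrite enum_valK.
have adjB p (A B : 'M[C]_p) : adjmx (A - B) = adjmx A - adjmx B.
  by rewrite /adjmx map_mxB linearB.
have adjS p (I : finType) (r : pred I) (A : I -> 'M[C]_p) :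
    adjmx (\sum_(i in r) A i) = \sum_(i in r) adjmx (A i).
  by rewrite /adjmx map_mx_sum linear_sum.
have c2 : conjc (2^-1 : C) = 2^-1 by rewrite conjc_inv conjc_nat.
rewrite {1}/kapm adjmxZ c2 adjS; congr (_ *: _); apply: eq_bigr => i _.
rewrite adjS; apply: eq_bigr => j _.
by rewrite adjB E tpermV; congr (_ - _); rewrite /adjmx map_mx1 trmx1.
Qed.

Lemma eigen_orthogonal (c1 c2 : C) p q (A : 'M[C]_(p, dimV n)) (B : 'M[C]_(q, dimV n)) :
  A *m kapm = c1 *: A -> B *m kapm = c2 *: B -> conjc c2 = c2 -> c1 != c2 ->
  A *m adjmx B = 0.
Proof.
move=> A1 B2 c2r c12; have : c1 *: (A *m adjmx B) = c2 *: (A *m adjmx B).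
  rewrite scalemxAl -A1 -mulmxA -{1}adjmx_kapm -adjmxM B2 adjmxZ c2r.
  by rewrite -scalemxAr.
move=> /eqP; rewrite -subr_eq0 -scalerBl scaler_eq0 subr_eq0 (negbTE c12) /=.
by move=> /eqP.
Qed.

Lemma casimir_inj x y : (x <= n./2)%N -> (y <= n./2)%N ->
  casimir C n x = casimir C n y -> x = y.
Proof.
move=> xn yn; have : (2 * n./2 <= n)%N by rewrite mul2n -{2}(odd_double_half n) leq_addl.
move=> n2 /eqP; rewrite -subr_eq0 /casimir.
have -> : x%:R * (n%:R + 1 - x%:R) - y%:R * (n%:R + 1 - y%:R) =
   (x%:R - y%:R) * (n.+1 - x - y)%:R :> C.
  by rewrite !natrB; [rewrite -natr1; ring|lia|lia].
rewrite mulf_eq0 pnatr_eq0 subr_eq0 eqr_nat => /orP[/eqP//|/eqP ?]; lia.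
Qed.

Lemma specht_module x : mxmodule (repV R n) <<specht R n x>>%MS.
Proof.
apply/mxmoduleP => s _; rewrite (eqmxMr _ (genmxE _)) genmxE /=; apply/row_subP => i.
rewrite row_mul rowK polytabE; set P := enum_val i.
case: pairs_okP => ok; last by rewrite mul0mx sub0mx.
pose P' : {ffun 'I_x -> 'I_n * 'I_n} := [ffun k => (s (P k).1, s (P k).2)].
have sP' p : site P' p = s (site P p) by rewrite /site !ffunE; case: p.2.
have ok' : injective (site P') by move=> p p'; rewrite !sP' => /perm_inj /ok.
have -> : vec (singlets C P (zero_bits n)) *m repm R s = row (enum_rank P') (specht R n x).
  rewrite rowK enum_rankK polytabE; case: pairs_okP => // _; rewrite vec_repm.
  apply/rowP => j; rewrite !mxE /singlets; congr (_ * (nat_of_bool _)%:R).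
    by apply: eq_bigr => k _; rewrite !ffunE /= invgK.
  apply/forallP/forallP => H h.
    have := H ((s^-1)%g h); rewrite !ffunE invgK permKV.
    suff -> : in_pairs P ((s^-1)%g h) = in_pairs P' h by [].
    apply: eq_existsb => k; rewrite !ffunE /=.
    by rewrite !(canF_eq (permKV s)).
  have := H (s h); rewrite !ffunE invgK.
  suff -> : in_pairs P' (s h) = in_pairs P h by [].
  by apply: eq_existsb => k; rewrite !ffunE /= !(inj_eq perm_inj).
exact: row_sub.
Qed.

End Isotypic.

(** Tableaux of one shape are conjugate, so a submodule containing one polytabloid contains all of
    them. *)
Lemma perm_extending (n x : nat) (P P' : {ffun 'I_x -> 'I_n * 'I_n}) :
  injective (site P) -> injective (site P') ->
  exists s : {perm 'I_n}, forall p, s (site P p) = site P' p.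
Proof.
move=> Pi P'i; pose e := enum {: 'I_x * bool}.
pose L := map (site P) e; pose L' := map (site P') e.
pose r := [seq i <- enum 'I_n | i \notin L].
pose r' := [seq i <- enum 'I_n | i \notin L'].
have full (Q : {ffun 'I_x -> 'I_n * 'I_n}) : injective (site Q) ->
    perm_eq (map (site Q) e ++ [seq i <- enum 'I_n | i \notin map (site Q) e]) (enum 'I_n).
  move=> Qi; apply: uniq_perm; rewrite ?enum_uniq //.
    rewrite cat_uniq (map_inj_uniq Qi) enum_uniq filter_uniq ?enum_uniq // andbT /=.
    by apply/hasPn => i; rewrite mem_filter => /andP[].
  by move=> i; rewrite mem_cat mem_filter mem_enum andbT orbN.
have P1 := full P Pi; have P2 := full P' P'i; rewrite -/L -/r in P1; rewrite -/L' -/r' in P2.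
have sz : size (L ++ r) = size (L' ++ r') by rewrite (perm_size P1) (perm_size P2).
have u1 : uniq (L ++ r) by rewrite (perm_uniq P1) enum_uniq.
have u2 : uniq (L' ++ r') by rewrite (perm_uniq P2) enum_uniq.
have m1 i : i \in L ++ r by rewrite (perm_mem P1) mem_enum.
pose f i := nth i (L' ++ r') (index i (L ++ r)).
have fi : injective f.
  move=> i j; rewrite /f (set_nth_default j) -?sz ?index_mem // => /eqP.
  rewrite nth_uniq // -?sz ?index_mem // => /eqP /(congr1 (nth i (L ++ r))).
  by rewrite !nth_index.
exists (perm fi) => p; rewrite permE /f.
have pe : p \in e by rewrite mem_enum.
have pL : site P p \in L by apply: map_f.
have ipL : (index p e < size L')%N by rewrite size_map index_mem.
rewrite index_cat pL /L (index_map Pi) nth_cat ipL /L' (nth_map p) ?index_mem //.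
by rewrite nth_index.
Qed.

(** * Irreducibility of the Specht modules and the spectral resolution *)

Section Simple.
Variables (R : realType) (n : nat).
Local Notation C := (R[i]).
Local Notation S x := (<<specht R n x>>)%MS.

Lemma sum_enum_val (F : Tn n -> C) : \sum_b F b = \sum_(j < dimV n) F (enum_val j).
Proof. by rewrite (reindex (@enum_val (Tn n) (mem predT))) //; exact/onW_bij/enum_val_bij. Qed.

Lemma vec_mod m (V : 'M[C]_(m, dimV n)) (s : {perm 'I_n}) (f : Tn n -> C) :
  mxmodule (repV R n) V -> (vec f <= V)%MS -> (vec (fun b => f (actb s b)) <= V)%MS.
Proof.
move=> modV fV; have -> : vec (fun b => f (actb s b)) = vec f *m repV R n (s^-1)%g.
  by rewrite /= vec_repm invgK.
by apply: mxmodule_trans; rewrite ?inE.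
Qed.

Lemma specht_ones x (f : Tn n -> C) : (vec f <= S x)%MS -> has_ones (suffix n 0) x f.
Proof.
rewrite genmxE => /submxP[D eD] b.
have -> : f b = \sum_r D 0 r * unvec (polytab R (enum_val r)) b.
  rewrite -[f]vecK eD /unvec mxE; apply: eq_bigr => r _; by rewrite mxE.
apply: contra_neq_eq => ob; apply: big1 => r _; rewrite polytabE.
case: pairs_okP => ok; last by rewrite /unvec mxE mulr0.
rewrite vecK; have o := singlets_ones ok (c := zero_bits n) (b := b).
have [->|/o] := eqVneq (singlets C (enum_val r) (zero_bits n) b) 0; first by rewrite mulr0.
by rewrite outer0 addn0 => e; rewrite e eqxx in ob.
Qed.

(** A vector of the span orthogonal to all generators is orthogonal to itself; polytabloids have
    real entries, so [dotf] needs no conjugation. *)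
Lemma specht_dot x (f : Tn n -> C) : (vec f <= S x)%MS -> vec f != 0 ->
  exists P : {ffun 'I_x -> 'I_n * 'I_n}, injective (site P) /\ dotf f (singlets C P (zero_bits n)) != 0.
Proof.
rewrite genmxE => fS f0.
have [/existsP[P /andP[/pairs_okP ok d]]|/existsPn none] := boolP [exists P : {ffun 'I_x -> 'I_n * 'I_n},
  pairs_ok P && (dotf f (singlets C P (zero_bits n)) != 0)].
  by exists P.
case/negP: f0; apply/eqP/adj_row_eq0; have /submxP[D {2}->] := fS.
suff -> : vec f *m adjmx (D *m specht R n x) = 0 by [].
rewrite adjmxM mulmxA (_ : vec f *m adjmx _ = 0) ?mul0mx //.
apply/rowP => r; rewrite !mxE; have := none (enum_val r); rewrite negb_and negbK.
set P := enum_val r => H; transitivity (\sum_j f (enum_val j) * conjc (polytab R P 0 j)).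
  by apply: eq_bigr => j _; rewrite /adjmx !mxE.
rewrite polytabE; move: H; case: ifP => /= ok.
  move=> /eqP H; rewrite -[RHS]H /dotf [RHS]sum_enum_val.
  apply: eq_bigr => j _; rewrite mxE; congr (_ * _).
  rewrite /singlets /pair_sign rmorphM rmorph_prod rmorph_nat; congr (_ * _).
  by apply: eq_bigr => k _; rewrite rmorphB !rmorph_nat.
by move=> _; apply: big1 => j _; rewrite mxE conjc0 mulr0.
Qed.

(** The submodule argument: a nonzero vector of V pairs nontrivially with some polytabloid;
    antisymmetrised over the pairs of P it becomes a nonzero multiple of that polytabloid, whose
    permutations generate everything. *)
Lemma specht_simple x (P0 : {ffun 'I_x -> 'I_n * 'I_n}) : injective (site P0) ->
  mxsimple (repV R n) (S x).
Proof.
move=> P0ok; split; first exact: specht_module.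
  have eb : singlets C P0 (zero_bits n) (bottoms P0) = 1.
    rewrite /singlets [pair_sign _ _ _]big1 ?mul1r.
      rewrite (_ : [forall _, _]) //; apply/forallP => j; apply/implyP => jP.
      by rewrite bottoms_out // ffunE.
    move=> k _; rewrite -[(P0 k).1]/(site P0 (k, false)) -[(P0 k).2]/(site P0 (k, true)).
    by rewrite !bottoms_site // subr0.
  apply/negP => /eqP S0; have : (polytab R P0 <= S x)%MS.
    by rewrite genmxE -[P0]enum_rankK -(rowK (fun r => polytab R (enum_val r))) row_sub.
  rewrite S0 submx0 polytabE; case: pairs_okP => // _ /eqP /(congr1 (@unvec R n)).
  move=> /(congr1 (@^~ (bottoms P0))); rewrite vecK /= eb /unvec mxE => /eqP.
  by rewrite oner_eq0.
move=> V modV VS V0.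
have : (nz_row V <= V)%MS by exact: nz_row_sub.
have : nz_row V != 0 by rewrite nz_row_eq0.
rewrite -[nz_row V]unvecK; set f := unvec _ => f0 fV.
have [P [ok fP]] := specht_dot (submx_trans fV VS) f0.
have eP := @singlets_antisym C n x P ok (zero_bits n).
(* Antisymmetrise one pair at a time. Each step doubles the inner product, because the polytabloid
   is itself antisymmetric, so the vector stays nonzero. *)
have [g [gV ga gP]] : exists g, [/\ (vec g <= V)%MS, antisym P g &
    dotf g (singlets C P (zero_bits n)) != 0].
  have /(_ x (leqnn x))[g [gV ga gP]] i : (i <= x)%N -> exists g, [/\ (vec g <= V)%MS,
      forall k : 'I_x, (k < i)%N -> forall b, g (actb (halves P k) b) = - g b &
      dotf g (singlets C P (zero_bits n)) != 0].
    elim: i => [|i IH] ix; first by exists f; split.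
    have [g [gV ga gP]] := IH (ltnW ix); pose k := Ordinal ix.
    exists (fun b => -1 * g (actb (halves P k) b) + g b); split.
    - by rewrite vecZD addmx_sub // scalemx_sub // vec_mod.
    - move=> k' k'i b; have [->|kk'] := eqVneq k' k.
        have -> : actb (halves P k) (actb (halves P k) b) = b.
          by rewrite -actbM tperm2 actb1.
        by ring.
      have lt : (k' < i)%N.
        by move: k'i; rewrite ltnS leq_eqVlt => /orP[/eqP e|//]; case/eqP: kk'; apply: val_inj.
      by rewrite -actbM halvesC // actbM !(ga k') //; ring.
    have -> : dotf (fun b => -1 * g (actb (halves P k) b) + g b) (singlets C P (zero_bits n)) =
       2 * dotf g (singlets C P (zero_bits n)).
      have -> : dotf (fun b => -1 * g (actb (halves P k) b) + g b) (singlets C P (zero_bits n)) =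
        - (\sum_b g (actb (halves P k) b) * singlets C P (zero_bits n) b)
         + dotf g (singlets C P (zero_bits n)).
        by rewrite -sumrN -big_split; apply: eq_bigr => b _ /=; ring.
      rewrite mulr_natl mulr2n; congr (_ + _).
      rewrite -sumrN [RHS](reindex_inj (@actb_inj _ (halves P k))) /=.
      by apply: eq_bigr => b _; rewrite eP; ring.
    by rewrite mulf_neq0 // pnatr_eq0.
  by exists g; split=> // k b; apply: ga.
have gE := antisym_singlets ok ga (specht_ones (submx_trans gV VS)).
have c0 : g (bottoms P) != 0.
  apply: contra_neq gP => gb; rewrite /dotf big1 // => b _.
  by rewrite gE gb !mul0r.
have PV : (vec (singlets C P (zero_bits n)) <= V)%MS.
  rewrite -(eqmx_scale _ c0) -vecZ.
  by have <- : g = (fun b => g (bottoms P) * singlets C P (zero_bits n) b) by apply/funext.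
rewrite genmxE; apply/row_subP => r; rewrite rowK polytabE; set P' := enum_val r.
case: pairs_okP => ok'; last exact: sub0mx.
have [s sP] := perm_extending ok' ok.
suff -> : singlets C P' (zero_bits n) = fun b => singlets C P (zero_bits n) (actb s b).
  exact: vec_mod.
apply/funext => b; rewrite /singlets; congr (_ * (nat_of_bool _)%:R).
  apply: eq_bigr => k _; rewrite -[(P' k).1]/(site P' (k, false)) -[(P' k).2]/(site P' (k, true)).
  rewrite -[(P k).1]/(site P (k, false)) -[(P k).2]/(site P (k, true)) -!sP.
  by rewrite !ffunE !permK.
apply/forallP/forallP => H h.
  have := H ((s^-1)%g h); rewrite !ffunE.
  suff -> : in_pairs P' ((s^-1)%g h) = in_pairs P h by [].
  apply/in_pairsP/in_pairsP => -[p e]; exists p; first by rewrite -sP -e permKV.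
  by rewrite e -sP permK.
have := H (s h); rewrite !ffunE permK.
suff -> : in_pairs P (s h) = in_pairs P' h by [].
apply/in_pairsP/in_pairsP => -[p e]; exists p; first by apply: (@perm_inj _ s); rewrite sP.
by rewrite e sP.
Qed.

Definition uptom m : 'M[C]_(dimV n) := \matrix_(i, j)
  ((ones (suffix n 0) (enum_val j) == m)%:R * (sub_bits (enum_val i) (enum_val j))%:R).

Lemma vec_uptom f m : vec f *m uptom m =
  vec (fun b => (ones (suffix n 0) b == m)%:R * upto f b).
Proof.
apply/rowP => j; rewrite !mxE /upto [in RHS]big_mkcond [in RHS]sum_enum_val.
rewrite mulr_sumr; apply: eq_bigr => i _; rewrite !mxE mulrC -mulrA; congr (_ * _).
by case: ifP; rewrite ?mul1r ?mul0r.
Qed.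

(** Passing to substrings and counting ones both commute with permuting sites, so [uptom m] is an
    endomorphism of the representation. *)
Lemma isotypic_uptom x (P : {ffun 'I_x -> 'I_n * 'I_n}) f m : injective (site P) ->
  (vec f <= isotypic R n x -> vec f *m uptom m <= isotypic R n x)%MS.
Proof.
move=> ok fI; apply: submx_trans (submxMr _ fI) _.
apply: (hom_component_mx (specht_simple ok)); apply/hom_mxP => s _ /=.
rewrite -!mulmxA; congr (_ *m _).
apply/row_matrixP => h; rewrite !rowE !mulmxA -[delta_mx _ _]unvecK.
rewrite vec_repm !vec_uptom vec_repm; congr vec; apply/funext => b.
rewrite upto_actb; congr ((_ == _)%:R * _).
rewrite /ones -[RHS](card_imset _ (@perm_inj _ s)).
apply: eq_card => j; rewrite -{2}[j](permKV s) mem_imset; last exact: perm_inj.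
by rewrite !inE ffunE invgK permKV.
Qed.

(** The sum of the components satisfies the closure conditions of [span_delta], hence contains every
    basis vector; [pairs_bound] keeps x at most n/2. *)
Lemma isotypic_span : (1%:M <= \sum_(x < (n./2).+1) isotypic R n x)%MS.
Proof.
set W := (\sum_(x < _) _)%MS; pose inW (f : Tn n -> C) := (vec f <= W)%MS.
have W0 : inW (fun=> 0).
  by rewrite /inW (_ : vec _ = 0) ?sub0mx //; apply/rowP => j; rewrite !mxE.
have WZD a f g : inW f -> inW g -> inW (fun b => a * f b + g b).
  by move=> fW gW; rewrite /inW vecZD addmx_sub // scalemx_sub.
have WP x (P : {ffun 'I_x -> 'I_n * 'I_n}) m : injective (site P) ->
    inW (fun b => (ones (suffix n 0) b == m)%:R * upto (singlets C P (zero_bits n)) b).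
  move=> ok; have xn : (x < (n./2).+1)%N.
    by rewrite ltnS; have := pairs_bound ok; rewrite -{1}(odd_double_half n) -muln2; lia.
  rewrite /inW -vec_uptom; apply: (@submx_trans _ _ _ _ _ _ (isotypic R n x)).
    apply: (isotypic_uptom m ok); apply: submx_trans (component_mx_id (specht_simple ok)).
    rewrite genmxE (_ : vec _ = row (enum_rank P) (specht R n x)) ?row_sub //.
    by rewrite rowK enum_rankK polytabE; case: pairs_okP.
  exact: (sumsmx_sup (Ordinal xn)).
apply/row_subP => h; have := span_delta W0 WZD WP (enum_val h); rewrite /inW.
congr (_ <= _)%MS; apply/rowP => j; rewrite !mxE (inj_eq enum_val_inj) eq_sym.
by [].
Qed.

Lemma hdot_vec (f g : Tn n -> C) : (forall b, conjc (f b) = f b) ->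
  hdot (vec f) (vec g) = dotf f g.
Proof.
move=> fr; rewrite /hdot /dotf sum_enum_val; apply: eq_bigr => j _.
by rewrite !mxE fr.
Qed.

Lemma casimir_real x : conjc (casimir C n x) = casimir C n x.
Proof. by rewrite /casimir rmorphM rmorphB rmorphD rmorph1 !rmorph_nat. Qed.

Lemma isotypic_moment (f : Tn n -> C) zs : (forall b, conjc (f b) = f b) ->
  \sum_(x < (n./2).+1) hdot (vec f) (orth_proj (isotypic R n x) (vec f))
     * \prod_(z <- zs) (z - casimir C n x) = dotf f (kprod (suffix n 0) zs f).
Proof.
move=> fr.
have /sub_sumsmxP[D fD] : (vec f <= \sum_(x < (n./2).+1) isotypic R n x)%MS.
  exact: submx_trans (submx1 _) isotypic_span.
pose w (x : 'I_(n./2).+1) := D x *m isotypic R n x.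
have wI x : (w x <= isotypic R n x)%MS by exact: submxMl.
have wK x : w x *m kapm R n = casimir C n x *: w x.
  by apply/eigenspaceP; apply: submx_trans (wI x) (isotypic_eigen R n x).
(* Components with different Casimir values are orthogonal, so the orthogonal projection picks out
   the summand of the decomposition. *)
have proj (x : 'I_(n./2).+1) : orth_proj (isotypic R n x) (vec f) = w x.
  rewrite fD (bigD1 x) //=; apply: orth_proj_decomp; first exact: wI.
  rewrite mulmx_suml big1 // => y yx; apply: (eigen_orthogonal (wK y)).
  - by apply/eigenspaceP; apply: isotypic_eigen.
  - exact: casimir_real.
  by apply: contra_neq yx => /(casimir_inj (ltn_ord y) (ltn_ord x)) => e; apply: val_inj.
have kw : vec (kprod (suffix n 0) zs f) = \sum_(x < (n./2).+1) (\prod_(z <- zs) (z - casimir C n x)) *: w x.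
  elim: zs => [|z zs IH] /=.
    by rewrite fD; apply: eq_bigr => x _; rewrite big_nil scale1r.
  have -> : vec (fun b => z * kprod (suffix n 0) zs f b - kap (suffix n 0) (kprod (suffix n 0) zs f) b)
     = z *: vec (kprod (suffix n 0) zs f) - vec (kprod (suffix n 0) zs f) *m kapm R n.
    by rewrite vec_kapm; apply/rowP => j; rewrite !mxE.
  rewrite IH scaler_sumr mulmx_suml -sumrB; apply: eq_bigr => x _.
  by rewrite big_cons -scalemxAl wK !scalerA -scalerBl; congr (_ *: _); ring.
rewrite -hdot_vec // kw /hdot; under [RHS]eq_bigr do rewrite summxE mulr_sumr.
rewrite exchange_big /=; apply: eq_bigr => x _; rewrite proj mulr_suml.
by apply: eq_bigr => j _; rewrite !mxE; ring.
Qed.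

End Simple.

Lemma kprodZ (F : numFieldType) n (S : {set 'I_n}) zs (c : F) f :
  kprod S zs (fun b => c * f b) = fun b => c * kprod S zs f b.
Proof.
elim: zs => //= z zs ->; apply/funext => b.
rewrite mulrBr mulrCA; congr (_ - _); rewrite /kap mulrCA; congr (_ * _).
rewrite mulr_sumr; apply: eq_bigr => i _; rewrite mulr_sumr; apply: eq_bigr => j _.
by rewrite mulrBr.
Qed.

(** Taking as roots all values other than e x isolates the weight at x. *)
Lemma fin_moments_eq (F : fieldType) n (e p p' : 'I_n -> F) : injective e ->
  (forall zs, \sum_x p x * \prod_(z <- zs) (z - e x) = \sum_x p' x * \prod_(z <- zs) (z - e x)) ->
  p =1 p'.
Proof.
move=> einj H x; pose zs := [seq e y | y <- enum 'I_n & y != x].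
have E (r : 'I_n -> F) : \sum_y r y * \prod_(z <- zs) (z - e y) = r x * \prod_(z <- zs) (z - e x).
  rewrite (bigD1 x) //= [X in _ + X]big1 ?addr0 // => y yx.
  rewrite (big_rem (e y)) /= ?subrr ?mul0r ?mulr0 //.
  by apply: map_f; rewrite mem_filter yx mem_enum.
have := H zs; rewrite !E; apply: mulIf.
rewrite big_map big_filter prodf_seq_neq0; apply/allP => y _; apply/implyP => yx.
by rewrite subr_eq0 (inj_eq einj).
Qed.

Theorem pXi_coupled (R : realType) n l m k x :
  (l <= k)%N -> (l <= m)%N -> (k <= n)%N -> (m - l <= n - k)%N -> (x <= n./2)%N ->
  pXi R n m k l x = coupled_weight R l (k - l) (m - l) (n - k - (m - l)) x.
Proof.
move=> lk lm kn Mr xn; set M := (m - l)%N; set q := (k - l)%N; set N := (n - k - M)%N.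
set c0 : R[i] := ((Num.sqrt ('C(n - k, M))%:R)^-1)%:C%C.
pose f (b : Tn n) : R[i] := c0 * dicke R[i] l k M b.
have c0r : conjc c0 = c0 by rewrite /c0 conjc_real.
have fr b : conjc (f b) = f b by rewrite /f /dicke rmorphM [X in X * _]c0r rmorph_nat.
have XiE : Xi R n m k l = vec f.
  apply/rowP => j; rewrite !mxE /f /dicke -/(prefix_ok l k _).
  by case: ifP; rewrite ?mulr1 ?mulr0.
have kn2 : (n = l + q + M + N)%N by rewrite /N /M /q; lia.
have c02 : c0 ^+ 2 * 'C(n - k, M)%:R = 1.
  have -> : 'C(n - k, M)%:R = ('C(n - k, M)%:R : R)%:C%C by rewrite rmorph_nat.
  rewrite /c0 -rmorphXn -rmorphM exprVn sqr_sqrtr ?ler0n //.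
  by rewrite mulVf ?rmorph1 // pnatr_eq0 -lt0n bin_gt0.
have key zs : \sum_(x < (n./2).+1) hdot (vec f) (orth_proj (isotypic R n x) (vec f))
     * \prod_(z <- zs) (z - casimir R[i] n x) =
   \sum_(x < (n./2).+1) coupled_weight R[i] l q M N x * \prod_(z <- zs) (z - casimir R[i] n x).
  rewrite isotypic_moment //.
  have -> : dotf f (kprod (suffix n 0) zs f) = c0 ^+ 2 * dicke_moment l k M (suffix n 0) zs.
    have -> : kprod (suffix n 0) zs f = fun b => c0 * kprod (suffix n 0) zs (dicke R[i] l k M) b.
      by rewrite -kprodZ.
    rewrite /dotf /dicke_moment /dotf mulr_sumr; apply: eq_bigr => b _; rewrite /f; ring.
  (* M + l and N + q add up to n, so the smaller is at most n/2 and the shapes cover the support. *)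
  rewrite (dicke_moment_all lk kn Mr zs (X := (n./2).+1)); last first.
    by rewrite kn2 in xn *; lia.
  by rewrite mulrA c02 mul1r.
have cE y : coupled_weight R[i] l q M N y = (coupled_weight R l q M N y)%:C%C.
  have gE s t d w : cgw R[i] s t d w = (cgw R s t d w)%:C%C.
    by rewrite /cgw; case: ifP => _; rewrite ?rmorph0 // fmorph_div !rmorph_nat.
  by rewrite /coupled_weight rmorph_sum; apply: eq_bigr => y' _; rewrite rmorphM !gE.
have inj : injective (fun x : 'I_(n./2).+1 => casimir R[i] n x).
  by move=> y y' /(casimir_inj (ltn_ord y) (ltn_ord y')) e; apply: val_inj.
have := fin_moments_eq inj key (Ordinal (xn : (x < (n./2).+1)%N)).
by rewrite /pXi XiE /= => ->; rewrite cE.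
Qed.

(** * Logarithmic increments of the coupling weights *)

Section Ratio.
Variable R : realType.
Implicit Types s t d w : nat.

(** Cross-multiplied, so that it also holds at the edge of the support, where both sides vanish. *)
Lemma cgw_ratio s t d w : let n := (s + t + d)%:R : R in
  cgw R s t d w.+1 * ((n - 2 * w%:R + 1) * (w%:R + 1) * (t%:R + d%:R - w%:R) * (s%:R + t%:R - w%:R))
  = cgw R s t d w * ((n - 2 * w%:R - 1) * (n - w%:R + 1) * (d%:R - w%:R) * (s%:R - w%:R)).
Proof.
move=> n; have [/andP[]|] := boolP ((w < s) && (w < d))%N; last first.
  have [/andP[ws wd]|] := boolP ((w <= s) && (w <= d))%N; last first.
    by move=> H H1; rewrite !cgw0 ?mul0r //; lia.
  move=> H; rewrite [cgw _ _ _ _ w.+1]cgw0 // mul0r.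
  have [->|/eqP ?] := eqVneq w s; first by rewrite subrr !mulr0.
  by have -> : w = d by [lia|]; rewrite subrr !(mulr0, mul0r).
move=> ws wd; have [p es] : exists p, (s = w.+1 + p)%N by exists (s - w.+1)%N; lia.
have [e ed] : exists e, (d = w.+1 + e)%N by exists (d - w.+1)%N; lia.
subst; rewrite cgwE.
rewrite (_ : w.+1 + p = w + p.+1)%N; last by lia.
rewrite (_ : w.+1 + e = w + e.+1)%N; last by lia.
rewrite cgwE /n; natfact; rewrite ?natrD -?natr1 ?natrD.
by field; nzsum (@factR_neq0 R).
Qed.

Lemma ln_linear (u e : R) : 0 < u -> `|e| <= u / 2 ->
  `|ln (u + e) - ln u - e / u| <= 2 * (e / u) ^+ 2.
Proof.
move=> u0 eu; set x := e / u.
have xu : `|x| <= 1 / 2 by rewrite normrM normfV (gtr0_norm u0) ler_pdivrMr //; lra.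
have x1 : 0 < 1 + x by move: xu; rewrite ler_norml; lra.
have -> : u + e = u * (1 + x) by rewrite /x; field; lra.
rewrite lnM ?posrE // (_ : ln u + _ - _ - x = ln (1 + x) - x); last by ring.
have up : ln (1 + x) <= x by apply: le_ln1Dx; lra.
have lo : x / (1 + x) <= ln (1 + x).
  have : ln ((1 + x)^-1) <= (1 + x)^-1 - 1.
    have := @le_ln1Dx _ ((1 + x)^-1 - 1); rewrite addrCA subrr addr0; apply.
    by rewrite ltrBrDr addNr invr_gt0.
  rewrite lnV ?posrE // => h; have -> : x / (1 + x) = 1 - (1 + x)^-1 by field; lra.
  lra.
have xx : x / (1 + x) = x - x ^+ 2 / (1 + x) by field; lra.
have : x ^+ 2 / (1 + x) <= 2 * x ^+ 2.
  rewrite ler_pdivrMr // mulrAC; have := sqr_ge0 x; move: xu; rewrite ler_norml; nra.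
rewrite ler_norml; have := sqr_ge0 x; lra.
Qed.

Lemma le_of_sqr (x y : R) : 0 <= y -> x ^+ 2 <= y ^+ 2 -> x <= y.
Proof. by move=> y0 xy; rewrite leNgt; apply/negP => ?; nra. Qed.

(** The smaller root of w (n - w) = s d with n = s + t + d; the exact mean of w (n + 1 - w) is s
    d. *)
Definition center (s t d : R) : R :=
  ((s + t + d) - Num.sqrt ((s + t + d) ^+ 2 - 4 * (s * d))) / 2.
(** The asymptotic variance; the denominator is the square of the gap n - 2 w0. *)
Definition spread (s t d : R) : R := s * t * d / ((s + t + d) ^+ 2 - 4 * (s * d)).

(** Constants below depend on rho alone; this uniformity is needed because the parameters of the
    second coupling vary with y. *)
Definition balanced (rho s t d : R) :=
  [/\ 0 < rho, 0 < s + t + d, rho * (s + t + d) <= s, rho * (s + t + d) <= t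
    & rho * (s + t + d) <= d].

Lemma center_facts (rho s t d : R) : balanced rho s t d ->
  let n := s + t + d in let w0 := center s t d in
  [/\ (n - 2 * w0) ^+ 2 = n ^+ 2 - 4 * (s * d), w0 * (n - w0) = s * d,
     rho * n <= n - 2 * w0, rho ^+ 2 * n <= w0 &
     (rho ^+ 2 * n <= s - w0) /\ (rho ^+ 2 * n <= d - w0)].
Proof.
move=> [r0]; set n := s + t + d => n0 rs rt rd; set w0 := center s t d.
have rn0 : 0 < rho * n by rewrite mulr_gt0.
have s0 : 0 < s by apply: lt_le_trans rs.
have t0 : 0 < t by apply: lt_le_trans rt.
have d0 : 0 < d by apply: lt_le_trans rd.
have r1 : rho <= 1 by rewrite -(ler_pM2r n0) mul1r; rewrite /n in rs *; lra.
set D := n ^+ 2 - 4 * (s * d).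
have Dlow : rho * n ^+ 2 <= D.
  have : n ^+ 2 - (s + d) ^+ 2 <= D by rewrite /D; have := sqr_ge0 (s - d); nra.
  have -> : n ^+ 2 - (s + d) ^+ 2 = t * (n + s + d) by rewrite /n; ring.
  have : rho * n * n <= t * (n + s + d) by apply: ler_pM; [exact: ltW | exact: ltW | exact: rt | lra].
  by rewrite expr2 mulrA; lra.
have D0 : 0 <= D by apply: le_trans Dlow; rewrite mulr_ge0 ?sqr_ge0 // ltW.
set e := Num.sqrt D; have eE : e ^+ 2 = D by rewrite sqr_sqrtr.
have w0E : n - 2 * w0 = e by rewrite /w0 /center -/n -/D -/e; field.
have e0 : 0 <= e by rewrite sqrtr_ge0.
have elow : rho * n <= e.
  apply: le_of_sqr => //; rewrite eE exprMn; apply: le_trans Dlow.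
  by rewrite ler_wpM2r ?sqr_ge0 // expr2 ler_piMl // ltW.
have prod : w0 * (n - w0) = s * d.
  have -> : w0 = (n - e) / 2 by rewrite -w0E; field.
  rewrite (_ : _ * _ = (n ^+ 2 - e ^+ 2) / 4); last by field.
  by rewrite eE /D; field.
have en : e <= n.
  by apply: le_of_sqr; [exact: ltW | rewrite eE /D; have := mulr_gt0 s0 d0; lra].
have w00 : 0 <= w0 by have := w0E; lra.
have w0n : w0 <= n by lra.
have sd : rho * n * (rho * n) <= s * d by apply: ler_pM; first [exact: ltW | assumption].
have st : rho * n * (rho * n) <= s * t by apply: ler_pM; first [exact: ltW | assumption].
have td : rho * n * (rho * n) <= d * t by apply: ler_pM; first [exact: ltW | assumption].
have quot (x y : R) : y <= n -> 0 <= y -> 0 <= x -> rho * n * (rho * n) <= x * y -> rho ^+ 2 * n <= x.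
  move=> yn y0 x0 h; rewrite -(ler_pM2r n0); have : x * y <= x * n by rewrite ler_wpM2l.
  have -> : rho ^+ 2 * n * n = rho * n * (rho * n) by ring.
  lra.
have pos (x y : R) : 0 < x * y -> 0 < x + y -> 0 < x /\ 0 < y.
  move=> xy xpy; have [x0|x0] := ltP 0 x; have [y0|y0] := ltP 0 y; first by split.
  - by exfalso; nra.
  - by exfalso; nra.
  - by exfalso; lra.
(* Two numbers with positive product and positive sum are positive; each is then at least (rho n)^2
   / n, because the other is at most n. *)
have ps : (s - w0) * (n - w0 - s) = s * t.
  by have -> : (s - w0) * (n - w0 - s) = s * (n - s) - w0 * (n - w0); [ring | rewrite prod /n; ring].
have pd : (d - w0) * (n - w0 - d) = d * t.
  by have -> : (d - w0) * (n - w0 - d) = d * (n - d) - w0 * (n - w0); [ring | rewrite prod /n; ring].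
have [s1 s2] : 0 < s - w0 /\ 0 < n - w0 - s by apply: pos; rewrite ?ps ?mulr_gt0 //; lra.
have [d1 d2] : 0 < d - w0 /\ 0 < n - w0 - d by apply: pos; rewrite ?pd ?mulr_gt0 //; lra.
split=> //; rewrite ?w0E //.
- by apply: (quot _ (n - w0)); rewrite ?prod //; lra.
split; [apply: (quot _ (n - w0 - s)) | apply: (quot _ (n - w0 - d))]; rewrite ?ps ?pd //; lra.
Qed.

End Ratio.

Section Step.
Variable R : realType.

(** The left side is minus the logarithmic derivative at w0 of the ratio in [cgw_ratio] without its
    unit shifts. *)
Lemma spread_inv (s t d w0 : R) : 0 < s -> 0 < t -> 0 < d ->
  let n := s + t + d in w0 * (n - w0) = s * d ->
  0 < w0 -> 0 < n - w0 -> 0 < s - w0 -> 0 < d - w0 ->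
  (n - w0)^-1 + w0^-1 + (d - w0)^-1 + (s - w0)^-1 - (t + d - w0)^-1 - (s + t - w0)^-1
    = (spread s t d)^-1.
Proof.
move=> s0 t0 d0 n prod w00 nw0 sw dw.
have ps : (s - w0) * (t + d - w0) = s * t.
  have -> : (s - w0) * (t + d - w0) = s * (t + d) - w0 * (n - w0) by rewrite /n; ring.
  by rewrite prod; ring.
have pd : (d - w0) * (s + t - w0) = d * t.
  have -> : (d - w0) * (s + t - w0) = d * (s + t) - w0 * (n - w0) by rewrite /n; ring.
  by rewrite prod; ring.
have tdw : 0 < t + d - w0 by lra.
have stw : 0 < s + t - w0 by lra.
have e1 : (n - w0)^-1 + w0^-1 = n / (s * d).
  by rewrite -prod; field; rewrite ?gt_eqF //; lra.
have e2 : (s - w0)^-1 - (t + d - w0)^-1 = (n - 2 * s) / (s * t).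
  by rewrite -ps /n; field; rewrite ?gt_eqF.
have e3 : (d - w0)^-1 - (s + t - w0)^-1 = (n - 2 * d) / (d * t).
  by rewrite -pd /n; field; rewrite ?gt_eqF.
transitivity (n / (s * d) + (n - 2 * s) / (s * t) + (n - 2 * d) / (d * t)).
  by rewrite -e1 -e2 -e3; ring.
rewrite /spread invf_div /n; field.
by rewrite !gt_eqF.
Qed.

(** Without its unit shifts the ratio in [cgw_ratio] equals 1 at the centre. *)
Lemma center_balance (s t d w0 : R) : let n := s + t + d in w0 * (n - w0) = s * d ->
  (n - w0) * (d - w0) * (s - w0) = w0 * (t + d - w0) * (s + t - w0).
Proof.
move=> n prod; apply/eqP; rewrite -subr_eq0; apply/eqP.
transitivity ((n - 2 * w0) * (s * d - w0 * (n - w0))); first by rewrite /n; ring.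
by rewrite prod subrr mulr0.
Qed.

Lemma cgw_gt0 (s t d w : nat) : (w <= s)%N -> (w <= d)%N -> 0 < cgw R s t d w.
Proof.
move=> ws wd; rewrite /cgw ws wd /= divr_gt0 // ltr0n !muln_gt0 !fact_gt0 //.
Qed.

Lemma spread_bounds (rho s t d : R) : balanced rho s t d ->
  rho ^+ 3 * (s + t + d) <= spread s t d /\ spread s t d <= (s + t + d) / rho ^+ 2.
Proof.
move=> bal; have [eD _ u1 _ _] := center_facts bal; have [r0 + rs rt rd] := bal.
move: eD u1; rewrite /spread; set n := s + t + d => eD u1 n0.
rewrite -/n in rs rt rd; have rn0 : 0 < rho * n by rewrite mulr_gt0.
have Dl : rho ^+ 2 * n ^+ 2 <= n ^+ 2 - 4 * (s * d).
  by rewrite -eD -exprMn ler_sqr ?nnegrE ?(ltW rn0) //; apply: le_trans u1; apply: ltW.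
have s0 : 0 < s by apply: lt_le_trans rs.
have t0 : 0 < t by apply: lt_le_trans rt.
have d0 : 0 < d by apply: lt_le_trans rd.
have D0 : 0 < n ^+ 2 - 4 * (s * d).
  by apply: lt_le_trans Dl; rewrite mulr_gt0 ?exprn_gt0.
have sd0 : 0 < s * d by rewrite mulr_gt0.
split.
  rewrite ler_pdivlMr //; apply: (@le_trans _ _ (rho ^+ 3 * n * n ^+ 2)).
    by rewrite ler_wpM2l ?mulr_ge0 ?exprn_ge0 ?(ltW r0) ?(ltW n0) //; clear -sd0; lra.
  have -> : rho ^+ 3 * n * n ^+ 2 = (rho * n) * (rho * n) * (rho * n) by ring.
  by apply: ler_pM => //; [rewrite mulr_ge0 ?ltW| exact: ltW | apply: ler_pM => //; exact: ltW].
rewrite ler_pdivrMr // [leRHS]mulrAC ler_pdivlMr ?exprn_gt0 //.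
apply: (@le_trans _ _ (n * (rho ^+ 2 * n ^+ 2))); last by rewrite ler_wpM2l // ltW.
have -> : n * (rho ^+ 2 * n ^+ 2) = n * n * n * rho ^+ 2 by ring.
rewrite ler_wpM2r ?sqr_ge0 //; apply: ler_pM => //; [by rewrite mulr_ge0 ?ltW|exact: ltW| |].
  by apply: ler_pM; rewrite ?ltW // /n; clear -s0 t0 d0; lra.
by rewrite /n; clear -s0 t0 d0; lra.
Qed.

(** The logarithm of [cgw_ratio] is linearised at w0 factor by factor: constants cancel by
    [center_balance] and linear terms collect into -(w - w0)/v by [spread_inv]. In the error, 16 is
    eight uses of the factor 2 of [ln_linear], 4 / rho^2 pays for the unit shifts and rho^-3 for
    (2v)^-1. *)
Lemma cgw_log_step (rho K h : R) (s t d w : nat) :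
  balanced rho (s%:R) t%:R d%:R -> 0 < K -> (s + t + d)%:R = h ^+ 2 ->
  1 <= h -> 4 * (2 * K + 1) <= rho ^+ 2 * h ->
  let w0 := center s%:R t%:R d%:R : R in
  let v := spread s%:R t%:R d%:R : R in
  `|w%:R - w0| <= K * h ->
  [/\ (w < s)%N, (w < d)%N &
  `|ln (cgw R s t d w.+1) - ln (cgw R s t d w) + (w%:R - w0) / v + (2 * v)^-1|
    <= (16 * (2 * K + 1) ^+ 2 / rho ^+ 4 + 4 / rho ^+ 2 + rho ^- 3) / h ^+ 2].
Proof.
move=> bal K0 nh h1 hK w0 v wK; set n := (s + t + d)%:R : R; rewrite -/n in nh.
have nE : n = s%:R + t%:R + d%:R by rewrite /n !natrD.
have [r0 n0 rs rt rd] := bal; have := center_facts bal.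
rewrite -/w0 -nE => -[eD prod u1 u5 [u4 u3]]; rewrite -nE in n0 rs rt rd; clearbody w0.
have h0 : 0 < h by lra.
set X := w%:R - w0 in wK *.
have rn : rho * n <= n by rewrite nE; rewrite nE in rs; apply: le_trans rs _; have := ler0n R t; have := ler0n R d; lra.
have r1 : rho <= 1 by rewrite -(ler_pM2r n0) mul1r.
have r2 : rho ^+ 2 <= rho by rewrite expr2 ler_piMr // ltW.
have c0 : 0 < rho ^+ 2 * n by rewrite mulr_gt0 // exprn_gt0.
have c1 : rho ^+ 2 * n <= rho * n by rewrite ler_wpM2r // ltW.
have eh : (2 * K + 1) * h <= rho ^+ 2 * n / 4.
  by rewrite nh expr2; have := ler_wpM2r (ltW h0) hK; lra.
have e1 : 2 * `|X| + 1 <= (2 * K + 1) * h by lra.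
have e0 : `|X| <= 2 * `|X| + 1 by have := normr_ge0 X; lra.
have s0 : 0 < s%:R :> R by lra.
have t0 : 0 < t%:R :> R by lra.
have d0 : 0 < d%:R :> R by lra.
have bX : - `|X| <= X <= `|X| by rewrite -ler_norml.
case/andP: bX => bX1 bX2.
have wE : w%:R = w0 + X by rewrite /X; ring.
have small (e : R) : `|e| <= 2 * `|X| + 1 -> `|e| <= rho ^+ 2 * n / 4 by lra.
have fac (u e : R) : rho ^+ 2 * n <= u -> `|e| <= 2 * `|X| + 1 ->
    0 < u + e /\ `|ln (u + e) - ln u - e / u| <= 2 * ((2 * K + 1) ^+ 2 / (rho ^+ 4 * h ^+ 2)).
  move=> cu eX; have u0 : 0 < u by lra.
  have eu : `|e| <= u / 2 by have := small e eX; lra.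
  split; first by have : `|e| <= u / 2 by []; rewrite ler_norml; lra.
  apply: le_trans (ln_linear u0 eu) _; rewrite ler_wpM2l //.
  rewrite -real_normK ?num_real // normrM normfV (gtr0_norm u0).
  have -> : (2 * K + 1) ^+ 2 / (rho ^+ 4 * h ^+ 2) = ((2 * K + 1) * h / (rho ^+ 2 * n)) ^+ 2.
    by rewrite nh; field; rewrite !gt_eqF.
  have K1 : 0 <= 2 * K + 1 by clear -K0; lra.
  rewrite ler_sqr ?nnegrE ?divr_ge0 ?mulr_ge0 ?normr_ge0 ?exprn_ge0 ?(ltW u0) ?(ltW h0) ?(ltW r0) ?(ltW n0) //.
  apply: ler_pM; rewrite ?invr_ge0 ?normr_ge0 //; [lra|lra|].
  by rewrite lef_pV2 ?posrE.
clear small.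
have w00 : 0 < w0 by clear -u5 c0; lra.
have u2 : rho ^+ 2 * n <= n - w0 by clear -u1 w00 c1; lra.
have u6 : rho ^+ 2 * n <= t%:R + d%:R - w0 by clear -u3 c1 rt t0 c0; lra.
have u7 : rho ^+ 2 * n <= s%:R + t%:R - w0 by clear -u4 c1 rt t0 c0; lra.
have u1' : rho ^+ 2 * n <= n - 2 * w0 by clear -u1 c1; lra.
have X0 := normr_ge0 X.
have small1 (e : R) : - (2 * `|X| + 1) <= e <= 2 * `|X| + 1 -> `|e| <= 2 * `|X| + 1.
  by rewrite ler_norml.
have [|b1p b1] := fac _ (- 2 * X - 1) u1'; first by apply: small1; clear -bX1 bX2 X0; lra.
have [|a1p a1] := fac _ (- 2 * X + 1) u1'; first by apply: small1; clear -bX1 bX2 X0; lra.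
have [|b2p b2] := fac _ (1 - X) u2; first by apply: small1; clear -bX1 bX2 X0; lra.
have [|a2p a2] := fac _ (1 + X) u5; first by apply: small1; clear -bX1 bX2 X0; lra.
have smX : `|- X| <= 2 * `|X| + 1 by rewrite normrN; clear -X0; lra.
have [b3p b3] := fac _ _ u3 smX.
have [b4p b4] := fac _ _ u4 smX.
have [a3p a3] := fac _ _ u6 smX.
have [a4p a4] := fac _ _ u7 smX.
have ws : (w < s)%N by rewrite -(ltr_nat R) wE; clear -b4p; lra.
have wd : (w < d)%N by rewrite -(ltr_nat R) wE; clear -b3p; lra.
split=> //.
have G0 : 0 < cgw R s t d w by apply: cgw_gt0; apply: ltnW.
have G1 : 0 < cgw R s t d w.+1 by apply: cgw_gt0.
have := cgw_ratio R s t d w; rewrite -/n /= wE.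
have -> : n - 2 * (w0 + X) + 1 = n - 2 * w0 + (- 2 * X + 1) by ring.
have -> : n - 2 * (w0 + X) - 1 = n - 2 * w0 + (- 2 * X - 1) by ring.
have -> : n - (w0 + X) + 1 = n - w0 + (1 - X) by ring.
have -> : w0 + X + 1 = w0 + (1 + X) by ring.
have -> : t%:R + d%:R - (w0 + X) = t%:R + d%:R - w0 + - X by ring.
have -> : s%:R + t%:R - (w0 + X) = s%:R + t%:R - w0 + - X by ring.
have -> : d%:R - (w0 + X) = d%:R - w0 + - X by ring.
have -> : s%:R - (w0 + X) = s%:R - w0 + - X by ring.
move=> /(congr1 (@ln R)); rewrite !lnM ?posrE ?mulr_gt0 // => lnE.
have := center_balance (s := s%:R) (t := t%:R) (d := d%:R) (w0 := w0); rewrite -nE => /(_ prod).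
have p1 : 0 < n - 2 * w0 by apply: lt_le_trans u1'.
have p2 : 0 < n - w0 by apply: lt_le_trans u2.
have p3 : 0 < d%:R - w0 by apply: lt_le_trans u3.
have p4 : 0 < s%:R - w0 by apply: lt_le_trans u4.
have p6 : 0 < t%:R + d%:R - w0 by apply: lt_le_trans u6.
have p7 : 0 < s%:R + t%:R - w0 by apply: lt_le_trans u7.
move=> /(congr1 (@ln R)); rewrite !lnM ?posrE ?mulr_gt0 // => lnB.
have := spread_inv (s := s%:R) (t := t%:R) (d := d%:R) (w0 := w0); rewrite -nE -/v.
move=> /(_ s0 t0 d0 prod w00 p2 p4 p3) vI.
have linE : (- 2 * X - 1) / (n - 2 * w0) - (- 2 * X + 1) / (n - 2 * w0) + (1 - X) / (n - w0)
   - (1 + X) / w0 + - X / (d%:R - w0) + - X / (s%:R - w0) - - X / (t%:R + d%:R - w0)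
   - - X / (s%:R + t%:R - w0)
   = - X / v - 2 / (n - 2 * w0) + (n - w0)^-1 - w0^-1.
  by rewrite -vI; ring.
have cinv (u : R) : rho ^+ 2 * n <= u -> 0 < u^-1 /\ u^-1 <= (rho ^+ 2 * h ^+ 2)^-1.
  move=> cu; have u0 : 0 < u by apply: lt_le_trans cu.
  by rewrite invr_gt0 lef_pV2 ?posrE // -nh.
have [q1 q1'] := cinv _ u1'; have [q2 q2'] := cinv _ u2; have [q5 q5'] := cinv _ u5.
have [vl _] := spread_bounds bal; rewrite -/v -nE nh in vl.
have v0' : 0 < rho ^+ 3 * h ^+ 2 by rewrite mulr_gt0 ?exprn_gt0.
have v0 : 0 < v^-1 by rewrite invr_gt0; apply: lt_le_trans vl.
have vb : v^-1 <= (rho ^+ 3 * h ^+ 2)^-1.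
  by rewrite lef_pV2 ?posrE //; apply: lt_le_trans vl.
have -> : (16 * (2 * K + 1) ^+ 2 / rho ^+ 4 + 4 / rho ^+ 2 + rho ^- 3) / h ^+ 2 =
  16 * ((2 * K + 1) ^+ 2 / (rho ^+ 4 * h ^+ 2)) + 4 * (rho ^+ 2 * h ^+ 2)^-1 + (rho ^+ 3 * h ^+ 2)^-1.
  by field; rewrite !gt_eqF.
have -> : (2 * v)^-1 = v^-1 / 2 by rewrite invfM mulrC.
move: a1 a2 a3 a4 b1 b2 b3 b4; rewrite !ler_norml.
move: linE lnB lnE q1 q1' q2 q2' q5 q5' v0 vb; clear.
lra.
Qed.
End Step.

(** * Concentration *)

Section Chebyshev.
Variable R : realType.

(** The exact variance of the Casimir value, whose mean is s d; the square expands in the moments of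
    [cgw_moment] of orders 0, 1 and 2. *)
Lemma cgw_variance (s t d X : nat) : (minn s d < X)%N ->
  \sum_(w < X) cgw R s t d w * (w%:R * ((s + t + d)%:R + 1 - w%:R) - s%:R * d%:R) ^+ 2
    = s%:R * d%:R * (t%:R + 1).
Proof.
case: X => // X; rewrite ltnS => le_X.
have m0 := sum_cgw R t le_X.
have m1 := cgw_moment R t 1 le_X; rewrite [RHS]big_ord_recl big_ord0 /= subr0 addr0 mulr1 in m1.
have m2 := cgw_moment R t 2 le_X.
rewrite [RHS]big_ord_recl [X in _ = _ * X]big_ord_recl big_ord0 /= subr0 addr0 mulr1 in m2.
have m2' : \sum_(w < X.+1) cgw R s t d w * (((s%:R - w%:R) * ((t + d).+1%:R - w%:R)) *
    ((s%:R - 1 - w%:R) * ((t + d).+1%:R + 1 - w%:R))) = s%:R * t.+1%:R * ((s%:R - 1) * (t.+1%:R + 1)).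
  rewrite -m2; apply: eq_bigr => w _; rewrite !big_ord_recl big_ord0 /= mulr1.
  by rewrite /bump /= subr0 addr0.
have m1' : \sum_(w < X.+1) cgw R s t d w * ((s%:R - w%:R) * ((t + d).+1%:R - w%:R)) = s%:R * t.+1%:R.
  by rewrite -m1; apply: eq_bigr => w _; rewrite big_ord_recl big_ord0 /= mulr1 subr0 addr0.
clear m1 m2; rewrite -!natr1 !natrD in m1' m2' *.
set S := s%:R in m1' m2' *; set T := t%:R in m1' m2' *; set D := d%:R in m1' m2' *.
pose f1 w := (S - w%:R) * (T + D + 1 - w%:R).
pose f2 w := f1 w * ((S - 1 - w%:R) * (T + D + 1 + 1 - w%:R)).
transitivity (\sum_(w < X.+1) (cgw R s t d w * f2 w + (T + D + 2 - S - 2 * S * (T + 1)) * (cgw R s t d w * f1 w)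
   + (S * (T + 1)) ^+ 2 * cgw R s t d w)).
  by apply: eq_bigr => w _; rewrite /f2 /f1; ring.
rewrite !big_split /= -!mulr_sumr m0 /f2 m2' m1'; ring.
Qed.

(** Chebyshev for w (n + 1 - w), not for w: its deviation is (w - w0)(n - w0 - w) + w, where the
    second factor is at least rho n / 2 and w is at most n/2. This leaves rho theta n / 4, and the
    variance is at most 2 n^3, whence 32. *)
Lemma cgw_chebyshev (rho theta : R) (s t d X : nat) :
  balanced rho s%:R t%:R d%:R -> 2 <= rho * theta -> (minn s d < X)%N ->
  \sum_(w < X | theta <= `|w%:R - center s%:R t%:R d%:R|) cgw R s t d w
    <= 32 * (s + t + d)%:R / (rho ^+ 2 * theta ^+ 2).
Proof.
move=> bal th leX; set n := (s + t + d)%:R; have nE : n = s%:R + t%:R + d%:R by rewrite /n !natrD.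
have [r0 n0 rs rt rd] := bal; have := center_facts bal.
set w0 := center _ _ _; rewrite -nE => -[_ prod u1 u5 _]; rewrite -nE in n0 rs rt rd; clearbody w0.
have th0 : 0 < theta by rewrite -(pmulr_rgt0 _ r0); apply: lt_le_trans th.
have c0 : 0 < rho * theta * n / 4 by rewrite divr_gt0 ?mulr_gt0.
have rn0 : 0 < rho * n by rewrite mulr_gt0.
have n1 : 1 <= n by rewrite /n ler1n lt0n; apply: contraTneq n0 => e; rewrite /n e ltxx.
apply: (@le_trans _ _ ((\sum_(w < X) cgw R s t d w * (w%:R * (n + 1 - w%:R) - s%:R * d%:R) ^+ 2)
    / (rho * theta * n / 4) ^+ 2)).
  rewrite mulr_suml big_mkcond; apply: ler_sum => -[w /= _] _; case: ifP => far; last first.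
    by rewrite mulr_ge0 ?invr_ge0 ?sqr_ge0 // mulr_ge0 ?cgw_ge0 ?sqr_ge0.
  have [/andP[ws wd]|H] := boolP ((w <= s) && (w <= d))%N; last by rewrite cgw0 ?mul0r.
  rewrite ler_pdivlMr ?exprn_gt0 // ler_wpM2l ?cgw_ge0 //.
  rewrite -[leRHS]real_normK ?num_real // ler_sqr ?nnegrE ?normr_ge0 ?(ltW c0) //.
  have -> : w%:R * (n + 1 - w%:R) - s%:R * d%:R = (w%:R - w0) * (n - w0 - w%:R) + w%:R.
    by rewrite -prod; ring.
  have wn : 2 * w%:R <= n by rewrite /n -natrM ler_nat; clear -ws wd; lia.
  have gap : rho * n / 2 <= n - w0 - w%:R by clear -wn u1; lra.
  have gap0 : 0 < rho * n / 2 by clear -rn0; lra.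
  have w0' : 0 <= w%:R :> R by exact: ler0n.
  have far' : theta * (rho * n / 2) <= `|(w%:R - w0) * (n - w0 - w%:R)|.
    rewrite normrM (gtr0_norm (lt_le_trans gap0 gap)).
    exact: (ler_pM (ltW th0) (ltW gap0) far gap).
  have := lerB_dist ((w%:R - w0) * (n - w0 - w%:R)) (- w%:R); rewrite opprK normrN (ger0_norm w0').
  have : 2 * n <= rho * theta * n by rewrite ler_wpM2r // ltW.
  by clear -wn far'; lra.
rewrite cgw_variance // ler_pdivrMr ?exprn_gt0 //.
have -> : 32 * n / (rho ^+ 2 * theta ^+ 2) * (rho * theta * n / 4) ^+ 2 = n * n * (2 * n).
  by field; rewrite !gt_eqF.
have S0 := ler0n R s; have T0 := ler0n R t; have D0 := ler0n R d.
have sn : s%:R <= n by rewrite nE; clear -T0 D0; lra.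
have dn : d%:R <= n by rewrite nE; clear -T0 S0; lra.
have tn : t%:R <= n by rewrite nE; clear -S0 D0; lra.
apply: ler_pM; [by rewrite mulr_ge0 | by rewrite addr_ge0 | by apply: ler_pM | clear -tn n1; lra].
Qed.

End Chebyshev.

(** * Riemann sums of the Gaussian density *)

Section Gauss.
Import numFieldNormedType.Exports.
Variable R : realType.
Notation mu := (@lebesgue_measure R).

Definition phi (x : R) : R := (Num.sqrt (2 * pi))^-1 * expR (- (x ^+ 2) / 2).

Lemma phiE : phi = normal_pdf 0 1.
Proof.
apply/funext => x; rewrite normal_pdfE ?oner_neq0 // /normal_peak /normal_fun expr1n mul1r subr0.
by rewrite /phi mulr_natl.
Qed.

Lemma peak_le1 : (Num.sqrt (2 * pi))^-1 <= 1 :> R.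
Proof.
have p2 := @pi_ge2 R; rewrite invf_le1 ?sqrtr_gt0; last by lra.
by rewrite -[leLHS]sqrtr1 ler_wsqrtr //; lra.
Qed.

Lemma peak_gt0 : 0 < (Num.sqrt (2 * pi))^-1 :> R.
Proof. by rewrite invr_gt0 sqrtr_gt0 mulr_gt0 // pi_gt0. Qed.

Lemma phi_gt0 x : 0 < phi x.
Proof. by rewrite mulr_gt0 ?expR_gt0 // peak_gt0. Qed.

Lemma phi_le1 x : phi x <= 1.
Proof.
rewrite -[leRHS]mulr1 ler_pM ?expR_ge0 ?peak_le1 ?(ltW peak_gt0) //.
by rewrite -[leRHS]expR0 ler_expR; have := sqr_ge0 x; lra.
Qed.

Lemma is_derive_phi (x : R) : is_derive x 1 phi (- x * phi x).
Proof.
have dq : is_derive x 1 (fun x : R => - x ^+ 2 / 2) (- x).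
  by apply: is_derive_eq; rewrite !scaler0 add0r /GRing.scale /=; field.
have -> : - x * phi x = (Num.sqrt (2 * pi))^-1 * (expR (- x ^+ 2 / 2) * (- x)).
  by rewrite /phi; ring.
by apply: is_deriveZ; apply: is_derive1_comp.
Qed.

Definition Phi (x : R) : R := (\int[mu]_(t in [set` `]-oo, x]]) phi t)%R.

Lemma integrable_phi A : measurable A -> mu.-integrable A (EFin \o phi).
Proof.
move=> mA; apply: (integrableS _ mA (@subsetT _ A)) => //.
by rewrite phiE; apply: integrable_normal_pdf.
Qed.

Lemma gauss_windowE t u : t <= u -> gauss_window t u = Phi u - Phi t.
Proof.
move=> tu; rewrite /Phi Rintegral_itvB //; last exact: integrable_phi.
rewrite Rintegral_itv_obnd_cbnd; last exact: integrable_phi.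
have s0 : Num.sqrt (2 * pi) != 0 :> R by rewrite -invr_eq0 gt_eqF // peak_gt0.
rewrite /gauss_window (_ : (fun s => _) = fun s => Num.sqrt (2 * pi) * phi s); last first.
  by apply/funext => s; rewrite /phi mulVKf.
by rewrite RintegralZl ?mulKf //; apply: integrable_phi.
Qed.

Lemma is_derive_Phi (x : R) : is_derive x 1 Phi (phi x).
Proof.
have [] := @continuous_FTC1 R phi -oo%O x (x + 1).
- by rewrite ltrDl.
- exact: integrable_phi.
- exact: ltNyr.
- by rewrite phiE; apply: continuous_normal_pdf.
rewrite derive1E => dP dE; exact: (DeriveDef dP dE).
Qed.

Lemma phi_lipschitz (x y : R) : x <= y -> `|phi y - phi x| <= y - x.
Proof.
rewrite le_eqVlt => /orP[/eqP->|xy]; first by rewrite !subrr normr0.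
have [|c _ ->] := MVT xy (fun z _ => is_derive_phi z).
  apply: continuous_subspaceT => z; rewrite phiE.
  by apply: continuous_normal_pdf; rewrite oner_neq0.
rewrite normrM (gtr0_norm (_ : 0 < y - x)) ?subr_gt0 // ler_piMl ?subr_ge0 ?(ltW xy) //.
rewrite normrM normrN (gtr0_norm (phi_gt0 c)) /phi.
have e0 := expR_gt0 (- c ^+ 2 / 2); have p0 := peak_gt0; have p1 := peak_le1.
rewrite mulrCA; apply: (@le_trans _ _ (1 * (`|c| * expR (- c ^+ 2 / 2)))).
  by rewrite ler_wpM2r // mulr_ge0 // ltW.
rewrite mul1r; have -> : - c ^+ 2 / 2 = - (c ^+ 2 / 2) by ring.
rewrite expRN ler_pdivrMr ?expR_gt0 // mul1r.
apply: le_trans (expR_ge1Dx _); rewrite -[c ^+ 2]real_normK ?num_real //.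
by have := sqr_ge0 (`|c| - 1); lra.
Qed.

Lemma Phi_step (z h : R) : 0 < h -> `|h * phi z - (Phi (z + h) - Phi z)| <= h ^+ 2.
Proof.
move=> h0; have zh : z < z + h by rewrite ltrDl.
have [|c] := MVT zh (fun z _ => is_derive_Phi z).
  apply: continuous_subspaceT => x.
  by apply: differentiable_continuous; apply/derivable1_diffP; have [] := is_derive_Phi x.
rewrite in_itv /= => /andP[zc ch] ->.
have -> : h * phi z - phi c * (z + h - z) = - (h * (phi c - phi z)) by ring.
rewrite normrN normrM (gtr0_norm h0) expr2 ler_wpM2l ?(ltW h0) //.
by apply: le_trans (phi_lipschitz (ltW zc)) _; lra.
Qed.

Lemma Phi_le (x y : R) : x <= y -> 0 <= Phi y - Phi x <= y - x.
Proof.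
rewrite le_eqVlt => /orP[/eqP->|xy]; first by rewrite !subrr lexx.
have [|c _ ->] := MVT xy (fun z _ => is_derive_Phi z).
  apply: continuous_subspaceT => z.
  by apply: differentiable_continuous; apply/derivable1_diffP; have [] := is_derive_Phi z.
have := phi_gt0 c; have := phi_le1 c; set p := phi c => p1 p0.
rewrite mulr_ge0 ?(ltW p0) ?subr_ge0 ?(ltW xy) //= ler_piMl ?subr_ge0 ?(ltW xy) //.
Qed.

(* Both ends of the window are handled by clipping, so that every error term
   telescopes. *)
Lemma riemann_phi (tau xi t u : R) (X : nat) : 0 < tau -> t <= u ->
  0 <= xi + t * tau -> xi + u * tau <= X%:R ->
  `| \sum_(y < X | (t <= (y%:R - xi) / tau) && ((y%:R - xi) / tau <= u)) phi ((y%:R - xi) / tau) / tau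
     - (Phi u - Phi t) | <= (u - t + 3) / tau.
Proof.
move=> tau0 tu lo hi; pose h := tau^-1; have h0 : 0 < h by rewrite invr_gt0.
pose z (y : nat) := (y%:R - xi) / tau.
have zS y : z y.+1 = z y + h by rewrite /z /h -natr1; ring.
pose cl (x : R) := Num.min u (Num.max t x).
(* Error budget of one cell: h times its clipped length, by [Phi_step], plus 2h if the cell crosses
   u and h if it crosses t. *)
pose e y := h * (cl (z y.+1) - cl (z y)) + 2 * h * ((z y <= u)%R%:R - (z y.+1 <= u)%R%:R)
  + h * ((z y < t)%R%:R - (z y.+1 < t)%R%:R).
have z0 : z 0%N <= t by rewrite /z ler_pdivrMr //; lra.
have zX : u <= z X by rewrite /z ler_pdivlMr //; lra.
have tel (f : nat -> R) : \sum_(y < X) (f y.+1 - f y) = f X - f 0%N.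
  by rewrite -(big_mkord xpredT (fun y => f y.+1 - f y)) telescope_sumr.
have clt : cl (z 0%N) = t by rewrite /cl (max_idPl _) // (min_idPr _).
have clu : cl (z X) = u by rewrite /cl (min_idPl _) // le_max zX orbT.
have telN (f : nat -> R) : \sum_(y < X) (f y - f y.+1) = f 0%N - f X.
  by rewrite -opprB -(tel f) -sumrN; apply: eq_bigr => i _; rewrite opprB.
have := tel (fun y => Phi (cl (z y))); rewrite clt clu => <-; rewrite big_mkcond -sumrB.
apply: le_trans (ler_norm_sum _ _ _) _.
apply: (@le_trans _ _ (\sum_(y < X) e y)); last first.
  rewrite /e !big_split /= -!mulr_sumr.
  have -> : \sum_(i < X) (cl (z i.+1) - cl (z i)) = u - t.
    by rewrite (tel (fun y => cl (z y))) clu clt.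
  have -> : \sum_(i < X) ((z i <= u)%R%:R - (z i.+1 <= u)%R%:R) = (z 0%N <= u)%R%:R - (z X <= u)%R%:R :> R.
    exact: (telN (fun y => (z y <= u)%R%:R)).
  have -> : \sum_(i < X) ((z i < t)%R%:R - (z i.+1 < t)%R%:R) = (z 0%N < t)%R%:R - (z X < t)%R%:R :> R.
    exact: (telN (fun y => (z y < t)%R%:R)).
  rewrite -/h; have b01 (b : bool) : 0 <= (b%:R : R) <= 1 by case: b; rewrite ?lexx ?ler01.
  have := b01 (z 0%N <= u)%R; have := b01 (z X <= u)%R; have := b01 (z 0%N < t)%R; have := b01 (z X < t)%R.
  by clear -h0; nra.
apply: ler_sum => y _; rewrite /e -/(z y) zS -/h.
have p1 := phi_le1 (z y); have p0 := phi_gt0 (z y).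
have := Phi_step (z y) h0; rewrite ler_norml.
rewrite ler_norml -/(cl _) -/(cl (_ + _)); move: p1 p0; set Z := z y; clearbody Z => p1 p0 S.
have cl1 x : x <= t -> cl x = t.
  by move=> xt; rewrite /cl (max_idPl xt) (min_idPr tu).
have cl2 x : t <= x -> x <= u -> cl x = x.
  by move=> tx xu; rewrite /cl (max_idPr tx) (min_idPr xu).
have cl3 x : u <= x -> cl x = u.
  by move=> ux; rewrite /cl (min_idPl _) // le_max ux orbT.
have hp : 0 <= h * phi Z <= h by rewrite mulr_ge0 ?ler_piMr // ltW.
rewrite [phi Z / tau]mulrC -/h; clearbody cl h.
have [Zt|tZ] := ltP Z t.
  have Zu : Z <= u by apply: le_trans tu; apply: ltW.
  rewrite (cl1 Z (ltW Zt)) Zu /=; have [Zht|tZh] := ltP (Z + h) t.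
    have Zhu : Z + h <= u by apply: le_trans tu; apply: ltW.
    rewrite cl1 ?(ltW Zht) // Zhu /=. lra.
  have [Zhu|uZh] := leP (Z + h) u.
    rewrite cl2 //; have := Phi_le tZh; have : 0 <= h * (Z + h - t) by rewrite mulr_ge0 ?subr_ge0 // ltW.
    by rewrite /=; lra.
  rewrite cl3 ?(ltW uZh) //; have := Phi_le tu; have : 0 <= h * (u - t) by rewrite mulr_ge0 ?subr_ge0 // ltW.
  by rewrite /=; lra.
have tZh : (Z + h < t) = false by apply/negbTE; rewrite -leNgt; lra.
rewrite tZh; have [Zu|uZ] := leP Z u; last first.
  have uZh : u < Z + h by lra.
  rewrite (cl3 Z (ltW uZ)) (cl3 (Z + h) (ltW uZh)) (lt_geF uZh) /=; lra.
rewrite (cl2 Z) //=; have [Zhu|uZh] := leP (Z + h) u.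
  have tzh : t <= Z + h by lra.
  by rewrite cl2 //=; lra.
rewrite cl3 ?(ltW uZh) //; have := Phi_le Zu; have : 0 <= h * (u - Z) by rewrite mulr_ge0 ?subr_ge0 // ltW.
by rewrite /=; lra.
Qed.

Local Open Scope classical_set_scope.
(** Continuity from below of the normal probability along growing intervals. *)
Lemma Phi_mass (eps : R) : 0 < eps -> exists2 K : R, 0 < K &
  forall t u, t <= - K -> K <= u -> 1 - eps <= Phi u - Phi t <= 1.
Proof.
move=> eps0.
have win t u : t <= u -> Phi u - Phi t = fine (normal_prob 0 1 `[t, u]).
  move=> tu; rewrite /normal_prob /Phi Rintegral_itvB //; last exact: integrable_phi.
  rewrite Rintegral_itv_obnd_cbnd; last exact: integrable_phi.
  by rewrite /Rintegral phiE.
pose F (n : nat) := `[- (n%:R : R), n%:R] : set R.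
have UF : \bigcup_n F n = setT.
  apply/seteqP; split=> // x _; exists (Num.bound `|x|) => //=.
  rewrite /F /= in_itv /= -ler_norml; apply/ltW; exact: archi_boundP.
have cv : fine (normal_prob 0 1 (F n)) @[n --> \oo] --> (1 : R).
  apply: fine_cvg; have <- : normal_prob 0 1 [set: R] = 1%:E by exact: probability_setT.
  rewrite -UF; apply: nondecreasing_cvg_mu => //.
  - by move=> n; exact: measurable_itv.
  - by rewrite UF.
  move=> m n mn; apply/subsetPset; apply: subset_itv; rewrite bnd_simp ?lerN2 ler_nat //.
have /cvgrPdist_lt /(_ eps eps0) [N _ HN] := cv.
have := HN N (leqnn N); rewrite /F -win; last by rewrite ge0_cp ?ler0n.
rewrite ltr_norml => /andP[_ HN'].
exists (Num.max 1 N%:R); first by rewrite lt_max ltr01.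
move=> t u tK Ku; have [KN K1] : N%:R <= Num.max 1 N%:R :> R /\ 1 <= Num.max 1 N%:R :> R.
  by rewrite !le_max !lexx orbT.
have tu : t <= u by lra.
apply/andP; split.
  have /Phi_le : - N%:R <= N%:R :> R by have := ler0n R N; lra.
  have tN : t <= - N%:R by lra.
  have Nu : N%:R <= u by lra.
  have := Phi_le tN; have := Phi_le Nu; lra.
rewrite win // -[leRHS]/(fine (1%:E : \bar R)); apply: fine_le => //.
  by apply: fin_num_measure; exact: measurable_itv.
by apply: probability_le1; exact: measurable_itv.
Qed.

End Gauss.

(** * Local limit theorem for one coupling *)

Section LocalLimit.
Variable R : realType.

Lemma sqrt_large (H : R) : exists N : nat, forall n, (N <= n)%N -> H <= Num.sqrt n%:R.
Proof.
exists (Num.bound (H ^+ 2)) => n Nn; apply: le_of_sqr; first exact: sqrtr_ge0.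
rewrite sqr_sqrtr ?ler0n //; apply/ltW; apply: lt_le_trans (archi_boundP (sqr_ge0 _)) _.
by rewrite ler_nat.
Qed.

Lemma increments_bound (f : nat -> R) (c : R) (a b : nat) : (a <= b)%N ->
  (forall i, (a <= i < b)%N -> `|f i.+1 - f i| <= c) -> `|f b - f a| <= (b - a)%:R * c.
Proof.
move=> ab; rewrite -(subnKC ab); elim: (b - a)%N => [|k IH] H.
  by rewrite addn0 subrr normr0 subnn mul0r.
have -> : f (a + k.+1)%N - f a = (f (a + k).+1 - f (a + k)%N) + (f (a + k)%N - f a).
  by rewrite addnS; ring.
apply: le_trans (ler_normD _ _) _.
have -> : (a + k.+1 - a)%N = (a + k - a).+1 by lia.
rewrite -natr1 mulrDl mul1r addrC lerD //.
  by apply: IH => i /andP[ai ik]; apply: H; rewrite ai addnS ltnS ltnW.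
by apply: H; rewrite leq_addr addnS ltnSn.
Qed.

Definition gauss_at (v x : R) : R := phi (x / Num.sqrt v) / Num.sqrt v.

Lemma gauss_at_gt0 v x : 0 < v -> 0 < gauss_at v x.
Proof. by move=> v0; rewrite divr_gt0 ?phi_gt0 ?sqrtr_gt0. Qed.

Lemma gauss_at_exp v x y : 0 < v ->
  gauss_at v x * expR (x ^+ 2 / (2 * v)) = gauss_at v y * expR (y ^+ 2 / (2 * v)).
Proof.
move=> v0; have E z : gauss_at v z * expR (z ^+ 2 / (2 * v)) =
    (Num.sqrt (2 * pi))^-1 / Num.sqrt v.
  rewrite /gauss_at /phi expr_div_n sqr_sqrtr ?(ltW v0) //.
  have -> : - (z ^+ 2 / v) / 2 = - (z ^+ 2 / (2 * v)) by field; rewrite gt_eqF.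
  by rewrite expRN; field; rewrite !gt_eqF ?expR_gt0 ?sqrtr_gt0 // mulr_gt0 ?pi_gt0.
by rewrite !E.
Qed.

(** This fixes the normalisation without Stirling's formula: if G / g varies little over a window in
    which both have mass close to 1, then G is close to g at each point. *)
Lemma ratio_window (I : finType) (P : pred I) (G g : I -> R) (e1 : R) (i : I) :
  0 < e1 -> e1 <= 1 / 8 -> P i ->
  (forall j, P j -> 0 < g j) -> (forall j, P j -> 0 <= G j) ->
  (forall j k, P j -> P k -> G j * g k <= (1 + 2 * e1) * (G k * g j)) ->
  1 - e1 <= \sum_(j | P j) G j <= 1 -> 1 - 2 * e1 <= \sum_(j | P j) g j <= 1 + e1 ->
  `|G i - g i| <= 8 * e1 * g i.
Proof.
move=> e0 e8 Pi g0 G0 ratio /andP[G1 G2] /andP[g1 g2].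
have up : G i * \sum_(j | P j) g j <= (1 + 2 * e1) * g i * \sum_(j | P j) G j.
  by rewrite !mulr_sumr; apply: ler_sum => k Pk; have := ratio _ _ Pi Pk; lra.
have lo : g i * \sum_(j | P j) G j <= (1 + 2 * e1) * G i * \sum_(j | P j) g j.
  by rewrite !mulr_sumr; apply: ler_sum => k Pk; have := ratio _ _ Pk Pi; lra.
have gi := g0 i Pi; have Gi := G0 i Pi.
move: up lo G1 G2 g1 g2; set SG := \sum_(j | P j) G j; set Sg := \sum_(j | P j) g j.
move=> up lo G1 G2 g1 g2; clear -e0 e8 gi Gi up lo G1 G2 g1 g2.
have a1 : G i * (1 - 2 * e1) <= G i * Sg by rewrite ler_wpM2l.
have a2 : (1 + 2 * e1) * g i * SG <= (1 + 2 * e1) * g i.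
  by rewrite ler_piMr // mulr_ge0 ?(ltW gi) //; lra.
have a3 : g i * (1 - e1) <= g i * SG by rewrite ler_wpM2l // ltW.
have a4 : (1 + 2 * e1) * G i * Sg <= (1 + 2 * e1) * G i * (1 + e1).
  by rewrite ler_wpM2l // mulr_ge0 //; lra.
have u1 : G i * (1 - 2 * e1) <= (1 + 2 * e1) * g i by lra.
have u2 : g i * (1 - e1) <= (1 + 2 * e1) * G i * (1 + e1) by lra.
rewrite ler_norml; apply/andP; split.
  have b1 : g i * (1 - 8 * e1) * ((1 + 2 * e1) * (1 + e1)) <= g i * (1 - e1).
    rewrite -mulrA ler_wpM2l ?(ltW gi) //; clear -e0 e8; nra.
  rewrite -(@ler_pM2r _ ((1 + 2 * e1) * (1 + e1))); last by rewrite mulr_gt0 //; lra.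
  by lra.
rewrite -(@ler_pM2r _ (1 - 2 * e1)); last by lra.
have b2 : g i * (1 + 2 * e1) <= g i * ((1 + 8 * e1) * (1 - 2 * e1)).
  rewrite ler_wpM2l ?(ltW gi) //; clear -e0 e8; nra.
by lra.
Qed.


Lemma expR_le_lin (e : R) : 0 <= e -> e <= 1 / 2 -> expR e <= 1 + 2 * e.
Proof.
move=> e0 e2; have : expR (- e) >= 1 - e by have := expR_ge1Dx (- e).
rewrite expRN => h; have p := expR_gt0 e.
have : (1 - e) * expR e <= 1 by rewrite -ler_pdivlMr // div1r.
move=> h2; have q : (1 - e) * (1 + 2 * e) >= 1 by nra.
by rewrite -(@ler_pM2l _ (1 - e)); lra.
Qed.

(** Both inputs of [ratio_window] are checked on |y - w0| <= T tau: ratios from [cgw_log_step],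
    masses from Chebyshev's inequality and a Riemann sum. *)
Lemma cgw_llt (rho K eps : R) : 0 < rho -> 0 < K -> 0 < eps ->
  exists N0 : nat, forall s t d : nat, (N0 <= s + t + d)%N ->
  balanced rho s%:R t%:R d%:R -> forall w : nat,
  let x := w%:R - center s%:R t%:R d%:R in let v := spread s%:R t%:R d%:R in
  `|x| <= K * Num.sqrt (s + t + d)%:R ->
  `|cgw R s t d w - gauss_at v x| <= eps * gauss_at v x.
Proof.
move=> r0 K0 eps0; pose e1 := Num.min eps 1 / 8.
have m1 : Num.min eps 1 <= 1 by rewrite ge_min lexx orbT.
have m2 : Num.min eps 1 <= eps by rewrite ge_min lexx.
have m0 : 0 < Num.min eps 1 by rewrite lt_min eps0 ltr01.
have e10 : 0 < e1 by rewrite /e1; lra.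
have e18 : e1 <= 1 / 8 by rewrite /e1; lra.
have e1e : 8 * e1 <= eps by rewrite /e1; lra.
clearbody e1; clear m1 m2 m0.
have [K1 K10 mass] := Phi_mass e10.
have p k : 0 < rho ^+ k by rewrite exprn_gt0.
have A0 : 0 < K / rho ^+ 2 by rewrite divr_gt0.
have B0 : 0 < 32 / (rho ^+ 5 * e1) by rewrite divr_gt0 ?mulr_gt0.
(* Since tau lies between rho^2 h and h / rho, the summands ensure in turn Gaussian mass 1 - e1, a
   window containing |x| <= K h, and a Chebyshev tail of at most e1. *)
pose T := K1 + K / rho ^+ 2 + 32 / (rho ^+ 5 * e1) + 1.
have T1 : 1 <= T by rewrite /T; lra.
have T0 : 0 <= T by apply: le_trans T1.
have TK1 : K1 <= T by rewrite /T; lra.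
have TK : K <= T * rho ^+ 2 by rewrite -ler_pdivrMr // /T; lra.
have Tc : 32 <= T * (rho ^+ 5 * e1) by rewrite -ler_pdivrMr ?mulr_gt0 // /T; lra.
clearbody T; clear A0 B0.
pose K2 := T / rho; have K20 : 0 < K2 by rewrite divr_gt0 //; lra.
have K2E : K2 * rho = T by rewrite /K2 divfK // gt_eqF.
clearbody K2.
have [C CE] : exists C, C = 16 * (2 * K2 + 1) ^+ 2 / rho ^+ 4 + 4 / rho ^+ 2 + rho ^- 3 by eexists.
have C0 : 0 < C.
  by rewrite CE !addr_gt0 ?divr_gt0 ?mulr_gt0 ?invr_gt0 ?exprn_gt0 //; lra.
have H1 : 0 < 4 * (2 * K2 + 1) / rho ^+ 2 by rewrite divr_gt0 ?mulr_gt0 //; lra.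
have H2 : 0 < 2 * K2 * C / e1 by rewrite divr_gt0 // !mulr_gt0.
have H3 : 0 < (2 * T + 3) / (rho ^+ 2 * e1) by rewrite divr_gt0 ?mulr_gt0 //; lra.
have H4 : 0 < 2 / rho ^+ 3 by rewrite divr_gt0.
have [N0 HN] := sqrt_large (1 + 4 * (2 * K2 + 1) / rho ^+ 2 + 2 * K2 * C / e1 + (2 * T + 3) / (rho ^+ 2 * e1)
  + 2 / rho ^+ 3).
exists N0 => s t d nN bal w x v xK.
set h := Num.sqrt (s + t + d)%:R in xK.
have hH : _ <= h := HN _ nN.
have h1 : 1 <= h by lra.
have hK2 : 4 * (2 * K2 + 1) <= rho ^+ 2 * h by rewrite [leRHS]mulrC -ler_pdivrMr //; lra.
have hC : 2 * K2 * C <= e1 * h by rewrite [leRHS]mulrC -ler_pdivrMr //; lra.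
have hT : 2 * T + 3 <= e1 * (rho ^+ 2 * h).
  have : 2 * T + 3 <= h * (rho ^+ 2 * e1) by rewrite -ler_pdivrMr ?mulr_gt0 //; lra.
  by clear; lra.
have h3 : 2 <= rho ^+ 3 * h by rewrite [leRHS]mulrC -ler_pdivrMr //; lra.
clear H1 H2 H3 H4 hH HN.
have hn : (s + t + d)%:R = h ^+ 2 by rewrite sqr_sqrtr ?ler0n.
have h0 : 0 < h by lra.
clearbody h.
have nE : s%:R + t%:R + d%:R = h ^+ 2 by rewrite -!natrD.
have [_ n0 rs rt rd] := bal; rewrite nE in n0 rs rt rd.
have [vl vu] := spread_bounds bal; rewrite -/v nE in vl vu.
have := center_facts bal; rewrite nE => -[_ _ _].
set w0 := center _ _ _ => cl [cs cd].
have v0 : 0 < v by apply: lt_le_trans vl; rewrite mulr_gt0 ?exprn_gt0.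
pose tau := Num.sqrt v; have tau0 : 0 < tau by rewrite sqrtr_gt0.
have tauE : tau ^+ 2 = v by rewrite sqr_sqrtr // ltW.
have r1 : rho <= 1.
  rewrite -(ler_pM2r n0) mul1r -nE; apply: le_trans (_ : s%:R <= _); first by rewrite nE.
  by have := ler0n R t; have := ler0n R d; lra.
have tl : rho ^+ 2 * h <= tau.
  apply: le_of_sqr; first exact: ltW.
  rewrite tauE; apply: le_trans vl; rewrite exprMn ler_wpM2r ?sqr_ge0 //.
  have -> : (rho ^+ 2) ^+ 2 = rho ^+ 3 * rho by ring.
  by rewrite ler_piMr // ltW.
have tu : tau * rho <= h.
  by apply: le_of_sqr; [exact: ltW | rewrite exprMn tauE -ler_pdivlMr].
pose P (y : 'I_(s + t + d).+1) := `|y%:R - w0| <= T * tau.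
have TtK2 : T * tau <= K2 * h.
  by rewrite -K2E -mulrA ler_wpM2l ?(ltW K20) // mulrC.
have step y : `|y%:R - w0| <= T * tau -> [/\ (y < s)%N, (y < d)%N &
    `|ln (cgw R s t d y.+1) - ln (cgw R s t d y) + (y%:R - w0) / v + (2 * v)^-1| <= C / h ^+ 2].
  move=> yT; rewrite CE; apply: cgw_log_step => //; exact: le_trans TtK2.
(* Up to a constant, the logarithm of the weight over the Gaussian. The term (2v)^-1 makes its
   increments exact: ((X + 1)^2 - X^2)/(2v) = X/v + 1/(2v). At most 2 K2 h increments of size C /
   h^2 add up to e1. *)
pose L (y : nat) := ln (cgw R s t d y) + (y%:R - w0) ^+ 2 / (2 * v).
have Lstep y : `|y%:R - w0| <= T * tau -> `|L y.+1 - L y| <= C / h ^+ 2.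
  move=> /step[_ _]; congr (`| _ | <= _).
  by rewrite /L -natr1; field; rewrite gt_eqF.
have Ldist y z : (y <= z)%N -> `|y%:R - w0| <= T * tau -> `|z%:R - w0| <= T * tau ->
    `|L z - L y| <= e1.
  move=> yz yT zT; apply: le_trans (increments_bound (c := C / h ^+ 2) yz _) _.
    move=> i /andP[yi iz]; apply: Lstep; move: yT zT; rewrite !ler_norml.
    have : y%:R <= i%:R :> R by rewrite ler_nat.
    have : i%:R <= z%:R :> R by rewrite ler_nat ltnW.
    by clear; lra.
  have yzR : (z - y)%:R <= 2 * K2 * h.
    by rewrite natrB //; move: yT zT; rewrite !ler_norml; clear -TtK2; lra.
  apply: (@le_trans _ _ (2 * K2 * h * (C / h ^+ 2))); first by rewrite ler_wpM2r // divr_ge0 ?ltW.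
  have -> : 2 * K2 * h * (C / h ^+ 2) = 2 * K2 * C / h by field; rewrite gt_eqF.
  by rewrite ler_pdivrMr.
have xT : `|x| <= T * tau.
  apply: le_trans xK _; apply: (@le_trans _ _ (T * rho ^+ 2 * h)); first by rewrite ler_wpM2r // ltW.
  by rewrite -mulrA ler_wpM2l //; lra.
have [ws wd _] := step w xT.
have wX : (w < (s + t + d).+1)%N by clear -ws; lia.
have main := @ratio_window _ P (fun y : 'I_(s + t + d).+1 => cgw R s t d y)
  (fun y => gauss_at v (y%:R - w0)) e1 (Ordinal wX) e10 e18 xT.
apply: le_trans (_ : 8 * e1 * gauss_at v x <= _); last first.
  by rewrite ler_wpM2r // ltW // gauss_at_gt0.
apply: main.
- by move=> y _; apply: gauss_at_gt0.
- by move=> y _; apply: cgw_ge0.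
- move=> j k jT kT; have Lle : L j - L k <= e1.
    have [jk|/ltnW kj] := leqP j k.
      by have := Ldist _ _ jk jT kT; rewrite ler_norml; clear; lra.
    by have := Ldist _ _ kj kT jT; rewrite ler_norml; clear; lra.
  have [js jd _] := step j jT; have [ks kd _] := step k kT.
  have Gj : 0 < cgw R s t d j by apply: cgw_gt0; exact: ltnW.
  have Gk : 0 < cgw R s t d k by apply: cgw_gt0; exact: ltnW.
  have gj := gauss_at_gt0 (j%:R - w0) v0; have gk := gauss_at_gt0 (k%:R - w0) v0.
  have GE (i : nat) : 0 < cgw R s t d i -> cgw R s t d i * expR ((i%:R - w0) ^+ 2 / (2 * v)) = expR (L i).
    by move=> Gi; rewrite /L expRD lnK // posrE.
  have eE := gauss_at_exp (j%:R - w0) (k%:R - w0) v0.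
  have e2 : expR (L j) <= (1 + 2 * e1) * expR (L k).
    rewrite -[L j](subrK (L k)) expRD ler_wpM2r ?expR_ge0 //.
    apply: (@le_trans _ _ (expR e1)); first by rewrite ler_expR.
    by apply: expR_le_lin; clear -e10 e18; lra.
  move: e2; rewrite -!GE //.
  set Ej := expR (_ / _) in eE *; set Ek := expR (_ / _) in eE * => e2.
  have Ej0 : 0 < Ej by exact: expR_gt0.
  have Ek0 : 0 < Ek by exact: expR_gt0.
  rewrite -(@ler_pM2r _ Ek) //.
  have -> : cgw R s t d j * gauss_at v (k%:R - w0) * Ek =
    gauss_at v (j%:R - w0) * (cgw R s t d j * Ej) by rewrite -mulrA -eE; ring.
  have -> : (1 + 2 * e1) * (cgw R s t d k * gauss_at v (j%:R - w0)) * Ek =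
    gauss_at v (j%:R - w0) * ((1 + 2 * e1) * (cgw R s t d k * Ek)) by ring.
  by rewrite ler_pM2l.
- have tot : \sum_(j < (s + t + d).+1) cgw R s t d j = 1.
    by apply: sum_cgw; clear; rewrite geq_min; lia.
  rewrite (bigID P) /= in tot.
  have far0 : 0 <= \sum_(j < (s + t + d).+1 | ~~ P j) cgw R s t d j.
    by apply: sumr_ge0 => j _; apply: cgw_ge0.
  have far : \sum_(j < (s + t + d).+1 | ~~ P j) cgw R s t d j <= e1.
    apply: (@le_trans _ _ (\sum_(j < (s + t + d).+1 | T * tau <= `|j%:R - w0|) cgw R s t d j)).
      rewrite [leLHS]big_mkcond [leRHS]big_mkcond; apply: ler_sum => j _; rewrite /P -ltNge.
      by case: ltP => [/ltW ->//|_]; case: ifP => // _; apply: cgw_ge0.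
    apply: le_trans (cgw_chebyshev bal _ _) _.
    - rewrite mulrA; apply: le_trans h3 _.
      have : rho * (1 * (rho ^+ 2 * h)) <= rho * (T * tau).
        by rewrite ler_wpM2l ?(ltW r0) //; apply: ler_pM => //; rewrite mulr_ge0 ?ltW.
      by clear; lra.
    - by rewrite ltnS; clear; rewrite geq_min; lia.
    have Tt0 : 0 < T * tau by rewrite mulr_gt0 //; clear -T1; lra.
    rewrite hn ler_pdivrMr; last by rewrite mulr_gt0 ?exprn_gt0.
    have : 32 * h ^+ 2 <= (T * (rho ^+ 5 * e1)) * h ^+ 2 by rewrite ler_wpM2r ?sqr_ge0.
    move=> q; apply: le_trans q _.
    have q2 : rho ^+ 3 * h ^+ 2 * (T * (T * (e1 * rho ^+ 2))) <= v * (T * (T * (e1 * rho ^+ 2))).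
      by rewrite ler_wpM2r // !mulr_ge0 ?sqr_ge0 ?(ltW e10) ?(ltW r0).
    have q3 : 1 * (T * (e1 * rho ^+ 2) * (rho ^+ 3 * h ^+ 2)) <= T * (T * (e1 * rho ^+ 2) * (rho ^+ 3 * h ^+ 2)).
      by rewrite ler_wpM2r // !mulr_ge0 ?sqr_ge0 ?exprn_ge0 ?(ltW e10) ?(ltW r0) ?(ltW h0).
    by rewrite -tauE in q2 *; move: q2 q3; clear; lra.
  by clear -far0 far tot; lra.
have TT : - T <= T by clear -T1; lra.
have lo0 : 0 <= w0 + - T * tau.
  by clear -cl TtK2 hK2 h0 K20 h1; have := ler_wpM2r (ltW h0) hK2; nra.
have hi0 : w0 + T * tau <= ((s + t + d).+1)%:R.
  rewrite -natr1 hn; clear -cs TtK2 hK2 h0 K20 h1 nE; have := ler_wpM2r (ltW h0) hK2.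
  by have := ler0n R t; have := ler0n R d; nra.
have rs2 := riemann_phi tau0 TT lo0 hi0.
have m := mass (- T) T; rewrite lerN2 in m; have /andP[ma mb] := m TK1 TK1.
have sE : \sum_(j < (s + t + d).+1 | P j) gauss_at v (j%:R - w0) =
  \sum_(y < (s + t + d).+1 | (- T <= (y%:R - w0) / tau) && ((y%:R - w0) / tau <= T))
     phi ((y%:R - w0) / tau) / tau.
  apply: eq_bigl => y; rewrite /P ler_norml ler_pdivlMr // ler_pdivrMr //.
  by rewrite mulNr.
rewrite sE; move: rs2; rewrite ler_norml.
have : (T - - T + 3) / tau <= e1.
  rewrite ler_pdivrMr //; apply: (@le_trans _ _ (e1 * (rho ^+ 2 * h))); first by clear -hT; lra.
  by rewrite ler_wpM2l // ltW.
by clear -ma mb; lra.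
Qed.

End LocalLimit.

(** * Monotonicity and a uniform bound for one coupling weight *)

Section Sup.
Variable R : realType.

Lemma sqrt_spread (rho s t d h : R) : balanced rho s t d -> s + t + d = h ^+ 2 -> 0 < h ->
  rho <= 1 /\ rho ^+ 2 * h <= Num.sqrt (spread s t d).
Proof.
move=> bal nE h0; have [vl _] := spread_bounds bal; have [r0 n0 rs rt rd] := bal.
have rn0 : 0 < rho * (s + t + d) by rewrite mulr_gt0.
have r1 : rho <= 1.
  rewrite -(ler_pM2r n0) mul1r; apply: (le_trans rs).
  by move: (lt_le_trans rn0 rt) (lt_le_trans rn0 rd); clear; lra.
split=> //; apply: le_of_sqr; first exact: sqrtr_ge0.
have vp : 0 <= spread s t d by apply: le_trans vl; rewrite mulr_ge0 ?exprn_ge0 // ltW.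
rewrite sqr_sqrtr //; apply: le_trans vl; rewrite nE exprMn ler_wpM2r ?sqr_ge0 //.
have -> : (rho ^+ 2) ^+ 2 = rho ^+ 3 * rho by ring.
by rewrite ler_piMr // exprn_ge0 // ltW.
Qed.

(** Numerator minus denominator of the ratio without unit shifts; its sign is that of w0 - w on the
    relevant range. *)
Lemma center_cubic (s t d w w0 : R) : let n := s + t + d in w0 * (n - w0) = s * d ->
  (n - w) * ((d - w) * (s - w)) - w * ((t + d - w) * (s + t - w)) =
  (n - 2 * w) * ((w0 - w) * (n - w0 - w)).
Proof.
move=> n prod; apply/eqP; rewrite -subr_eq0; apply/eqP.
transitivity ((n - 2 * w) * (s * d - w0 * (n - w0))); first by rewrite /n; ring.
by rewrite prod subrr mulr0.
Qed.

Lemma cgw_decreasing (rho : R) (s t d w : nat) : balanced rho s%:R t%:R d%:R ->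
  center s%:R t%:R d%:R <= w%:R :> R -> cgw R s t d w.+1 <= cgw R s t d w.
Proof.
move=> bal ww; have [/andP[ws wd]|H] := boolP ((w < s) && (w < d))%N; last first.
  by rewrite [cgw _ _ _ _ w.+1]cgw0 ?cgw_ge0.
have := cgw_ratio R s t d w; rewrite /= natrD natrD.
have [r0 n0 rs rt rd] := bal; have := center_facts bal.
set n := s%:R + t%:R + d%:R in n0 rs rt rd *; set w0 := center _ _ _ in ww *.
move=> [_ prod u1 u5 _].
have cub := center_cubic w%:R prod.
have w1 : w%:R + 1 <= s%:R :> R by rewrite natr1 ler_nat.
have w2 : w%:R + 1 <= d%:R :> R by rewrite natr1 ler_nat.
have t0 : 0 <= t%:R :> R by exact: ler0n.
have w00 : 0 <= w%:R :> R by exact: ler0n.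
rewrite -/n in cub; set ds := (d%:R - w%:R) * (s%:R - w%:R) in cub.
set ts := (t%:R + d%:R - w%:R) * (s%:R + t%:R - w%:R) in cub.
have ds0 : 0 <= ds by rewrite mulr_ge0 // subr_ge0; clear -w1 w2; lra.
have dts : ds <= ts by apply: ler_pM; rewrite ?subr_ge0; clear -w1 w2 t0; lra.
have ts0 : 0 < ts by apply: mulr_gt0; clear -w1 w2 t0; lra.
have n2w : 1 <= n - 2 * w%:R by rewrite /n; clear -w1 w2 t0; lra.
have neg : (n - 2 * w%:R) * ((w0 - w%:R) * (n - w0 - w%:R)) <= 0.
  apply: mulr_ge0_le0; first by clear -n2w; lra.
  apply: mulr_le0_ge0; first by rewrite subr_le0.
  have : 0 < rho * n by rewrite mulr_gt0.
  by clear -u1 n2w; lra.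
set a := (X in _ * X = _); set b := (X in _ = _ * X) => ratio.
have aE : a = (n - 2 * w%:R + 1) * ((w%:R + 1) * ts) by rewrite /a /ts; ring.
have bE : b = (n - 2 * w%:R - 1) * ((n - w%:R + 1) * ds) by rewrite /b /ds; ring.
clearbody a b ds ts.
have a0 : 0 < a by rewrite aE !mulr_gt0 //; clear -n2w w00; lra.
have ba : b <= a.
  rewrite aE bE; apply: ler_pM; [by clear -n2w; lra| |by clear; lra|].
    by rewrite mulr_ge0 //; clear -n2w w00; lra.
  by rewrite -cub in neg; clear -neg dts; lra.
by rewrite -(ler_pM2r a0) ratio ler_wpM2l ?cgw_ge0.
Qed.

(** The unit shifts in [cgw_ratio] work against growth, so it is claimed only at distance h below
    the centre, where the gain rho^3 h n^3 >= 5 n^3 outweighs them. *)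
Lemma cgw_increasing (rho h : R) (s t d w : nat) : balanced rho s%:R t%:R d%:R ->
  (s + t + d)%:R = h ^+ 2 -> 1 <= h -> 5 <= rho ^+ 3 * h ->
  w%:R <= center s%:R t%:R d%:R - h :> R -> cgw R s t d w <= cgw R s t d w.+1.
Proof.
move=> bal; rewrite natrD natrD => nh h1 h5 ww.
have := cgw_ratio R s t d w; rewrite /= natrD natrD.
have [r0 n0 rs rt rd] := bal; have := center_facts bal.
set n := s%:R + t%:R + d%:R in n0 rs rt rd nh *; set w0 := center _ _ _ in ww *.
move=> [_ prod u1 u5 [u4 u3]].
have cub := center_cubic w%:R prod.
have c0 : 0 < rho ^+ 2 * n by rewrite mulr_gt0 ?exprn_gt0.
have rn0 : 0 < rho * n by rewrite mulr_gt0.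
have t0 : 0 < t%:R :> R by clear -rt rn0; lra.
have w00 : 0 <= w%:R :> R by exact: ler0n.
have w1 : 0 < s%:R - w%:R :> R by clear -u4 c0 ww h1; lra.
have w2 : 0 < d%:R - w%:R :> R by clear -u3 c0 ww h1; lra.
rewrite -/n in cub; set ds := (d%:R - w%:R) * (s%:R - w%:R) in cub.
set ts := (t%:R + d%:R - w%:R) * (s%:R + t%:R - w%:R) in cub.
have ds0 : 0 <= ds by rewrite mulr_ge0 ?ltW.
have dts : ds <= ts by apply: ler_pM; clear -w1 w2 t0; lra.
have ts0 : 0 < ts by apply: mulr_gt0; clear -w1 w2 t0; lra.
have tsn : ts <= n * n by rewrite /n; apply: ler_pM; clear -w1 w2 t0 w00; lra.
have g1 : rho * n <= n - 2 * w%:R by clear -u1 ww h1; lra.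
have g2 : rho * n <= n - w0 - w%:R by clear -u1 ww h1; lra.
have g3 : h <= w0 - w%:R by clear -ww; lra.
set a := (X in _ * X = _); set b := (X in _ = _ * X) => ratio.
have aE : a = (n - 2 * w%:R + 1) * ((w%:R + 1) * ts) by rewrite /a /ts; ring.
have bE : b = (n - 2 * w%:R - 1) * ((n - w%:R + 1) * ds) by rewrite /b /ds; ring.
clearbody a b ds ts w0 n.
have n1 : 1 <= n by rewrite nh -(expr1n _ 2) ler_sqr ?nnegrE //; clear -h1; lra.
have gain : (rho * n) * ((rho * n) * (h * (rho * n))) <=
    (n - 2 * w%:R) * ((n - 2 * w%:R) * ((w0 - w%:R) * (n - w0 - w%:R))).
  have hr : 0 <= h * (rho * n) by rewrite mulr_ge0 ?(ltW rn0) //; clear -h1; lra.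
  apply: ler_pM => //; [exact: ltW | by rewrite mulr_ge0 ?(ltW rn0) |].
  apply: ler_pM => //; [exact: ltW |].
  by apply: ler_pM => //; [clear -h1; lra | exact: ltW].
have gain5 : 5 * (n * n * n) <= (rho * n) * ((rho * n) * (h * (rho * n))).
  have -> : (rho * n) * ((rho * n) * (h * (rho * n))) = rho ^+ 3 * h * (n * n * n) by ring.
  by rewrite ler_wpM2r // !mulr_ge0 // ltW.
have wn : w%:R <= n by clear -g1 rn0 w00; lra.
have dn : n - 2 * w%:R <= n by clear -w00; lra.
have dsn : ds <= n * n by clear -dts tsn; lra.
have nn : n * n <= n * n * n by rewrite ler_peMr // mulr_ge0 // ltW.
have l1 : (n - 2 * w%:R) * (ts - ds) <= n * (n * n).
  by apply: ler_pM => //; clear -g1 rn0 dts tsn ds0; lra.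
have l2 : (n - w%:R) * ds <= n * (n * n) by apply: ler_pM => //; clear -wn w00; lra.
have l3 : w%:R * ts <= n * (n * n) by apply: ler_pM => //; exact: ltW.
have ab : a <= b by rewrite -cub in gain; rewrite aE bE; clear -gain gain5 l1 l2 l3 nn dsn tsn; lra.
have a0 : 0 < a.
  rewrite aE mulr_gt0 //; first by clear -g1 rn0; lra.
  by rewrite mulr_gt0 //; clear -w00; lra.
have : cgw R s t d w * a <= cgw R s t d w.+1 * a by rewrite ratio ler_wpM2l ?cgw_ge0.
by rewrite ler_pM2r.
Qed.

(** Within 2h of the centre the local limit theorem with relative error 1 gives the factor 2;
    monotonicity carries the bound outward. The width 2h covers the strip of width h without known
    growth and one step of rounding. *)
Lemma cgw_sup (rho : R) : 0 < rho -> exists N0 : nat,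
  forall s t d : nat, (N0 <= s + t + d)%N -> balanced rho s%:R t%:R d%:R ->
  forall w, cgw R s t d w <= 2 / rho ^+ 2 / Num.sqrt (s + t + d)%:R.
Proof.
move=> r0; have [N1 llt] := @cgw_llt R rho 2 1 r0 ltac:(by []) ltac:(by []).
have [N2 big] := sqrt_large (1 + 5 / rho ^+ 3).
exists (maxn N1 N2) => s t d; rewrite geq_max => /andP[n1 n2] bal w.
have := big _ n2; set h := Num.sqrt (s + t + d)%:R => hbig.
have h5 : 5 <= rho ^+ 3 * h.
  have p3 : 0 < rho ^+ 3 by rewrite exprn_gt0.
  by rewrite [leRHS]mulrC -ler_pdivrMr //; clear -hbig; lra.
have p5 : 0 < 5 / rho ^+ 3 by rewrite divr_gt0 ?exprn_gt0.
have h1 : 1 <= h by clear -hbig p5; lra.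
have hn : (s + t + d)%:R = h ^+ 2 by rewrite sqr_sqrtr ?ler0n.
have h0 : 0 < h by clear -h1; lra.
have [r1 tl] : rho <= 1 /\ rho ^+ 2 * h <= Num.sqrt (spread s%:R t%:R d%:R).
  by apply: sqrt_spread => //; rewrite -hn !natrD.
have rh0 : 0 < rho ^+ 2 * h by rewrite mulr_gt0 ?exprn_gt0.
set w0 := center s%:R t%:R d%:R : R.
have w0p : 0 <= w0.
  have [_ n0 _ _ _] := bal; have [_ _ _ c0 _] := center_facts bal; apply: le_trans c0.
  by rewrite mulr_ge0 ?exprn_ge0 // ltW.
have win y : `|y%:R - w0| <= 2 * h -> cgw R s t d y <= 2 / rho ^+ 2 / h.
  move=> yw; have := llt s t d n1 bal y yw; rewrite mul1r ler_norml -/w0.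
  have : gauss_at (spread s%:R t%:R d%:R) (y%:R - w0) <= 1 / (rho ^+ 2 * h).
    apply: ler_pM; rewrite ?invr_ge0 ?sqrtr_ge0 ?phi_le1 ?(ltW (phi_gt0 _)) //.
    by rewrite lef_pV2 ?posrE // (lt_le_trans rh0).
  have -> : 2 / rho ^+ 2 / h = 2 * (1 / (rho ^+ 2 * h)) by field; rewrite !gt_eqF.
  by clear; lra.
clear hbig; have [ww|ww] := leP w0 w%:R.
  elim: w ww => [|w IH] ww.
    by apply: win; rewrite ler_norml; move: w0p ww h1; clear; lra.
  have [ww'|ww'] := leP w0 w%:R.
    exact: le_trans (cgw_decreasing bal ww') (IH ww').
  by apply: win; rewrite ler_norml; move: ww ww' h1; rewrite -natr1; clear; lra.
have [k] : exists k : nat, w0 - h <= (w + k)%:R.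
  exists (Num.bound `|w0|); have := archi_boundP (normr_ge0 w0).
  by have := ler_norm w0; have := ler0n R w; rewrite natrD; clear -h0; lra.
elim: k w ww => [|k IH] w ww wk.
  by apply: win; rewrite ler_norml; move: ww wk h1; rewrite addn0; clear; lra.
have [wh|wh] := leP w%:R (w0 - h); last first.
  by apply: win; rewrite ler_norml; move: ww wh h1; clear; lra.
apply: le_trans (cgw_increasing bal hn h1 h5 wh) _.
have [ww'|ww'] := ltP w.+1%:R w0; first by apply: IH; rewrite // addSnnS.
by apply: win; rewrite ler_norml; move: ww ww' h1; rewrite -natr1; clear; lra.
Qed.

End Sup.

(** * Products, perturbation and scaling of Gaussian densities *)

Section GaussTools.
Variable R : realType.

Lemma gauss_atE (v x : R) : 0 < v ->
  gauss_at v x = (Num.sqrt (2 * pi))^-1 / Num.sqrt v * expR (- (x ^+ 2 / (2 * v))).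
Proof.
move=> v0; rewrite /gauss_at /phi expr_div_n sqr_sqrtr ?(ltW v0) //.
have -> : - (x ^+ 2 / v) / 2 = - (x ^+ 2 / (2 * v)) by field; rewrite gt_eqF.
by ring.
Qed.

(** Completing the square: V is the variance of r Y plus independent noise of variance v, and u v /
    V is the conditional variance of Y given Z. *)
Lemma gauss_product (u v r Y Z : R) : 0 < u -> 0 < v ->
  let V := v + r ^+ 2 * u in
  gauss_at u Y * gauss_at v (Z - r * Y) =
  gauss_at V Z * gauss_at (u * v / V) (Y - r * u / V * Z).
Proof.
move=> u0 v0 V; have V0 : 0 < V by rewrite /V ltr_pwDl // mulr_ge0 ?sqr_ge0 // ltW.
have w0 : 0 < u * v / V by rewrite divr_gt0 ?mulr_gt0.
rewrite !gauss_atE // mulrACA [RHS]mulrACA -!expRD; congr (_ * expR _); last first.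
  by rewrite /V; field; rewrite -/V !gt_eqF.
have -> : Num.sqrt (u * v / V) = Num.sqrt u * Num.sqrt v / Num.sqrt V.
  by rewrite sqrtrM ?mulr_ge0 ?ltW // sqrtrM ?ltW // sqrtrV // ltW.
by field; rewrite !gt_eqF ?sqrtr_gt0 // mulr_gt0 // pi_gt0.
Qed.

Lemma ln_diff_le (u v : R) : 0 < u -> 0 < v -> ln u - ln v <= (u - v) / v.
Proof.
move=> u0 v0; rewrite -ln_div ?posrE //.
have := @le_ln1Dx R (u / v - 1); rewrite addrCA subrr addr0 => h.
rewrite mulrBl divff ?gt_eqF //; apply: h.
by rewrite ltrBrDr addNr divr_gt0.
Qed.

(* Perturbation of centre and variance: the relative change is O(D/h). *)
Lemma gauss_near (kappa c D h e u v x y : R) : 0 < c -> 0 < h -> 0 <= kappa -> 0 <= D ->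
  0 < e -> e <= 1 ->
  c * h ^+ 2 <= u -> c * h ^+ 2 <= v -> `|x| <= kappa * h -> `|y| <= kappa * h ->
  `|x - y| <= D -> `|u - v| <= D * h ->
  (2 * (D / c) + 4 * (D * kappa / c) + 2 * (kappa ^+ 2 * D / c ^+ 2)) <= e * h ->
  `|gauss_at u x - gauss_at v y| <= e * gauss_at v y.
Proof.
move=> c0 h0 k0 D0 e0 e1 cu cv xk yk xy uv big.
have ch : 0 < c * h ^+ 2 by rewrite mulr_gt0 ?exprn_gt0.
have u0 : 0 < u by apply: lt_le_trans cu.
have v0 : 0 < v by apply: lt_le_trans cv.
have lnb (p q : R) : c * h ^+ 2 <= p -> 0 < q -> c * h ^+ 2 <= q -> `|q - p| <= D * h -> ln q - ln p <= D / c / h.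
  move=> cp q0 cq qp; have p0 : 0 < p by apply: lt_le_trans cp.
  apply: le_trans (ln_diff_le q0 p0) _.
  apply: (@le_trans _ _ (D * h / (c * h ^+ 2))).
    apply: (@le_trans _ _ (`|q - p| / p)); first by rewrite ler_wpM2r ?invr_ge0 ?(ltW p0) ?ler_norm.
    by apply: ler_pM; rewrite ?invr_ge0 ?normr_ge0 ?(ltW p0) // lef_pV2 ?posrE.
  by rewrite le_eqVlt; apply/orP; left; apply/eqP; field; rewrite !gt_eqF.
have l1 := lnb _ _ cv u0 cu uv.
have l2 : ln v - ln u <= D / c / h by apply: lnb => //; rewrite distrC.
have q : `|x ^+ 2 / u - y ^+ 2 / v| <= (2 * (D * kappa / c) + kappa ^+ 2 * D / c ^+ 2) / h.
  have -> : x ^+ 2 / u - y ^+ 2 / v = (x - y) * (x + y) / u + y ^+ 2 * (v - u) / (u * v).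
    by field; rewrite !gt_eqF.
  apply: le_trans (ler_normD _ _) _.
  have -> : (2 * (D * kappa / c) + kappa ^+ 2 * D / c ^+ 2) / h =
     D * (2 * kappa * h) / (c * h ^+ 2) + (kappa * h) ^+ 2 * (D * h) / (c * h ^+ 2 * (c * h ^+ 2)).
    by field; rewrite !gt_eqF.
  apply: lerD.
    rewrite normrM normrM normfV (gtr0_norm u0).
    apply: ler_pM; rewrite ?invr_ge0 ?mulr_ge0 ?normr_ge0 ?(ltW u0) //; last by rewrite lef_pV2 ?posrE.
    apply: ler_pM; rewrite ?normr_ge0 //; apply: le_trans (ler_normD _ _) _; clear -xk yk; lra.
  rewrite normrM normrM normfV (gtr0_norm (mulr_gt0 u0 v0)).
  apply: ler_pM; rewrite ?invr_ge0 ?mulr_ge0 ?normr_ge0 ?(ltW u0) ?(ltW v0) //; last first.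
    by rewrite lef_pV2 ?posrE ?mulr_gt0 //; apply: ler_pM => //; exact: ltW.
  apply: ler_pM; rewrite ?normr_ge0 //; last by rewrite distrC.
  by rewrite normrX ler_sqr ?nnegrE ?normr_ge0 // mulr_ge0 // ltW.
pose A := ln (gauss_at u x) - ln (gauss_at v y).
have gE (w z : R) : 0 < w -> ln (gauss_at w z) = ln (Num.sqrt (2 * pi))^-1 - ln w / 2 - z ^+ 2 / (2 * w).
  move=> w0; have s0 : 0 < Num.sqrt w by rewrite sqrtr_gt0.
  have p1 : 0 < (Num.sqrt (2 * pi))^-1 / Num.sqrt w by rewrite divr_gt0 // peak_gt0.
  rewrite gauss_atE // (lnM p1) ?posrE ?expR_gt0 // expRK ln_div ?posrE ?peak_gt0 //.
  have -> : ln w = 2 * ln (Num.sqrt w); last by field; rewrite gt_eqF.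
  by rewrite -{1}[w]sqr_sqrtr ?(ltW w0) // lnXn // mulr_natl.
have hinv : 0 < h^-1 by rewrite invr_gt0.
have Ab : `|A| <= e / 2.
  have : (2 * (D / c) + 4 * (D * kappa / c) + 2 * (kappa ^+ 2 * D / c ^+ 2)) / h <= e by rewrite ler_pdivrMr.
  have AE : A = - (ln u - ln v) / 2 - (x ^+ 2 / u - y ^+ 2 / v) / 2.
    by rewrite /A !gE //; field; rewrite !gt_eqF.
  rewrite AE; move: q l1 l2; rewrite !ler_norml; clear; lra.
have gx := gauss_at_gt0 x u0; have gy := gauss_at_gt0 y v0.
have rE : gauss_at u x = expR A * gauss_at v y.
  by rewrite /A expRB !lnK ?posrE // divfK // gt_eqF.
have eA : `|expR A - 1| <= e.
  move: Ab; rewrite !ler_norml => /andP[A1 A2]; apply/andP; split.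
    by have := expR_ge1Dx A; clear -A1 e0; lra.
  have : expR A <= expR (e / 2) by rewrite ler_expR.
  have : expR (e / 2) <= 1 + 2 * (e / 2) by apply: expR_le_lin; clear -e0 e1; lra.
  by clear; lra.
have -> : gauss_at u x - gauss_at v y = (expR A - 1) * gauss_at v y by rewrite rE; ring.
by rewrite normrM (gtr0_norm gy) ler_wpM2r // ltW.
Qed.

Lemma cgw_le1 s t d w : cgw R s t d w <= 1.
Proof.
rewrite -(sum_cgw R t (s := s) (d := d) (n := maxn s w)); last by rewrite geq_min !leq_max leqnn.
have wm : (w < (maxn s w).+1)%N by rewrite ltnS leq_max leqnn orbT.
rewrite (bigD1 (Ordinal wm)) //= lerDl; apply: sumr_ge0 => j _; exact: cgw_ge0.
Qed.

Lemma center_scale (k s t d : R) : 0 < k -> center (s * k) (t * k) (d * k) = center s t d * k.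
Proof.
move=> k0; rewrite /center -!mulrDl.
have -> : ((s + t + d) * k) ^+ 2 - 4 * (s * k * (d * k)) =
   k ^+ 2 * ((s + t + d) ^+ 2 - 4 * (s * d)) by ring.
by rewrite sqrtrM ?sqr_ge0 // sqrtr_sqr (gtr0_norm k0); ring.
Qed.

Lemma spread_scale (k s t d : R) : 0 < k -> spread (s * k) (t * k) (d * k) = spread s t d * k.
Proof.
move=> k0; rewrite /spread -!mulrDl.
have -> : ((s + t + d) * k) ^+ 2 - 4 * (s * k * (d * k)) =
   ((s + t + d) ^+ 2 - 4 * (s * d)) * k ^+ 2 by ring.
set E := (_ - _); have [->|E0] := eqVneq E 0; first by rewrite mul0r !invr0 !mulr0 mul0r.
by field; rewrite E0 gt_eqF.
Qed.

End GaussTools.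

(** * Local limit theorem for two couplings *)

Lemma Dcst_gt0 (R : realType) (a b c d : R) :
  0 < b -> 0 < d -> a + b + c + d = 1 :> R -> 0 < Dcst a b c d.
Proof.
move=> b0 d0 sum1.
have -> : Dcst a b c d = (a + b - c - d) ^+ 2 + 4 * (b * d).
  by rewrite /Dcst (_ : a = 1 - b - c - d); [ring | rewrite -sum1; ring].
by rewrite ltr_wpDl ?sqr_ge0 // !mulr_gt0.
Qed.

Section Mixture.
Variables (R : realType) (a b c d : R).
Hypotheses (a0 : 0 < a) (b0 : 0 < b) (c0 : 0 < c) (d0 : 0 < d) (sum1 : a + b + c + d = 1 :> R).

Ltac slra := move: a0 b0 c0 d0 sum1; intros; lra.

(** Per unit of n: [yA], [sA] and [dA] are the centre, spread and gap of the first coupling, [kap] =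
    1 - 2 mu is the gap after both, [sB] is the spread of the second coupling at y = yA n, and [r]
    is the slope in y of y plus the second centre. *)
Let D := Dcst a b c d.
Let kap := Num.sqrt D.
Let yA := center b d c.
Let dA := (b + d + c) - 2 * yA.
Let sA := spread b d c.
Let sB := b * d * a / kap ^+ 2.
Let r := dA / kap.
Let rho0 := Num.min b (Num.min c d).
Let m0 := rho0 ^+ 2 * (b + d + c).
Let rho1 := Num.min a (m0 / 2).

Lemma sum_le : b + d + c <= 1 - a. Proof. by rewrite -sum1; slra. Qed.
Lemma kap_gt0 : 0 < kap. Proof. by rewrite sqrtr_gt0; apply: Dcst_gt0. Qed.
Lemma kap_sqr : kap ^+ 2 = D. Proof. by rewrite sqr_sqrtr //; apply/ltW/Dcst_gt0. Qed.
Lemma kap_le1 : kap <= 1.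
Proof.
apply: le_of_sqr => //; rewrite kap_sqr expr1n /D /Dcst.
have := mulr_gt0 a0 c0; have := mulr_gt0 a0 d0; have := mulr_gt0 b0 c0; slra.
Qed.

Lemma balanced_first : balanced rho0 b d c.
Proof.
have r0 : 0 < rho0 by rewrite !lt_min b0 c0 d0.
have s1 : b + d + c <= 1 by have := sum_le; slra.
have le x : rho0 <= x -> rho0 * (b + d + c) <= x.
  by apply: le_trans; rewrite ler_piMr // ltW.
split=> //; first by slra.
- by apply: le; rewrite ge_min lexx.
- by apply: le; rewrite !ge_min lexx !orbT.
by apply: le; rewrite !ge_min lexx !orbT.
Qed.

Lemma first_facts : [/\ dA ^+ 2 = (b + d + c) ^+ 2 - 4 * (b * c), 0 < dA, dA <= 1, 0 < m0 &
  [/\ yA * (b + d + c - yA) = b * c, m0 <= yA, m0 <= b - yA & m0 <= c - yA]].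
Proof.
have bal := balanced_first; have [r0 n0 _ _ _] := bal.
have [eD prod u1 cl [cs cd]] := center_facts bal.
have m00 : 0 < m0 by rewrite mulr_gt0 ?exprn_gt0.
have u0 : 0 < rho0 * (b + d + c) by rewrite mulr_gt0.
split=> //; first exact: lt_le_trans u1.
rewrite /dA; move: cl; rewrite -/m0 -/yA; have := sum_le; slra.
Qed.

Lemma sA_E : sA = b * d * c / dA ^+ 2.
Proof. by have [eD _ _ _ _] := first_facts; rewrite /sA /spread eD. Qed.

(** The factor dA^2 cancels, so the convolution has variance sigma^2. *)
Lemma total_spread : sB + r ^+ 2 * sA = (a + c) * b * d / D.
Proof.
have [_ d1 _ _ _] := first_facts; have k0 := kap_gt0.
by rewrite sA_E /sB /r -kap_sqr; field; rewrite !gt_eqF.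
Qed.

Lemma rho1_gt0 : 0 < rho1.
Proof. by have [_ _ _ m _] := first_facts; rewrite lt_min a0 divr_gt0. Qed.

Section Perturbed.
Variables (n y : R).
Hypotheses (n0 : 0 < n) (yn : `|y - yA * n| <= m0 / 2 * n).
Ltac plra := move: n0; intros; slra.
Let Y := y - yA * n.
Let s := (c + d) * n - y.
Let t := b * n - y.
Let e := a * n.
Let dB := (n - 2 * y) - 2 * center s t e.

Lemma sum_second : s + t + e = n - 2 * y.
Proof.
rewrite /s /t /e; have -> : d = 1 - a - b - c by rewrite -sum1; ring.
ring. Qed.

(** [m0] bounds b - yA and c - yA from below, and a deviation of y by m0 n / 2 leaves half of
    each. *)
Lemma balanced_second : balanced rho1 s t e.
Proof.
have [_ _ _ m [_ _ mb mc]] := first_facts.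
have r1 := rho1_gt0; have ra : rho1 <= a by rewrite ge_min lexx.
have rm : rho1 <= m0 / 2 by rewrite ge_min lexx orbT.
have rn (z : R) : rho1 <= z -> rho1 * n <= z * n by rewrite ler_pM2r.
move: yn; rewrite ler_norml => /andP[y1 y2].
have mn : 0 < m0 * n by rewrite mulr_gt0.
have mbn : m0 * n <= (b - yA) * n by rewrite ler_pM2r.
have mcn : m0 * n <= (c - yA) * n by rewrite ler_pM2r.
have dn : 0 < d * n by rewrite mulr_gt0.
have an : 0 < a * n by rewrite mulr_gt0.
have sm : m0 / 2 * n <= s by rewrite /s; plra.
have tm : m0 / 2 * n <= t by rewrite /t; plra.
have tot : s + t + e <= n.
  rewrite sum_second; have : m0 * n <= yA * n by rewrite ler_pM2r //; have [_ _ _ _ []] := first_facts.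
  by plra.
have le z : rho1 * n <= z -> rho1 * (s + t + e) <= z.
  by apply: le_trans; rewrite ler_wpM2l // ltW.
split=> //.
- by rewrite /e; plra.
- by apply: le; apply: le_trans sm; apply: rn.
- by apply: le; apply: le_trans tm; apply: rn.
by apply: le; apply: rn.
Qed.

Lemma second_facts : [/\ dB ^+ 2 = D * n ^+ 2 - 4 * (Y * (dA * n - Y)),
  3 * rho1 ^+ 2 * n <= dB, 3 * rho1 * n <= n - 2 * y, n - 2 * y <= n & spread s t e = s * t * e / dB ^+ 2].
Proof.
have bal := balanced_second; have [r1 n1 b1 b2 b3] := bal; have := center_facts bal.
rewrite /spread sum_second => -[eD _ u1 _ _].
rewrite sum_second in n1 b1 b2 b3; rewrite -/dB in eD u1.
have [_ _ _ m [prod my mb mc]] := first_facts.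
move: yn; rewrite ler_norml => /andP[y1 y2].
have mn : 0 < m0 * n by rewrite mulr_gt0.
have mbn : m0 * n <= (b - yA) * n by rewrite ler_pM2r.
have mcn : m0 * n <= (c - yA) * n by rewrite ler_pM2r.
have myn : m0 * n <= yA * n by rewrite ler_pM2r.
have ra : rho1 * n <= a * n by rewrite ler_pM2r // ge_min lexx.
have rm : rho1 * n <= m0 / 2 * n by rewrite ler_pM2r // ge_min lexx orbT.
have dn : 0 < d * n by rewrite mulr_gt0.
have n3 : 3 * rho1 * n <= n - 2 * y.
  rewrite -sum_second /s /t /e; plra.
split=> //; last 2 first.
- by plra.
- by rewrite eD.
- rewrite eD /s /e /Y /dA /D /Dcst.
  have -> : (n - 2 * y) ^+ 2 - 4 * (((c + d) * n - y) * (a * n)) =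
    n ^+ 2 - 4 * (n ^+ 2 * (c + d) * a) - 4 * (y * ((b + d + c) * n - y)).
    have -> : b = 1 - a - c - d by rewrite -sum1; ring.
    by ring.
  have -> : (1 - 4 * (a * c + a * d + b * c)) * n ^+ 2 =
    n ^+ 2 - 4 * (n ^+ 2 * (c + d) * a) - 4 * (b * c * n ^+ 2) by ring.
  by rewrite -prod; ring.
apply: le_trans u1; have := ler_wpM2l (ltW r1) n3; rewrite expr2; plra.
Qed.

Lemma Y_bound : `|Y| <= n.
Proof.
have [_ _ _ m [_ my mb _]] := first_facts; apply: le_trans yn _.
by rewrite ler_piMl ?(ltW n0) //; have := sum_le; plra.
Qed.

Lemma dA_bound : `|dA * n - Y| <= 2 * n.
Proof.
have [_ dA0 dA1 _ _] := first_facts.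
apply: le_trans (ler_normB _ _) _; rewrite normrM (gtr0_norm dA0) (gtr0_norm n0).
have : dA * n <= 1 * n by rewrite ler_pM2r.
by have := Y_bound; plra.
Qed.

(** The squares of kap n and dB differ by 4 Y (dA n - Y); dividing by kap n + dB yields r Y and a
    remainder of order Y^2 / n, bounded when Y is of order sqrt n. *)
Lemma second_center : `|(y + center s t e - (1 - kap) / 2 * n) - r * Y| <= (8 / kap + 2) / kap ^+ 2 * (Y ^+ 2 / n).
Proof.
have [eD u1 n3 nn _] := second_facts; have [_ dA0 dA1 _ _] := first_facts.
have k0 := kap_gt0; have k1 := kap_le1; have r1 := rho1_gt0.
have dB0 : 0 < dB by apply: lt_le_trans u1; rewrite !mulr_gt0 ?exprn_gt0.
have kn0 : 0 < kap * n by rewrite mulr_gt0.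
rewrite -kap_sqr -exprMn in eD.
have -> : y + center s t e - (1 - kap) / 2 * n - r * Y =
   Y * (dA * n * (kap * n - dB) - 2 * Y * (kap * n)) / (kap * n * (kap * n + dB)).
  have -> : center s t e = (n - 2 * y - dB) / 2 by rewrite /dB; field.
  have e2 : (kap * n - dB) * (kap * n + dB) = 4 * (Y * (dA * n - Y)).
    by rewrite -subr_sqr eD; ring.
  apply: (@mulIf _ (2 * (kap * n * (kap * n + dB)))).
    by rewrite gt_eqF // !mulr_gt0 // addr_gt0.
  have kk : kap * n != 0 by rewrite gt_eqF.
  have kd : kap * n + dB != 0 by rewrite gt_eqF // addr_gt0.
  rewrite /r; transitivity (kap * n * ((kap * n - dB) * (kap * n + dB)) - 2 * (dA * n * Y * (kap * n + dB))).
    by field; rewrite !gt_eqF.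
  rewrite [RHS](_ : _ = 2 * (Y * (dA * n * (kap * n - dB) - 2 * Y * (kap * n)))); last by field; rewrite kd !gt_eqF.
  by rewrite e2; ring.
set q := kap * n - dB.
have Yb := Y_bound; have dY := dA_bound.
have qb : `|q| <= 8 * `|Y| / kap.
  have e2 : q * (kap * n + dB) = 4 * (Y * (dA * n - Y)).
    by rewrite -subr_sqr eD; ring.
  have kd : 0 < kap * n + dB by rewrite addr_gt0.
  rewrite -(ler_pM2r kd) -{1}(gtr0_norm kd) -normrM e2 normrM normrM (ger0_norm (ler0n R 4)).
  apply: (@le_trans _ _ (8 * `|Y| / kap * (kap * n))); last first.
    by rewrite ler_wpM2l ?divr_ge0 ?mulr_ge0 ?(ltW k0) // lerDl ltW.
  have -> : 8 * `|Y| / kap * (kap * n) = 4 * (`|Y| * (2 * n)) by field; rewrite gt_eqF.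
  by rewrite ler_wpM2l // ler_wpM2l.
rewrite normrM normfV normrM (gtr0_norm (_ : 0 < kap * n * (kap * n + dB))); last first.
  by rewrite mulr_gt0 // addr_gt0.
rewrite ler_pdivrMr; last by rewrite mulr_gt0 // addr_gt0.
have i1 : `|dA * n * q - 2 * Y * (kap * n)| <= n * (8 * `|Y| / kap) + 2 * `|Y| * n.
  apply: le_trans (ler_normB _ _) _; rewrite !normrM (gtr0_norm dA0) (gtr0_norm n0) (gtr0_norm k0) (ger0_norm (ler0n R 2)).
  apply: lerD.
    apply: ler_pM => //; first by rewrite mulr_ge0 // ltW.
    by rewrite ler_piMl // ltW.
  rewrite ler_wpM2l // ?mulr_ge0 //.
  by rewrite ler_piMl // ltW.
apply: (@le_trans _ _ (`|Y| * (n * (8 * `|Y| / kap) + 2 * `|Y| * n))); first by rewrite ler_wpM2l.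
apply: (@le_trans _ _ ((8 / kap + 2) / kap ^+ 2 * (Y ^+ 2 / n) * (kap * n * (kap * n)))).
  rewrite -(real_normK (num_real Y)).
  have -> : (8 / kap + 2) / kap ^+ 2 * (`|Y| ^+ 2 / n) * (kap * n * (kap * n)) =
     `|Y| * (n * (8 * `|Y| / kap) + 2 * `|Y| * n) by field; rewrite !gt_eqF.
  by [].
have X0 : 0 <= (8 / kap + 2) / kap ^+ 2 * (Y ^+ 2 / n).
  apply: mulr_ge0; apply: divr_ge0; rewrite ?sqr_ge0 ?(ltW n0) //.
  by rewrite addr_ge0 // divr_ge0 // ltW.
apply: (ler_wpM2l X0).
by rewrite ler_wpM2l ?(ltW kn0) // lerDl ltW.
Qed.

(** With Q = Y (dA n - Y), s t = b d n^2 - Q and dB^2 = kap^2 n^2 - 4 Q, so the spread moves by a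
    multiple of Q / n, which is of order Y. *)
Lemma second_spread : `|spread s t e - sB * n| <= (2 / (3 * rho1 ^+ 2) ^+ 2 + 8 / ((3 * rho1 ^+ 2) ^+ 2 * kap ^+ 2)) * `|Y|.
Proof.
have [eD u1 n3 nn ->] := second_facts; have [_ dA0 dA1 _ [prod _ _ _]] := first_facts.
have k0 := kap_gt0; have r1 := rho1_gt0.
have r3 : 0 < 3 * rho1 ^+ 2 by rewrite mulr_gt0 ?exprn_gt0.
have dB0 : 0 < dB by apply: lt_le_trans u1; rewrite mulr_gt0.
have Yb := Y_bound; have dY := dA_bound.
pose Q := Y * (dA * n - Y).
have Qb : `|Q| <= `|Y| * (2 * n) by rewrite normrM ler_wpM2l.
have st : s * t = b * d * n ^+ 2 - Q.
  have -> : s * t = (c + d) * b * n ^+ 2 - y * ((b + d + c) * n - y) by rewrite /s /t; ring.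
  have -> : Q = y * ((b + d + c) * n - y) - b * c * n ^+ 2.
    by rewrite -prod /Q /Y /dA; ring.
  by ring.
rewrite -kap_sqr in eD; rewrite -/Q in eD.
have -> : s * t * e / dB ^+ 2 - sB * n = a * n * ((4 * (b * d) / kap ^+ 2 - 1) * Q) / dB ^+ 2.
  rewrite st /sB /e.
  have -> : b * d * n ^+ 2 = b * d / kap ^+ 2 * (dB ^+ 2 + 4 * Q).
    by rewrite eD; field; rewrite gt_eqF.
  by field; rewrite !gt_eqF.
rewrite normrM normfV (ger0_norm (sqr_ge0 dB)) ler_pdivrMr ?exprn_gt0 //.
have bd1 : b * d <= 1 by rewrite -[leRHS]mulr1; apply: ler_pM; rewrite ?(ltW b0) ?(ltW d0) //; plra.
have bd0 : 0 < b * d by rewrite mulr_gt0.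
have k2 : 0 < kap ^+ 2 by rewrite exprn_gt0.
have i1 : `|4 * (b * d) / kap ^+ 2 - 1| <= 4 / kap ^+ 2 + 1.
  have h : 0 <= 4 * (b * d) / kap ^+ 2 by rewrite divr_ge0 ?(ltW k2) // mulr_ge0 ?(ltW bd0).
  apply: le_trans (ler_normB _ _) _; rewrite normr1 lerD2r (ger0_norm h).
  by rewrite ler_wpM2r ?invr_ge0 ?(ltW k2) // ler_piMr.
apply: (@le_trans _ _ (1 * n * ((4 / kap ^+ 2 + 1) * (`|Y| * (2 * n))))).
  rewrite !normrM (gtr0_norm a0) (gtr0_norm n0).
  have h1 : a * n <= 1 * n by rewrite ler_wpM2r ?(ltW n0) //; plra.
  have h2 : `|4 * (b * d) / kap ^+ 2 - 1| * (`|Y| * `|dA * n - Y|) <= (4 / kap ^+ 2 + 1) * (`|Y| * (2 * n)).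
    by apply: ler_pM => //; apply: ler_pM.
  have h3 : 0 <= a * n by rewrite mulr_ge0 ?(ltW a0) ?(ltW n0).
  by apply: ler_pM => //; do ?apply: mulr_ge0.
apply: (@le_trans _ _ ((2 / (3 * rho1 ^+ 2) ^+ 2 + 8 / ((3 * rho1 ^+ 2) ^+ 2 * kap ^+ 2)) * `|Y| * (3 * rho1 ^+ 2 * n) ^+ 2)).
  by rewrite le_eqVlt; apply/orP; left; apply/eqP; field; rewrite !gt_eqF.
have X0 : 0 <= (2 / (3 * rho1 ^+ 2) ^+ 2 + 8 / ((3 * rho1 ^+ 2) ^+ 2 * kap ^+ 2)) * `|Y|.
  apply: mulr_ge0 => //; apply: addr_ge0; apply: divr_ge0; rewrite ?sqr_ge0 //.
  by rewrite mulr_ge0 ?sqr_ge0.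
apply: (ler_wpM2l X0).
by rewrite ler_sqr ?nnegrE ?(ltW dB0) // mulr_ge0 ?(ltW r3) // ltW.
Qed.

End Perturbed.
End Mixture.

Lemma le_sum_normB (R : realType) (X : nat) (P : pred nat) (f g : nat -> R) (e : R) :
  (forall y, (y < X)%N -> P y -> `|f y - g y| <= e * g y) ->
  `|\sum_(y < X | P y) f y - \sum_(y < X | P y) g y| <= e * \sum_(y < X | P y) g y.
Proof.
move=> H; rewrite -sumrB; apply: le_trans (ler_norm_sum _ _ _) _.
by rewrite mulr_sumr; apply: ler_sum => y; apply: H.
Qed.

(** Replacing A and B by Gaussians costs 3 e relative to g S; by [gauss_product] S is a Riemann sum
    with |S - 1| <= 2 e, hence S <= 3. The total is 9 e + 2 e. *)
Lemma mixture_window (R : realType) (e H u v r y0 Z : R) (X : nat) (A B : nat -> R) :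
  0 < u -> 0 < v -> 0 < e -> e <= 1 -> 0 <= H ->
  let V := v + r ^+ 2 * u in let tau := Num.sqrt (u * v / V) in let c := r * u / V * Z in
  0 <= y0 - H -> y0 + H <= X%:R -> (2 * H / tau + 3) / tau <= e ->
  1 - e <= Phi ((H - c) / tau) - Phi ((- H - c) / tau) <= 1 ->
  (forall y, (y < X)%N -> `|y%:R - y0| <= H ->
     `|A y - gauss_at u (y%:R - y0)| <= e * gauss_at u (y%:R - y0) /\
     `|B y - gauss_at v (Z - r * (y%:R - y0))| <= e * gauss_at v (Z - r * (y%:R - y0))) ->
  `|\sum_(y < X | `|y%:R - y0| <= H) A y * B y - gauss_at V Z| <= 11 * e * gauss_at V Z.
Proof.
move=> u0 v0 e0 e1 H0 V tau c yH HX het /andP[m1 m2] AB.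
have V0 : 0 < V by rewrite /V ltr_wpDr // mulr_ge0 ?sqr_ge0 // ltW.
have w0 : 0 < u * v / V by rewrite divr_gt0 // mulr_gt0.
have t0 : 0 < tau by rewrite sqrtr_gt0.
set g := gauss_at V Z; have g0 : 0 < g by apply: gauss_at_gt0.
pose G (y : nat) := gauss_at u (y%:R - y0) * gauss_at v (Z - r * (y%:R - y0)).
have GE y : G y = g * gauss_at (u * v / V) (y%:R - y0 - c) by rewrite /G gauss_product.
pose S := \sum_(y < X | `|y%:R - y0| <= H) gauss_at (u * v / V) (y%:R - y0 - c).
have SG : \sum_(y < X | `|y%:R - y0| <= H) G y = g * S.
  by rewrite /S mulr_sumr; apply: eq_bigr => y _; rewrite GE.
have d1 : `|\sum_(y < X | `|y%:R - y0| <= H) A y * B y - g * S| <= 3 * e * (g * S).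
  rewrite -SG; apply: (@le_sum_normB R X (fun y => `|y%:R - y0| <= H) (fun y => A y * B y)) => y yX yH'.
  have [hA hB] := AB y yX yH'.
  rewrite /G; move: hA hB; set p := gauss_at u _; set q := gauss_at v _ => hA hB.
  have p0 : 0 < p by apply: gauss_at_gt0.
  have q0 : 0 < q by apply: gauss_at_gt0.
  have -> : A y * B y - p * q = (A y - p) * (B y - q) + p * (B y - q) + (A y - p) * q by ring.
  apply: le_trans (ler_normD _ _) _.
  have i1 : `|(A y - p) * q| <= e * p * q by rewrite normrM (gtr0_norm q0) ler_wpM2r // ltW.
  have i2 : `|p * (B y - q)| <= p * (e * q) by rewrite normrM (gtr0_norm p0) ler_wpM2l // ltW.
  have i3 : `|(A y - p) * (B y - q)| <= e * p * (e * q) by rewrite normrM; apply: ler_pM.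
  have i4 : e * p * (e * q) <= e * p * (1 * q).
    by rewrite !ler_wpM2l ?mulr_ge0 ?(ltW e0) ?(ltW p0) // ler_wpM2r // ltW.
  apply: (@le_trans _ _ (e * p * (1 * q) + p * (e * q) + e * p * q)); last by rewrite le_eqVlt; apply/orP; left; apply/eqP; ring.
  apply: lerD i1; apply: le_trans (ler_normD _ _) _; apply: lerD i2; exact: le_trans i3 i4.
have d2 : `|S - (Phi ((H - c) / tau) - Phi ((- H - c) / tau))| <= e.
  apply: le_trans het.
  have -> : 2 * H / tau + 3 = (H - c) / tau - (- H - c) / tau + 3 by field; rewrite gt_eqF.
  have SE : S = \sum_(y < X | ((- H - c) / tau <= (y%:R - (y0 + c)) / tau) && ((y%:R - (y0 + c)) / tau <= (H - c) / tau)) phi ((y%:R - (y0 + c)) / tau) / tau.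
    apply: eq_big => y.
      rewrite !ler_pM2r ?invr_gt0 // ler_norml; congr andb; apply/idP/idP; clear; lra.
    by move=> _; rewrite /gauss_at -/tau opprD addrA.
  rewrite SE; apply: riemann_phi => //.
  - by rewrite ler_pM2r ?invr_gt0 //; move: H0; clear; lra.
  - by rewrite divfK ?gt_eqF //; move: yH; clear; lra.
  by rewrite divfK ?gt_eqF //; move: HX; clear; lra.
have S2 : `|S - 1| <= 2 * e.
  move: d2 m1 m2 e0; clear; rewrite !ler_norml => /andP[z1 z2] *; apply/andP; split; lra.
have S3 : S <= 3 by move: S2 e1; clear; rewrite ler_norml => /andP[z1 z2] *; lra.
have gS : `|g * S - g| <= 2 * e * g.
  by rewrite -[X in _ - X]mulr1 -mulrBr normrM (gtr0_norm g0) mulrC ler_wpM2r // ltW.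
have gS3 : 3 * e * (g * S) <= 9 * e * g.
  have -> : 9 * e * g = 3 * e * (g * 3) by ring.
  by rewrite !ler_wpM2l ?(ltW g0) // mulr_ge0 // ltW.
move: (\sum_(y < X | _) _) d1 => W d1.
have -> : W - g = (W - g * S) + (g * S - g) by ring.
apply: le_trans (ler_normD _ _) _; apply: (@le_trans _ _ (9 * e * g + 2 * e * g)).
  by apply: lerD gS; apply: le_trans gS3.
by rewrite -!mulrDl -natrD.
Qed.

Lemma nat_large (R : realType) (k : R) (N0 : nat) : 0 < k ->
  exists N1, forall n s : nat, (N1 <= n)%N -> k * n%:R <= s%:R -> (N0 <= s)%N.
Proof.
move=> k0; have [N1 H] := sqrt_large (Num.max 1 (N0%:R / k)).
exists N1 => n s /H; rewrite ge_max => /andP[h1 h2] hs.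
rewrite -(ler_nat R); apply: le_trans hs; rewrite mulrC -ler_pdivrMr //.
apply: le_trans h2 _; rewrite -[leRHS](sqr_sqrtr (ler0n R n)) expr2.
by rewrite ler_peMl // (le_trans ler01).
Qed.

Lemma balanced_scale (R : realType) (k rho s t d : R) :
  0 < k -> balanced rho s t d -> balanced rho (s * k) (t * k) (d * k).
Proof.
move=> k0 [r0 n0 h1 h2 h3]; split=> //; rewrite -!mulrDl; first exact: mulr_gt0.
all: by rewrite mulrA ler_pM2r.
Qed.

Lemma cgw_llt_scaled (R : realType) (rho s0 t0 d0 K eps : R) :
  balanced rho s0 t0 d0 -> 0 < K -> 0 < eps -> exists N0, forall n s t d : nat, (N0 <= n)%N ->
  s%:R = s0 * n%:R -> t%:R = t0 * n%:R -> d%:R = d0 * n%:R ->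
  forall w : nat, let x := w%:R - center s0 t0 d0 * n%:R in `|x| <= K * Num.sqrt n%:R ->
  `|cgw R s t d w - gauss_at (spread s0 t0 d0 * n%:R) x| <= eps * gauss_at (spread s0 t0 d0 * n%:R) x.
Proof.
move=> bal K0 e0; have [r0 n0 _ _ _] := bal.
have k0 : 0 < Num.sqrt (s0 + t0 + d0) by rewrite sqrtr_gt0.
have [N0 H] := cgw_llt r0 (divr_gt0 K0 k0) e0.
have [N1 H1] := nat_large N0 n0.
exists (maxn 1 N1) => n s t d; rewrite geq_max => /andP[np nN] es et ed w x xK.
have n1 : 0 < n%:R :> R by rewrite ltr0n.
have tot : (s + t + d)%:R = (s0 + t0 + d0) * n%:R :> R by rewrite !natrD es et ed; ring.
have := H s t d; rewrite es et ed center_scale // spread_scale // => /(_ _ _ w); apply.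
- by apply: H1 nN _; rewrite tot.
- exact: balanced_scale.
by rewrite tot sqrtrM ?(ltW n0) // mulrA divfK ?gt_eqF.
Qed.

Lemma approx_trans (R : realType) (e p q g : R) : 0 < e -> e <= 1 -> 0 <= g ->
  `|p - q| <= e / 4 * q -> `|q - g| <= e / 4 * g -> `|p - g| <= e * g.
Proof.
move=> e0 e1 g0 h1 h2; have -> : p - g = (p - q) + (q - g) by ring.
apply: le_trans (ler_normD _ _) _; apply: le_trans (lerD h1 h2) _.
have q2 : q <= 2 * g.
  have eg : e / 4 * g <= 1 * g by rewrite ler_wpM2r //; move: e1; clear; lra.
  by move: h2 eg; clear; rewrite ler_norml => /andP[_ h] *; lra.
have : e / 4 * q <= e / 4 * (2 * g) by rewrite ler_wpM2l // divr_ge0 // ltW.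
have : 0 <= e * g by rewrite mulr_ge0 // ltW.
by clear; lra.
Qed.

(** [cgw_llt] applies at the exact centre and spread, which depend on y; [gauss_near] then replaces
    them by the affine centre and the constant spread sB n. *)
Lemma second_stage_core (R : realType) (a b c d yA mu r sB m0 rho1 C1 C2 T K eps : R) :
  0 < r -> 0 < sB -> 0 < m0 -> 0 < rho1 -> 0 < C1 -> 0 < C2 -> a + b + c + d = 1 :> R ->
  (forall n y : R, 0 < n -> `|y - yA * n| <= m0 / 2 * n ->
    [/\ balanced rho1 ((c + d) * n - y) (b * n - y) (a * n),
        3 * rho1 * n <= n - 2 * y,
        `|(y + center ((c + d) * n - y) (b * n - y) (a * n) - mu * n) - r * (y - yA * n)| <= C1 * ((y - yA * n) ^+ 2 / n) &
        `|spread ((c + d) * n - y) (b * n - y) (a * n) - sB * n| <= C2 * `|y - yA * n|]) ->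
  0 < T -> 0 < K -> 0 < eps -> eps <= 1 ->
  exists N0, forall n l q M N : nat, (N0 <= n)%N ->
  l%:R = a * n%:R -> q%:R = c * n%:R -> M%:R = b * n%:R -> N%:R = d * n%:R ->
  forall x y : nat, let Z := x%:R - mu * n%:R in let Y := y%:R - yA * n%:R in
  `|Z| <= K * Num.sqrt n%:R -> `|Y| <= T * Num.sqrt n%:R ->
  [/\ (y <= x)%N, (y <= M)%N & `|cgw R (N + q - y) (M - y) l (x - y) - gauss_at (sB * n%:R) (Z - r * Y)|
    <= eps * gauss_at (sB * n%:R) (Z - r * Y)].
Proof.
move=> rp sB0 m00 r1 C10 C20 sum1 Ceq T0 K0 e0 e1.
have sumE : forall n y : R, ((c + d) * n - y) + (b * n - y) + (a * n) = n - 2 * y.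
  by move=> n y; rewrite (_ : d = 1 - a - b - c); [ring|rewrite -sum1; ring].
(* A common bound: the centre moves by at most C1 T^2 and the spread by at most C2 T h. *)
pose D1 := C1 * T ^+ 2 + C2 * T.
have D10 : 0 < D1 by rewrite addr_gt0 ?mulr_gt0 ?exprn_gt0.
pose kappa := K + r * T + D1.
have kappa0 : 0 < kappa by rewrite !addr_gt0 ?mulr_gt0.
pose cc := Num.min sB (3 * rho1 ^+ 4).
have cc0 : 0 < cc by rewrite lt_min sB0 mulr_gt0 ?exprn_gt0.
have s3 : 0 < Num.sqrt (3 * rho1) by rewrite sqrtr_gt0 mulr_gt0.
have e40 : 0 < eps / 4 by rewrite divr_gt0.
have [N1 H1] := cgw_llt r1 (divr_gt0 kappa0 s3) e40.
have [N2 H2] := nat_large N1 (mulr_gt0 (ltr0Sn R 2) r1).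
pose big1 := (2 * (D1 / cc) + 4 * (D1 * kappa / cc) + 2 * (kappa ^+ 2 * D1 / cc ^+ 2)) / (eps / 4).
have [N3 H3] := sqrt_large (Num.max (Num.max 1 big1) (Num.max (2 * T / m0) (kappa / (3 * rho1 ^+ 3)))).
exists (maxn N2 N3) => n l q M N; rewrite geq_max => /andP[n2 /H3].
rewrite !ge_max => /andP[/andP[h1 hbig] /andP[hT hk]] el eq eM eN x y Z Y hZ hY.
set h := Num.sqrt n%:R in h1 hbig hT hk hZ hY.
have nE : n%:R = h ^+ 2 :> R by rewrite sqr_sqrtr.
have h0 : 0 < h := lt_le_trans ltr01 h1.
have n0 : 0 < n%:R :> R by rewrite nE exprn_gt0.
have hm : `|Y| <= m0 / 2 * n%:R.
  apply: le_trans hY _; rewrite nE expr2 mulrA ler_pM2r //.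
  by move: hT; rewrite ler_pdivrMr // => hT; rewrite -(ler_pM2l (ltr0Sn R 1)); apply: le_trans hT _; rewrite le_eqVlt; apply/orP; left; apply/eqP; field.
have [bal n3 hc hs] := Ceq _ _ n0 hm.
have [_ _ bs bt _] := bal; rewrite sumE in bs bt.
have pos : 0 < rho1 * (n%:R - 2 * y%:R) by rewrite mulr_gt0 // (lt_le_trans _ n3) // !mulr_gt0.
have yM : (y <= M)%N by rewrite -(ler_nat R) eM; move: pos bt; clear; lra.
have yN : (y <= N + q)%N by rewrite -(ler_nat R) natrD eN eq; move: pos bs; clear; lra.
have es : (N + q - y)%:R = (c + d) * n%:R - y%:R :> R by rewrite natrB // natrD eN eq; ring.
have et : (M - y)%:R = b * n%:R - y%:R :> R by rewrite natrB // eM.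
set w0 := center _ _ _ in hc.
set v1 := spread _ _ _ in hs.
have Y2 : Y ^+ 2 / n%:R <= T ^+ 2.
  rewrite ler_pdivrMr // nE -exprMn -(real_normK (num_real Y)).
  by rewrite ler_sqr ?nnegrE // mulr_ge0 // ltW.
have xy : `|(x%:R - y%:R - w0) - (Z - r * Y)| <= D1.
  have -> : x%:R - y%:R - w0 - (Z - r * Y) = - (y%:R + w0 - mu * n%:R - r * Y) by rewrite /Z; ring.
  rewrite normrN.
  apply: le_trans hc _; apply: (@le_trans _ _ (C1 * T ^+ 2)); first by rewrite ler_pM2l.
  by rewrite lerDl mulr_ge0 // ltW.
have uv : `|v1 - sB * n%:R| <= D1 * h.
  apply: le_trans hs _; apply: (@le_trans _ _ (C2 * (T * h))); first by rewrite ler_pM2l.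
  by rewrite mulrA ler_pM2r // lerDr mulr_ge0 ?sqr_ge0 // ltW.
have yk0 : `|Z - r * Y| <= (K + r * T) * h.
  apply: le_trans (ler_normB _ _) _; rewrite mulrDl; apply: lerD => //.
  by rewrite normrM (gtr0_norm rp) -mulrA ler_pM2l.
have Dh : D1 <= D1 * h by rewrite ler_peMr // ltW.
have yk : `|Z - r * Y| <= kappa * h.
  by apply: le_trans yk0 _; rewrite ler_pM2r // lerDl ltW.
have xk : `|x%:R - y%:R - w0| <= kappa * h.
  rewrite (_ : _ - w0 = (x%:R - y%:R - w0 - (Z - r * Y)) + (Z - r * Y)); last by rewrite subrK.
  apply: le_trans (ler_normD _ _) _; rewrite /kappa [(_ + D1) * h]mulrDl addrC; apply: lerD => //.
  exact: le_trans Dh.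
have [_ _ _ w0l _] := center_facts bal; rewrite sumE -/w0 in w0l.
have w0b : kappa * h <= w0.
  apply: le_trans w0l; apply: (@le_trans _ _ (rho1 ^+ 2 * (3 * rho1 * n%:R))); last by rewrite ler_pM2l ?exprn_gt0.
  rewrite nE (_ : rho1 ^+ 2 * _ = 3 * rho1 ^+ 3 * h * h); last by ring.
  by rewrite ler_pM2r // mulrC -ler_pdivrMr // mulr_gt0 ?exprn_gt0.
have yx : (y <= x)%N.
  by rewrite -(ler_nat R); move: w0b xk; clear; rewrite ler_norml => w0b /andP[k1 _]; lra.
split=> //.
have v1l : cc * h ^+ 2 <= v1.
  have [sb _] := spread_bounds bal; apply: le_trans sb; rewrite sumE -nE.
  apply: (@le_trans _ _ (rho1 ^+ 3 * (3 * rho1 * n%:R))); last by rewrite ler_pM2l ?exprn_gt0.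
  rewrite (_ : rho1 ^+ 3 * _ = 3 * rho1 ^+ 4 * n%:R); last by ring.
  by rewrite ler_pM2r // ge_min lexx orbT.
apply: (@approx_trans _ _ _ (gauss_at v1 (x%:R - y%:R - w0))) => //.
- by apply/ltW/gauss_at_gt0; rewrite mulr_gt0.
- have stot : (N + q - y + (M - y) + l)%:R = n%:R - 2 * y%:R :> R by rewrite !natrD es et el sumE.
  have := H1 (N + q - y)%N (M - y)%N l; rewrite stot es et el -/w0 -/v1 => /(_ _ bal (x - y)%N).
  rewrite natrB //; apply; first by apply: H2 n2 _; rewrite stot.
  apply: le_trans xk _; rewrite -mulrA ler_pM2l // mulrC ler_pdivlMr //.
  rewrite /h mulrC -sqrtrM; last by rewrite mulr_ge0 // ltW.
  by rewrite ler_wsqrtr.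
apply: (@gauss_near _ kappa cc D1 h) => //.
- exact: ltW.
- exact: ltW.
- by move: e1; clear; lra.
- by rewrite -nE ler_pM2r // ge_min lexx.
by rewrite [leRHS]mulrC -ler_pdivrMr.
Qed.

Section SecondStage.
Variables (R : realType) (a b c d : R).
Hypotheses (a0 : 0 < a) (b0 : 0 < b) (c0 : 0 < c) (d0 : 0 < d) (sum1 : a + b + c + d = 1 :> R).

Let D := Dcst a b c d.
Let kap := Num.sqrt D.
Let yA := center b d c.
Let dA := (b + d + c) - 2 * yA.
Let sA := spread b d c.
Let sB := b * d * a / kap ^+ 2.
Let r := dA / kap.
Let rho0 := Num.min b (Num.min c d).
Let m0 := rho0 ^+ 2 * (b + d + c).
Let rho1 := Num.min a (m0 / 2).
Let mu := (1 - kap) / 2.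

Lemma second_stage_llt (T K eps : R) : 0 < T -> 0 < K -> 0 < eps -> eps <= 1 ->
  exists N0, forall n l q M N : nat, (N0 <= n)%N ->
  l%:R = a * n%:R -> q%:R = c * n%:R -> M%:R = b * n%:R -> N%:R = d * n%:R ->
  forall x y : nat, let Z := x%:R - mu * n%:R in let Y := y%:R - yA * n%:R in
  `|Z| <= K * Num.sqrt n%:R -> `|Y| <= T * Num.sqrt n%:R ->
  [/\ (y <= x)%N, (y <= M)%N & `|cgw R (N + q - y) (M - y) l (x - y) - gauss_at (sB * n%:R) (Z - r * Y)|
    <= eps * gauss_at (sB * n%:R) (Z - r * Y)].
Proof.
move=> T0 K0 e0 e1.
have r1 : 0 < rho1 := rho1_gt0 a0 b0 c0 d0 sum1.
have k0 : 0 < kap := kap_gt0 b0 d0 sum1.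
have [_ dA0 _ m00 _] : [/\ dA ^+ 2 = (b + d + c) ^+ 2 - 4 * (b * c), 0 < dA, dA <= 1, 0 < m0 & _] := first_facts a0 b0 c0 d0 sum1.
have rp : 0 < r by rewrite divr_gt0.
have sB0 : 0 < sB by rewrite divr_gt0 ?exprn_gt0 // !mulr_gt0.
pose C1 := (8 / kap + 2) / kap ^+ 2.
pose C2 := 2 / (3 * rho1 ^+ 2) ^+ 2 + 8 / ((3 * rho1 ^+ 2) ^+ 2 * kap ^+ 2).
have Ceq : forall n y : R, 0 < n -> `|y - yA * n| <= m0 / 2 * n ->
    [/\ balanced rho1 ((c + d) * n - y) (b * n - y) (a * n),
        3 * rho1 * n <= n - 2 * y,
        `|(y + center ((c + d) * n - y) (b * n - y) (a * n) - mu * n) - r * (y - yA * n)| <= C1 * ((y - yA * n) ^+ 2 / n) &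
        `|spread ((c + d) * n - y) (b * n - y) (a * n) - sB * n| <= C2 * `|y - yA * n|].
  move=> n y n0 hy; split.
  - exact: balanced_second a0 b0 c0 d0 sum1 _ _ n0 hy.
  - by have [] := second_facts a0 b0 c0 d0 sum1 n0 hy.
  - exact: second_center a0 b0 c0 d0 sum1 _ _ n0 hy.
  exact: second_spread a0 b0 c0 d0 sum1 _ _ n0 hy.
have C10 : 0 < C1 by rewrite divr_gt0 ?exprn_gt0 // addr_gt0 // divr_gt0.
have C20 : 0 < C2 by rewrite addr_gt0 // divr_gt0 // ?mulr_gt0 ?exprn_gt0 // mulr_gt0 ?exprn_gt0.
exact: (second_stage_core rp sB0 m00 r1 C10 C20 sum1 Ceq T0 K0 e0 e1).
Qed.

End SecondStage.

(** Two thresholds: up to m the bound q on B multiplies the tail beyond H; beyond m only B <= 1 is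
    available. *)
Lemma tail_product (R : realType) (X : nat) (A B Y : nat -> R) (H m q t1 t2 : R) :
  (forall y, 0 <= A y) -> (forall y, 0 <= B y <= 1) -> 0 <= q ->
  (forall y, `|Y y| <= m -> B y <= q) ->
  \sum_(y < X | H <= `|Y y|) A y <= t1 -> \sum_(y < X | m <= `|Y y|) A y <= t2 ->
  0 <= \sum_(y < X | ~~ (`|Y y| <= H)) A y * B y <= q * t1 + t2.
Proof.
move=> A0 B01 q0 Bq h1 h2; apply/andP; split.
  by apply: sumr_ge0 => y _; rewrite mulr_ge0 //; case/andP: (B01 y).
apply: (@le_trans _ _ (q * \sum_(y < X | H <= `|Y y|) A y + \sum_(y < X | m <= `|Y y|) A y)).
  rewrite mulr_sumr big_mkcond [\sum_(y < X | H <= _) _]big_mkcond [\sum_(y < X | m <= _) _]big_mkcond -big_split.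
  apply: ler_sum => y _ /=; have [b0 b1] := andP (B01 y).
  rewrite -ltNge; case: ltP => [hy|_]; last first.
    by rewrite addr_ge0 //; case: ifP => // _; rewrite mulr_ge0.
  rewrite (ltW hy); case: (leP m `|Y y|) => hm.
    by apply: ler_wpDl; rewrite ?mulr_ge0 // ler_piMr.
  by rewrite addr0 mulrC ler_wpM2r // Bq // ltW.
by apply: lerD => //; rewrite ler_wpM2l.
Qed.

(** The target is at least a constant over h, the scale against which the tails are measured. *)
Lemma gauss_at_lower (R : realType) (s K h Z : R) : 0 < s -> 0 < h -> `|Z| <= K * h ->
  gauss_at s K / h <= gauss_at (s * h ^+ 2) Z.
Proof.
move=> s0 h0 hZ; have V0 : 0 < s * h ^+ 2 by rewrite mulr_gt0 ?exprn_gt0.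
rewrite !gauss_atE //.
have -> : Num.sqrt (s * h ^+ 2) = Num.sqrt s * h by rewrite sqrtrM ?(ltW s0) // sqrtr_sqr (gtr0_norm h0).
set p := (Num.sqrt (2 * pi))^-1; have p0 : 0 <= p by rewrite invr_ge0 sqrtr_ge0.
clearbody p; rewrite mulrAC -[p / _ / h]mulrA -invfM ler_wpM2l //.
  by rewrite mulr_ge0 // invr_ge0 mulr_ge0 ?sqrtr_ge0 // ltW.
rewrite ler_expR lerN2 ler_pdivrMr ?mulr_gt0 //.
rewrite (_ : K ^+ 2 / _ * _ = K ^+ 2 * h ^+ 2); last by field; rewrite gt_eqF.
rewrite -exprMn -(real_normK (num_real Z)) ler_sqr ?nnegrE //.
exact: le_trans hZ.
Qed.

(** After the signs, the analytic hypotheses are the two local limit theorems, the bound C / sqrt n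
    on B for y near its centre, and the Chebyshev tail of A. The window |Y| <= T sqrt n costs 11 e
    and its complement e. *)
Lemma mixture_core (R : realType) (I : Type) (ok : I -> Prop) (nu : I -> nat)
  (A : I -> nat -> R) (B : I -> nat -> nat -> R) (sA sB r yA mu rho m C K eps : R) :
  0 < sA -> 0 < sB -> 0 < r -> 0 < rho -> 0 < m -> m <= yA -> yA < mu -> 0 < C -> 0 < K -> 0 < eps ->
  (forall i y, 0 <= A i y) -> (forall i x y, 0 <= B i x y <= 1) ->
  (forall T e, 0 < T -> 0 < e -> exists N0, forall i, ok i -> (N0 <= nu i)%N ->
     forall y, let Y := y%:R - yA * (nu i)%:R in `|Y| <= T * Num.sqrt (nu i)%:R ->
     `|A i y - gauss_at (sA * (nu i)%:R) Y| <= e * gauss_at (sA * (nu i)%:R) Y) ->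
  (forall T e, 0 < T -> 0 < e -> e <= 1 -> exists N0, forall i, ok i -> (N0 <= nu i)%N ->
     forall x y, let Z := x%:R - mu * (nu i)%:R in let Y := y%:R - yA * (nu i)%:R in
     `|Z| <= K * Num.sqrt (nu i)%:R -> `|Y| <= T * Num.sqrt (nu i)%:R ->
     `|B i x y - gauss_at (sB * (nu i)%:R) (Z - r * Y)| <= e * gauss_at (sB * (nu i)%:R) (Z - r * Y)) ->
  (exists N0, forall i, ok i -> (N0 <= nu i)%N ->
     forall x y, `|y%:R - yA * (nu i)%:R| <= m * (nu i)%:R -> B i x y <= C / Num.sqrt (nu i)%:R) ->
  (forall i X theta, ok i -> (0 < nu i)%N -> 2 <= rho * theta ->
     \sum_(y < X | theta <= `|y%:R - yA * (nu i)%:R|) A i y <= 32 * (nu i)%:R / (rho ^+ 2 * theta ^+ 2)) ->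
  exists N0, forall i, ok i -> (N0 <= nu i)%N ->
    forall x, let Z := x%:R - mu * (nu i)%:R in `|Z| <= K * Num.sqrt (nu i)%:R ->
    `|\sum_(y < x.+1) A i y * B i x y - gauss_at ((sB + r ^+ 2 * sA) * (nu i)%:R) Z| <=
      eps * gauss_at ((sB + r ^+ 2 * sA) * (nu i)%:R) Z.
Proof.
move=> sA0 sB0 r0 rho0 m0 my ymu C0 K0 eps0 A0 B01 hA hB [N1 hS] hT.
pose e := Num.min 1 eps / 12.
have e0 : 0 < e by rewrite divr_gt0 // lt_min ltr01.
have e1 : e <= 1 by rewrite ler_pdivrMr // ge_min; apply/orP; left; clear; lra.
have e12 : 12 * e <= eps by rewrite /e mulrC divfK // ge_min lexx orbT.
clearbody e.
set sig := sB + r ^+ 2 * sA.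
have sig0 : 0 < sig by rewrite ltr_wpDr // mulr_ge0 ?sqr_ge0 // ltW.
pose s' := sA * sB / sig; have s'0 : 0 < s' by rewrite divr_gt0 // mulr_gt0.
pose ts := Num.sqrt s'; have ts0 : 0 < ts by rewrite sqrtr_gt0.
have [Ke Ke0 mass] := Phi_mass e0.
pose g0 := gauss_at sig K; have g00 : 0 < g0 by apply: gauss_at_gt0.
pose c' := r * sA / sig; have c'0 : 0 < c' by rewrite divr_gt0 // mulr_gt0.
(* With T^2 >= T1 the moderate range, bounded by (C/h) 32 / (rho^2 T^2), takes at most half of e g0
   / h. *)
pose T1 := 64 * C / (rho ^+ 2 * e * g0).
have T10 : 0 < T1 by apply: divr_gt0; [apply: mulr_gt0 | apply: mulr_gt0 => //; apply: mulr_gt0 => //; apply: exprn_gt0].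
(* The last two summands keep mass 1 - e inside the window although the Gaussian in Y is centred at
   c' Z. *)
pose T := 1 + T1 + Ke * ts + c' * K.
have kts0 : 0 < Ke * ts by apply: mulr_gt0.
have ck0 : 0 < c' * K by apply: mulr_gt0.
have T0 : 0 < T by rewrite /T !addr_gt0.
have TT1 : 1 <= T.
  by rewrite /T; move: T10 kts0 ck0; clear; lra.
have T1T : T1 <= T ^+ 2.
  apply: (@le_trans _ _ T); last by rewrite expr2 ler_peMl // ltW.
  by rewrite /T; move: T10 kts0 ck0; clear; lra.
have TK : Ke * ts <= T - c' * K by rewrite /T; move: T10 kts0 ck0; clear; lra.
clearbody T.
have [N2 HA] := hA T e T0 e0.
have [N3 HB] := hB T e T0 e0 e1.
pose hb1 := (2 * T / ts + 3) / (ts * e).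
(* The far range contributes 32 / (rho^2 m^2 h^2), one power of h below g0 / h. *)
pose hb2 := 256 / 2 / (rho ^+ 2 * m ^+ 2 * e * g0).
(* Since yA < mu, the upper end of the window in y lies below x + 1. *)
pose hb3 := (T + K) / (mu - yA).
have [N4 H4] := sqrt_large (Num.max (Num.max (Num.max 1 hb1) (Num.max hb2 hb3)) (Num.max (T / m) (Num.max (2 / rho) (2 / (rho * m))))).
exists (maxn (maxn N1 N2) (maxn N3 N4)) => i oki.
rewrite !geq_max => /andP[/andP[n1 n2] /andP[n3 /H4]].
rewrite !ge_max => /andP[/andP[/andP[h1 b1] /andP[b2 b3]] /and3P[b4 b5 b6]] x Z hZ.
have {}HA := HA i oki n2; have {}HB := HB i oki n3 x; have {}hS := hS i oki n1 x.
have {}hT := hT i x.+1 _ oki.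
rewrite -/Z in HB.
set h := Num.sqrt (nu i)%:R in h1 b1 b2 b3 b4 b5 b6 hZ HA HB hS.
have nE : (nu i)%:R = h ^+ 2 :> R by rewrite sqr_sqrtr.
have h0 : 0 < h := lt_le_trans ltr01 h1.
have np : (0 < nu i)%N by rewrite -(ltr_nat R) nE exprn_gt0.
have ZE : Z = x%:R - mu * h ^+ 2 by rewrite /Z nE.
clearbody Z; rewrite nE in HA HB hS hT *.
set g := gauss_at _ Z.
have g0l : g0 / h <= g by apply: gauss_at_lower.
clearbody g0; have gp : 0 < g by apply: lt_le_trans g0l; rewrite divr_gt0.
rewrite (bigID (fun y : 'I_x.+1 => `|y%:R - yA * h ^+ 2| <= T * h)) /=.
have W1 : `|\sum_(y < x.+1 | `|y%:R - yA * h ^+ 2| <= T * h) A i y * B i x y - g| <= 11 * e * g.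
  have Vh : sB * h ^+ 2 + r ^+ 2 * (sA * h ^+ 2) = sig * h ^+ 2 by rewrite /sig; ring.
  have uvV : sA * h ^+ 2 * (sB * h ^+ 2) / (sig * h ^+ 2) = s' * h ^+ 2.
    by rewrite /s'; field; rewrite !gt_eqF.
  have tE : Num.sqrt (s' * h ^+ 2) = ts * h by rewrite sqrtrM ?(ltW s'0) // sqrtr_sqr gtr0_norm.
  have th0 : 0 < ts * h by rewrite mulr_gt0.
  have cE : r * (sA * h ^+ 2) / (sig * h ^+ 2) * Z = c' * Z by rewrite /c'; field; rewrite !gt_eqF.
  have cb : `|c' * Z| <= c' * K * h by rewrite normrM (gtr0_norm c'0) -mulrA ler_pM2l.
  have := @mixture_window R e (T * h) (sA * h ^+ 2) (sB * h ^+ 2) r (yA * h ^+ 2) Z x.+1 (A i) (B i x).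
  rewrite /= Vh uvV tE cE; apply=> //.
  - by rewrite mulr_gt0 ?exprn_gt0.
  - by rewrite mulr_gt0 ?exprn_gt0.
  - by rewrite mulr_ge0 // ltW.
  - rewrite subr_ge0 expr2 mulrA ler_pM2r //; move: b4; rewrite ler_pdivrMr // => b4.
    by apply: le_trans b4 _; rewrite mulrC ler_pM2r.
  - have : T * h + K * h <= mu * h ^+ 2 - yA * h ^+ 2.
      move: b3; rewrite ler_pdivrMr ?subr_gt0 // => b3.
      by rewrite -mulrDl -mulrBl expr2 mulrA ler_pM2r // mulrC.
    move: hZ; rewrite ZE ler_norml => /andP[hZ' _]; move: hZ'; rewrite -[x.+1%:R]natr1; clear; lra.
  - have -> : 2 * (T * h) / (ts * h) = 2 * T / ts by field; rewrite !gt_eqF.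
    move: b1; rewrite !ler_pdivrMr // ?mulr_gt0 // => b1; apply: le_trans b1 _.
    by rewrite le_eqVlt; apply/orP; left; apply/eqP; ring.
  - have KT : Ke * (ts * h) <= T * h - c' * K * h by rewrite mulrA -mulrBl ler_pM2r.
    apply: mass.
      rewrite ler_pdivrMr // mulNr; move: cb KT; clear; rewrite ler_norml => /andP[cb1 cb2]; lra.
    rewrite ler_pdivlMr //; move: cb KT; clear; rewrite ler_norml => /andP[cb1 cb2]; lra.
  move=> y _ hy; split; [exact: HA | exact: HB].
have /andP[W2 W3] : 0 <= \sum_(y < x.+1 | ~~ (`|y%:R - yA * h ^+ 2| <= T * h)) A i y * B i x y <=
    C / h * (32 * h ^+ 2 / (rho ^+ 2 * (T * h) ^+ 2)) + 32 * h ^+ 2 / (rho ^+ 2 * (m * h ^+ 2) ^+ 2).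
  apply: (@tail_product _ _ (A i) (B i x) (fun y => y%:R - yA * h ^+ 2) (T * h) (m * h ^+ 2)) => //.
  - by rewrite divr_ge0 // ltW.
  - apply: hT => //; move: b5; rewrite ler_pdivrMr // => b5; apply: le_trans b5 _.
    by rewrite mulrC ler_pM2l // ler_peMl // ltW.
  apply: hT => //; move: b6; rewrite ler_pdivrMr ?mulr_gt0 // => b6; apply: le_trans b6 _.
  have -> : rho * (m * h ^+ 2) = h * (rho * m) * h by ring.
  by rewrite ler_peMr // !mulr_ge0 // ltW.
have W4 : C / h * (32 * h ^+ 2 / (rho ^+ 2 * (T * h) ^+ 2)) + 32 * h ^+ 2 / (rho ^+ 2 * (m * h ^+ 2) ^+ 2) <= e * g.
  apply: (@le_trans _ _ (e * (g0 / h))); last by rewrite ler_pM2l.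
  have -> : e * (g0 / h) = e * g0 / 2 / h + e * g0 / 2 / h by field; rewrite gt_eqF.
  apply: lerD.
    have -> : C / h * (32 * h ^+ 2 / (rho ^+ 2 * (T * h) ^+ 2)) = 32 * C / (rho ^+ 2 * T ^+ 2) / h.
      by field; rewrite !gt_eqF.
    rewrite ler_pM2r ?invr_gt0 // ler_pdivrMr ?mulr_gt0 ?exprn_gt0 //.
    move: T1T; rewrite ler_pdivrMr ?mulr_gt0 ?exprn_gt0 // => T1T; move: T1T; clear; lra.
  have -> : 32 * h ^+ 2 / (rho ^+ 2 * (m * h ^+ 2) ^+ 2) = 32 / (rho ^+ 2 * m ^+ 2) / h / h.
    by field; rewrite !gt_eqF.
  rewrite ler_pM2r ?invr_gt0 // ler_pdivrMr // ler_pdivrMr ?mulr_gt0 ?exprn_gt0 //.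
  move: b2; rewrite ler_pdivrMr ?mulr_gt0 ?exprn_gt0 // => b2; move: b2; clear; lra.
move: (\sum_(y < _ | ~~ _) _) W2 (le_trans W3 W4) => W2' W2 W5.
move: (\sum_(y < _ | _) _) W1 => W1' W1.
apply: (@le_trans _ _ (12 * e * g)); last by rewrite ler_wpM2r // ltW.
by move: W1 W2 W5; clear; rewrite !ler_norml => /andP[w1 w2] w3 w4; apply/andP; split; lra.
Qed.

Lemma second_stage_sup (R : realType) (a b c d m rho1 : R) : 0 < rho1 -> a + b + c + d = 1 :> R ->
  (forall n y : R, 0 < n -> `|y - center b d c * n| <= m * n ->
     balanced rho1 ((c + d) * n - y) (b * n - y) (a * n) /\ 3 * rho1 * n <= n - 2 * y) ->
  exists N0, forall n l q M N : nat, (N0 <= n)%N ->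
  l%:R = a * n%:R -> q%:R = c * n%:R -> M%:R = b * n%:R -> N%:R = d * n%:R ->
  forall y z : nat, `|y%:R - center b d c * n%:R| <= m * n%:R ->
  cgw R (N + q - y) (M - y) l z <= 2 / rho1 ^+ 2 / Num.sqrt (3 * rho1) / Num.sqrt n%:R.
Proof.
move=> r1 sum1 bal.
have r3 : 0 < 3 * rho1 by rewrite mulr_gt0.
have [N1 H1] := cgw_sup r1; have [N2 H2] := nat_large N1 r3.
exists (maxn 1 N2) => n l q M N; rewrite geq_max => /andP[np nN] el eq eM eN y z hy.
have n0 : 0 < n%:R :> R by rewrite ltr0n.
have [bs n3] := bal _ _ n0 hy.
have [_ pos bs1 bs2 _] := bs.
have pos' : 0 < rho1 * ((c + d) * n%:R - y%:R + (b * n%:R - y%:R) + a * n%:R) by rewrite mulr_gt0.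
have yM : (y <= M)%N by rewrite -(ler_nat R) eM; move: pos' bs2; clear; lra.
have yN : (y <= N + q)%N by rewrite -(ler_nat R) natrD eN eq; move: pos' bs1; clear; lra.
have es : (N + q - y)%:R = (c + d) * n%:R - y%:R :> R by rewrite natrB // natrD eN eq; ring.
have et : (M - y)%:R = b * n%:R - y%:R :> R by rewrite natrB // eM.
have stot : (N + q - y + (M - y) + l)%:R = n%:R - 2 * y%:R :> R.
  by rewrite !natrD es et el (_ : d = 1 - a - b - c); [ring|rewrite -sum1; ring].
have := H1 (N + q - y)%N (M - y)%N l; rewrite stot es et el => /(_ _ bs z) H.
apply: le_trans (H _) _; first by apply: H2 nN _; rewrite stot.
have r2 : 0 < 2 / rho1 ^+ 2 by rewrite divr_gt0 ?exprn_gt0.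
rewrite -(mulrA (2 / rho1 ^+ 2)) ler_pM2l // -invfM -sqrtrM ?(ltW r3) //.
have p3 : 0 < 3 * rho1 * n%:R by rewrite mulr_gt0.
by rewrite lef_pV2 ?posrE ?sqrtr_gt0 ?(lt_le_trans p3) // ler_wsqrtr.
Qed.

Lemma first_stage_tail (R : realType) (b c d rho theta : R) (n q M N X : nat) :
  balanced rho b d c -> b + d + c <= 1 -> (0 < n)%N ->
  q%:R = c * n%:R -> M%:R = b * n%:R -> N%:R = d * n%:R -> 2 <= rho * theta ->
  \sum_(y < X | theta <= `|y%:R - center b d c * n%:R|) cgw R M N q y <=
    32 * n%:R / (rho ^+ 2 * theta ^+ 2).
Proof.
move=> bal s1 np eq eM eN ht; have [r0 _ _ _ _] := bal.
have n0 : 0 < n%:R :> R by rewrite ltr0n.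
have bal' : balanced rho M%:R N%:R q%:R by rewrite eq eM eN; apply: balanced_scale.
have cE : center M%:R N%:R q%:R = center b d c * n%:R :> R by rewrite eq eM eN center_scale.
pose X' := maxn X M.+1.
have XX : (X <= X')%N by rewrite leq_maxl.
have MX : (minn M q < X')%N by rewrite /X' (leq_ltn_trans (geq_minl _ _)) // leq_max ltnSn orbT.
have := cgw_chebyshev bal' ht MX; rewrite cE => H.
have th : 0 < theta by rewrite -(pmulr_rgt0 _ r0) (lt_le_trans _ ht).
apply: (@le_trans _ _ (32 * (M + N + q)%:R / (rho ^+ 2 * theta ^+ 2))); last first.
  have h : (M + N + q)%:R <= n%:R :> R by rewrite !natrD eq eM eN -!mulrDl ler_piMl // ltW.
  have h2 : 0 <= (rho ^+ 2 * theta ^+ 2)^-1 by rewrite invr_ge0 mulr_ge0 ?sqr_ge0.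
  by apply: ler_wpM2r => //; apply: ler_wpM2l.
apply: le_trans H; rewrite (big_ord_widen_cond X' (fun y => theta <= `|y%:R - center b d c * n%:R|) (cgw R M N q)) //.
rewrite [leLHS]big_mkcond [leRHS]big_mkcond; apply: ler_sum => y _ /=.
by case: ifP => [/andP[-> _] //|_]; case: ifP => // _; apply: cgw_ge0.
Qed.

Definition local_limit (R : realType) (a b c d : R) : Prop := forall K eps : R, 0 < K -> 0 < eps ->
  exists N0, forall n l q M N : nat, (N0 <= n)%N ->
  l%:R = a * n%:R -> q%:R = c * n%:R -> M%:R = b * n%:R -> N%:R = d * n%:R ->
  forall x : nat, let Z := x%:R - mucst a b c d * n%:R in
  let g := gauss_at (sigmacst a b c d ^+ 2 * n%:R) Z in
  `|Z| <= K * Num.sqrt n%:R -> `|coupled_weight R l q M N x - g| <= eps * g.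

Lemma sigmacst_sqr (R : realType) (a b c d : R) : 0 < a + c -> 0 < b -> 0 < d -> 0 < Dcst a b c d ->
  sigmacst a b c d ^+ 2 = (a + c) * b * d / Dcst a b c d.
Proof. by move=> ac b0 d0 D0; rewrite sqr_sqrtr // divr_ge0 ?mulr_ge0 // ltW. Qed.

Lemma local_limit_mixture (R : realType) (a b c d : R) :
  0 < a -> 0 < b -> 0 < c -> 0 < d -> a + b + c + d = 1 :> R -> local_limit a b c d.
Proof.
move=> a0 b0 c0 d0 sum1 K eps K0 eps0.
rewrite (sigmacst_sqr (addr_gt0 a0 c0) b0 d0 (Dcst_gt0 b0 d0 sum1)) -(total_spread a0 b0 c0 d0 sum1).
set sB := b * d * a / _; set sA := spread b d c; set r := (_ - 2 * _) / _.
have k0 := kap_gt0 b0 d0 sum1.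
have [_ dA0 _ m0 [_ my _ _]] := first_facts a0 b0 c0 d0 sum1.
have r1 := rho1_gt0 a0 b0 c0 d0 sum1.
have balf := balanced_first a0 b0 c0 d0 sum1.
set rho0 := Num.min b _ in m0 my r1 balf.
set m := rho0 ^+ 2 * (b + d + c) in m0 my r1.
set rho1 := Num.min a (m / 2) in r1.
have bal2 (n y : R) : 0 < n -> `|y - center b d c * n| <= m / 2 * n ->
     balanced rho1 ((c + d) * n - y) (b * n - y) (a * n) /\ 3 * rho1 * n <= n - 2 * y.
  move=> n0 hy; split; first exact: balanced_second a0 b0 c0 d0 sum1 _ _ n0 hy.
  by have [] := second_facts a0 b0 c0 d0 sum1 n0 hy.
have m20 : 0 < m / 2 by rewrite divr_gt0.
have rho00 : 0 < rho0 by rewrite !lt_min b0 c0 d0.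
(* At n = 1 and y = yA the error in [second_center] is zero, so mu is yA plus the positive centre of
   the second coupling. *)
have gap : center b d c < mucst a b c d.
  have h1 : `|center b d c - center b d c * 1| <= m / 2 * 1 by rewrite mulr1 subrr normr0 mulr1 ltW.
  have := second_center a0 b0 c0 d0 sum1 ltr01 h1.
  have [bal n3] := bal2 _ _ ltr01 h1; have [_ _ _ cl _] := center_facts bal.
  have [_ pos _ _ _] := bal.
  have {}cl : 0 < center ((c + d) * 1 - center b d c) (b * 1 - center b d c) (a * 1).
    by apply: lt_le_trans cl; rewrite mulr_gt0 ?exprn_gt0.
  move: cl; rewrite /mucst !mulr1 subrr expr0n /= mul0r !mulr0 subr0 normr_le0 subr_eq0 => cl /eqP <-.
  by rewrite ltrDl.
have sB0 : 0 < sB by rewrite divr_gt0 ?exprn_gt0 // !mulr_gt0.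
have sA0 : 0 < sA.
  by rewrite /sA (sA_E a0 b0 c0 d0 sum1) divr_gt0 ?exprn_gt0 // !mulr_gt0.
have rp : 0 < r by rewrite divr_gt0.
have sle := sum_le a0 b0 c0 d0 sum1.
(* The index i is the list of n, l, q, M, N in this order. *)
pose ok (i : seq nat) := [/\ (nth 0%N i 1%N)%:R = a * (nth 0%N i 0%N)%:R, (nth 0%N i 2%N)%:R = c * (nth 0%N i 0%N)%:R,
   (nth 0%N i 3%N)%:R = b * (nth 0%N i 0%N)%:R & (nth 0%N i 4%N)%:R = d * (nth 0%N i 0%N)%:R :> R].
pose A (i : seq nat) (y : nat) : R := cgw R (nth 0%N i 3%N) (nth 0%N i 4%N) (nth 0%N i 2%N) y.
pose B (i : seq nat) (x y : nat) : R :=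
  cgw R (nth 0%N i 4%N + nth 0%N i 2%N - y) (nth 0%N i 3%N - y) (nth 0%N i 1%N) (x - y).
have C0 : 0 < 2 / rho1 ^+ 2 / Num.sqrt (3 * rho1).
  have h3 : 0 < Num.sqrt (3 * rho1) by rewrite sqrtr_gt0; apply: mulr_gt0.
  by apply: divr_gt0 => //; apply: divr_gt0 => //; apply: exprn_gt0.
have my2 : m / 2 <= center b d c.
  by apply: le_trans my; rewrite ler_pdivrMr // ler_peMr ?(ltW m0) //; clear; lra.
have := @mixture_core R (seq nat) ok (fun i => nth 0%N i 0) A B sA sB r (center b d c) (mucst a b c d)
  rho0 (m / 2) _ K eps sA0 sB0 rp rho00 m20 my2 gap C0 K0 eps0.
case.
- by move=> i y; apply: cgw_ge0.
- by move=> i x y; rewrite cgw_ge0 cgw_le1.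
- move=> T e T0 e0; have [N0 H] := cgw_llt_scaled balf T0 e0.
  by exists N0 => i [? ? ? ?] hi y Y hY; apply: H.
- move=> T e T0 e0 e1.
  have [N0 H] := second_stage_llt a0 b0 c0 d0 sum1 T0 K0 e0 e1.
  exists N0 => i [h1 h2 h3 h4] hi x y Z Y hZ hY.
  by have [_ _] := H _ _ _ _ _ hi h1 h2 h3 h4 x y hZ hY.
- have [N0 H] := second_stage_sup r1 sum1 bal2.
  exists N0 => i [h1 h2 h3 h4] hi x y hy.
  exact: H hi h1 h2 h3 h4 y (x - y)%N hy.
- move=> i X theta [h1 h2 h3 h4] np ht.
  apply: first_stage_tail => //; apply: le_trans sle _; rewrite gerBl; exact: ltW.
move=> N0 H; exists N0 => n l q M N hn el eq eM eN x Z g hZ.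
exact: (H [:: n; l; q; M; N] (And4 el eq eM eN) hn x hZ).
Qed.

Lemma coupled_weight_q0 (R : realType) (l M N x : nat) : coupled_weight R l 0 M N x = cgw R N M l x.
Proof.
rewrite /coupled_weight big_ord_recl /= cgw_d0 mul1r addn0 !subn0 big1 ?addr0 // => i _.
by rewrite cgw_d0 /= mul0r.
Qed.

Lemma coupled_weight_l0 (R : realType) (q M N x : nat) : coupled_weight R 0 q M N x = cgw R M N q x.
Proof.
rewrite /coupled_weight big_ord_recr /= subnn cgw_d0 mulr1 big1 ?add0r // => i _.
by rewrite cgw_d0 subn_eq0 leqNgt ltn_ord mulr0.
Qed.

(** For a = 0 or c = 0 one of the two reference blocks is empty and the coupled weight is a single
    [cgw]. *)
Lemma local_limit_single (R : realType) (a b c d s0 t0 d0 : R) :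
  0 < s0 -> 0 < t0 -> 0 < d0 -> s0 + t0 + d0 = 1 :> R -> 
  Dcst a b c d = 1 - 4 * (s0 * d0) -> sigmacst a b c d ^+ 2 = spread s0 t0 d0 ->
  (forall n l q M N x : nat, l%:R = a * n%:R -> q%:R = c * n%:R -> M%:R = b * n%:R -> N%:R = d * n%:R ->
    exists s t e : nat, [/\ s%:R = s0 * n%:R, t%:R = t0 * n%:R, e%:R = d0 * n%:R :> R &
       coupled_weight R l q M N x = cgw R s t e x]) ->
  local_limit a b c d.
Proof.
move=> sp tp dp sum1 DE sE H K eps K0 eps0.
have bal : balanced (Num.min s0 (Num.min t0 d0)) s0 t0 d0.
  split; first by rewrite !lt_min sp tp dp.
  - by rewrite sum1.
  - by rewrite sum1 mulr1 ge_min lexx.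
  - by rewrite sum1 mulr1 !ge_min lexx orbT.
  - by rewrite sum1 mulr1 !ge_min lexx !orbT.
have cE : center s0 t0 d0 = mucst a b c d by rewrite /center /mucst sum1 DE expr1n.
have [N0 HN] := cgw_llt_scaled bal K0 eps0.
exists N0 => n l q M N hn el eq eM eN x Z g hZ.
have [s [t [e [es et ee ->]]]] := H n l q M N x el eq eM eN.
by have := HN n s t e hn es et ee x; rewrite cE -sE; apply.
Qed.

Lemma local_limit_all (R : realType) (a b c d : R) :
  0 <= a -> 0 < b -> 0 <= c -> 0 < d -> 0 < a + c -> a + b + c + d = 1 :> R -> local_limit a b c d.
Proof.
move=> a0 b0 c0 d0 ac sum1.
have D0 := Dcst_gt0 b0 d0 sum1.
move: a0; rewrite le_eqVlt => /orP[/eqP az|a0].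
  subst a; rewrite add0r in ac sum1.
  apply: (@local_limit_single _ 0 b c d b d c) => //.
  - by rewrite -sum1; ring.
  - by rewrite /Dcst; ring.
  - rewrite sigmacst_sqr ?add0r // /spread (_ : b + d + c = 1); last by rewrite -sum1; ring.
    by rewrite expr1n /Dcst !mul0r !add0r; congr (_ / _); ring.
  move=> n l q M N x; rewrite mul0r => /eqP; rewrite pnatr_eq0 => /eqP -> eq eM eN.
  by exists M, N, q; split=> //; apply: coupled_weight_l0.
move: c0; rewrite le_eqVlt => /orP[/eqP cz|c0]; last exact: local_limit_mixture.
subst c; rewrite addr0 in ac sum1.
(* The remaining coupling is with |1>^l, where zeros and ones trade places: s = N and t = M. *)
apply: (@local_limit_single _ a b 0 d d b a) => //.
- by rewrite -sum1; ring.
- by rewrite /Dcst; ring.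
- rewrite sigmacst_sqr ?addr0 // /spread (_ : d + b + a = 1); last by rewrite -sum1; ring.
  by rewrite expr1n /Dcst !mulr0 add0r addr0 [d * a]mulrC; congr (_ / _); ring.
move=> n l q M N x el; rewrite mul0r => /eqP; rewrite pnatr_eq0 => /eqP -> eM eN.
by exists N, M, l; split=> //; apply: coupled_weight_q0.
Qed.

(** * Limit theorems for the measurement *)

Lemma pXi_local_limit (R : realType) (a b c d : R) (n l m k x : nat) :
  0 <= a -> 0 <= b -> 0 <= c -> 0 <= d -> a + b + c + d = 1 :> R ->
  l%:R = a * n%:R -> m%:R = (a + b) * n%:R -> k%:R = (a + c) * n%:R -> (x <= n./2)%N ->
  exists q M N : nat, [/\ q%:R = c * n%:R, M%:R = b * n%:R, N%:R = d * n%:R :> R &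
    pXi R n m k l x = coupled_weight R l q M N x].
Proof.
move=> a0 b0 c0 d0 sum1 el em ek xn.
have bn : 0 <= b * n%:R by rewrite mulr_ge0.
have cn : 0 <= c * n%:R by rewrite mulr_ge0.
have dn : 0 <= d * n%:R by rewrite mulr_ge0.
have nE : n%:R = a * n%:R + b * n%:R + c * n%:R + d * n%:R by rewrite -!mulrDl sum1 mul1r.
rewrite mulrDl in em; rewrite mulrDl in ek.
have lk : (l <= k)%N by rewrite -(ler_nat R) el ek lerDl.
have lm : (l <= m)%N by rewrite -(ler_nat R) el em lerDl.
have kn : (k <= n)%N by rewrite -(ler_nat R) ek; move: nE bn dn; clear; lra.
have mlE : (m - l)%:R = b * n%:R :> R by rewrite natrB // em el addrC addKr.
have nkE : (n - k)%:R = b * n%:R + d * n%:R :> R by rewrite natrB // ek; move: nE; clear; lra.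
have mn : (m - l <= n - k)%N by rewrite -(ler_nat R) mlE nkE lerDl.
exists (k - l)%N, (m - l)%N, (n - k - (m - l))%N; split=> //.
- by rewrite natrB // ek el addrC addKr.
- by rewrite natrB // mlE nkE addrC addKr.
exact: pXi_coupled.
Qed.

Lemma sigmacst_gt0 (R : realType) (a b c d : R) :
  0 < b -> 0 < d -> 0 < a + c -> a + b + c + d = 1 :> R -> 0 < sigmacst a b c d.
Proof. by move=> *; rewrite sqrtr_gt0 divr_gt0 ?mulr_gt0 //; apply: Dcst_gt0. Qed.

Lemma mucst_bounds (R : realType) (a b c d : R) :
  0 <= a -> 0 < b -> 0 <= c -> 0 < d -> 0 < a + c -> a + b + c + d = 1 :> R -> 0 < mucst a b c d < 1 / 2.
Proof.
move=> a0 b0 c0 d0 ac sum1; have D0 := Dcst_gt0 b0 d0 sum1.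
have k0 : 0 < Num.sqrt (Dcst a b c d) by rewrite sqrtr_gt0.
have D1 : Dcst a b c d < 1.
  rewrite /Dcst gtrBl; apply: mulr_gt0 => //.
  have h1 : 0 <= a * c by rewrite mulr_ge0.
  have h2 : 0 <= a * d by rewrite mulr_ge0 // ltW.
  have h3 : 0 <= b * c by rewrite mulr_ge0 // ltW.
  move: a0; rewrite le_eqVlt => /orP[/eqP az|ap].
    by rewrite ltr_wpDl ?addr_ge0 // mulr_gt0 //; move: ac; rewrite -az add0r.
  by rewrite ltr_wpDr // ltr_wpDl // mulr_gt0.
have k1 : Num.sqrt (Dcst a b c d) < 1 by rewrite -[ltRHS]sqrtr1 ltr_sqrt.
by rewrite /mucst; apply/andP; split; move: k0 k1; clear; lra.
Qed.

Lemma gauss_localE (R : realType) (a b c d : R) (n x : nat) : 0 < sigmacst a b c d -> (0 < n)%N ->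
  gauss_local a b c d n x =
  gauss_at (sigmacst a b c d ^+ 2 * n%:R) (x%:R - mucst a b c d * n%:R).
Proof.
move=> s0 np; have n0 : 0 < n%:R :> R by rewrite ltr0n.
have h0 : 0 < Num.sqrt n%:R :> R by rewrite sqrtr_gt0.
have p0 : 0 < 2 * pi :> R by rewrite mulr_gt0 ?pi_gt0.
have q0 : 0 < Num.sqrt (2 * pi) :> R by rewrite sqrtr_gt0.
rewrite gauss_atE; last by rewrite mulr_gt0 ?exprn_gt0.
rewrite /gauss_local /zscore sqrtrM ?(ltW p0) // [Num.sqrt (_ ^+ 2 * _)]sqrtrM ?sqr_ge0 // sqrtr_sqr (gtr0_norm s0).
congr (_ * expR _).
  by field; rewrite !gt_eqF.
have nE := sqr_sqrtr (ltW n0); set h := Num.sqrt n%:R in h0 nE *.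
by clearbody h; rewrite -nE; field; rewrite !gt_eqF.
Qed.

Lemma zscoreE (R : realType) (a b c d : R) (n x : nat) : zscore a b c d n x =
  (x%:R - mucst a b c d * n%:R) / (sigmacst a b c d * Num.sqrt n%:R).
Proof. by rewrite /zscore [n%:R * _]mulrC [Num.sqrt _ * _]mulrC. Qed.

Lemma pXi_llt (R : realType) (a b c d K eps : R) :
  0 <= a -> 0 < b -> 0 <= c -> 0 < d -> 0 < a + c -> a + b + c + d = 1 :> R -> 0 < K -> 0 < eps -> exists N0, forall n l m k : nat, (N0 <= n)%N ->
  l%:R = a * n%:R -> m%:R = (a + b) * n%:R -> k%:R = (a + c) * n%:R ->
  forall x, let g := gauss_at (sigmacst a b c d ^+ 2 * n%:R) (x%:R - mucst a b c d * n%:R) in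
  (x <= n./2)%N -> `|zscore a b c d n x| <= K ->
  `|pXi R n m k l x - g| <= eps * g.
Proof.
move=> a0 b0 c0 d0 ac sum1 K0 e0; have s0 := sigmacst_gt0 b0 d0 ac sum1.
have [N0 H] := local_limit_all a0 b0 c0 d0 ac sum1 (mulr_gt0 K0 s0) e0.
exists (maxn 1 N0) => n l m k; rewrite geq_max => /andP[np nN] el em ek x g xn zK.
have [q [M [N [eq eM eN ->]]]] := pXi_local_limit a0 (ltW b0) c0 (ltW d0) sum1 el em ek xn.
apply: (H n l q M N nN el eq eM eN x).
have h0 : 0 < Num.sqrt n%:R :> R by rewrite sqrtr_gt0 ltr0n.
have p0 : 0 < sigmacst a b c d * Num.sqrt n%:R by rewrite mulr_gt0.
by move: zK; rewrite zscoreE normrM normfV (gtr0_norm p0) ler_pdivrMr // mulrA.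
Qed.

(** Summing the local estimate costs e times a sum of at most u - t + 1, and the Riemann sum is
    within e of the integral; the spare e in e (u - t + 3) <= eps makes the inequality strict. *)
Lemma pXi_clt (R : realType) (a b c d t u eps : R) :
  0 <= a -> 0 < b -> 0 <= c -> 0 < d -> 0 < a + c -> a + b + c + d = 1 :> R -> t < u -> 0 < eps -> exists N0, forall n l m k : nat, (N0 <= n)%N ->
  l%:R = a * n%:R -> m%:R = (a + b) * n%:R -> k%:R = (a + c) * n%:R ->
  `|prob_window a b c d n m k l t u - gauss_window t u| < eps.
Proof.
move=> a0 b0 c0 d0 ac sum1 tu eps0; have s0 := sigmacst_gt0 b0 d0 ac sum1.
have /andP[mu0 mu2] := mucst_bounds a0 b0 c0 d0 ac sum1.
set sg := sigmacst a b c d in s0; set mu := mucst a b c d in mu0 mu2.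
have ut : 0 < u - t by rewrite subr_gt0.
have ut3 : 0 < u - t + 3 by rewrite addr_gt0.
pose e := Num.min 1 (eps / (u - t + 3)).
have e0 : 0 < e by rewrite lt_min ltr01 divr_gt0.
have e1 : e <= 1 by rewrite ge_min lexx.
have ee : e * (u - t + 3) <= eps by rewrite -ler_pdivlMr // ge_min lexx orbT.
clearbody e.
pose K := `|t| + `|u| + 1.
have K0 : 0 < K by rewrite ltr_wpDl // addr_ge0.
have [N1 H1] := pXi_llt a0 b0 c0 d0 ac sum1 K0 e0.
(* The second threshold bounds the Riemann error by e; the last two place the window of x between 0
   and n/2, using 0 < mu < 1/2. *)
have [N2 H2] := sqrt_large (Num.max (Num.max 1 ((u - t + 3) / (sg * e)))
  (Num.max (`|t| * sg / mu) (`|u| * sg / (1 / 2 - mu)))).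
exists (maxn N1 N2) => n l m k; rewrite geq_max => /andP[n1 /H2].
rewrite !ge_max => /andP[/andP[h1 h2] /andP[h3 h4]] el em ek.
set h := Num.sqrt n%:R in h1 h2 h3 h4.
have nE : n%:R = h ^+ 2 :> R by rewrite sqr_sqrtr.
have h0 : 0 < h := lt_le_trans ltr01 h1.
pose tau := sg * h; have tau0 : 0 < tau by apply: mulr_gt0.
have tE : Num.sqrt (sg ^+ 2 * n%:R) = tau by rewrite sqrtrM ?sqr_ge0 // sqrtr_sqr gtr0_norm.
rewrite gauss_windowE ?(ltW tu) //.
pose P (x : nat) := (t <= (x%:R - mu * n%:R) / tau) && ((x%:R - mu * n%:R) / tau <= u).
pose G (x : nat) := gauss_at (sg ^+ 2 * n%:R) (x%:R - mu * n%:R).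
have WE : prob_window a b c d n m k l t u = \sum_(x < (n./2).+1 | P x) pXi R n m k l x.
  by apply: eq_bigl => x; rewrite !zscoreE.
pose S := \sum_(x < (n./2).+1 | P x) G x.
have W1 : `|prob_window a b c d n m k l t u - S| <= e * S.
  rewrite WE; apply: (@le_sum_normB _ _ P (pXi R n m k l) G) => x; rewrite ltnS => xn /andP[p1 p2].
  apply: (H1 n l m k n1 el em ek x) => //; rewrite zscoreE ler_norml /K.
  have := ler_norm t; have := ler_norm u; have := ler_norm (- t); rewrite normrN.
  have := normr_ge0 t; have := normr_ge0 u.
  by move: p1 p2; rewrite /tau; clear; set z := _ / _; move=> *; apply/andP; split; lra.
have S1 : `|S - (Phi u - Phi t)| <= e.
  apply: (@le_trans _ _ ((u - t + 3) / tau)); last first.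
    rewrite ler_pdivrMr // mulrC; move: h2; rewrite ler_pdivrMr ?mulr_gt0 // => h2.
    by apply: le_trans h2 _; rewrite /tau le_eqVlt; apply/orP; left; apply/eqP; ring.
  have -> : S = \sum_(y < (n./2).+1 | (t <= (y%:R - mu * n%:R) / tau) && ((y%:R - mu * n%:R) / tau <= u)) phi ((y%:R - mu * n%:R) / tau) / tau.
    by apply: eq_bigr => y _; rewrite /G /gauss_at tE.
  apply: riemann_phi; rewrite ?(ltW tu) //.
    rewrite nE expr2 (_ : _ + _ = (mu * h + t * sg) * h); last by rewrite /tau; ring.
    rewrite mulr_ge0 // ?(ltW h0) //; move: h3; rewrite ler_pdivrMr // => h3.
    have : - t * sg <= `|t| * sg by rewrite ler_pM2r // -normrN ler_norm.
    by move: h3; clear; rewrite mulNr [mu * h]mulrC; lra.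
  apply: (@le_trans _ _ (n%:R / 2)); last first.
    have nn : n%:R = (odd n)%:R + (n./2)%:R * 2 :> R by rewrite -natrM muln2 -natrD odd_double_half.
    have mm : (n./2).+1%:R = (n./2)%:R + 1 :> R by rewrite -natr1.
    by rewrite mm nn; case: (odd n) => /=; move: (n./2%:R); clear => z; lra.
  rewrite nE expr2 (_ : _ + _ = (mu * h + u * sg) * h); last by rewrite /tau; ring.
  rewrite [leRHS]mulrAC ler_pM2r //; move: h4; rewrite ler_pdivrMr ?subr_gt0 // => h4.
  have : u * sg <= `|u| * sg by rewrite ler_pM2r // ler_norm.
  by move: h4; clear; lra.
have /andP[Q0 Q1] := Phi_le (ltW tu).
move: (prob_window _ _ _ _ _ _ _ _ _ _) W1 => W W1.
have S2 : S <= u - t + 1 by move: S1 Q1 e1; clear; rewrite ler_norml => /andP[_ s] *; lra.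
have W2 : e * S <= e * (u - t + 1) by rewrite ler_pM2l.
have -> : W - (Phi u - Phi t) = (W - S) + (S - (Phi u - Phi t)) by ring.
apply: le_lt_trans (ler_normD _ _) _; move: (le_trans W1 W2) S1 ee e0; clear; lra.
Qed.

Theorem theorem5p12 (R : realType) (a b c d : R) :
  0 <= a -> 0 <= b -> 0 <= c -> 0 <= d -> a + b + c + d = 1 ->
  0 < a + c -> 0 < b -> 0 < d ->
  (* central limit theorem, along n with l = a n, m = (a+b) n, k = (a+c) n integers *)
  (forall t u : R, t < u ->
   forall eps : R, 0 < eps ->
   exists N : nat, forall n l m k : nat, (N <= n)%N ->
     l%:R = a * n%:R -> m%:R = (a + b) * n%:R -> k%:R = (a + c) * n%:R ->
     `| prob_window a b c d n m k l t u - gauss_window t u | < eps)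
  /\
  (* local form: p(x) = g(x) (1 + o(1)), uniformly for |(x - n mu)/(sqrt n sigma)| <= K *)
  (forall K eps : R, 0 < K -> 0 < eps ->
   exists N : nat, forall n l m k : nat, (N <= n)%N ->
     l%:R = a * n%:R -> m%:R = (a + b) * n%:R -> k%:R = (a + c) * n%:R ->
     forall x : nat, (x <= n./2)%N -> `| zscore a b c d n x | <= K ->
     `| pXi R n m k l x / gauss_local a b c d n x - 1 | < eps).
Proof.
move=> a0 _ c0 _ sum1 ac b0 d0; split=> [t u tu eps eps0|K eps K0 eps0].
  exact: pXi_clt.
have e20 : 0 < eps / 2 by rewrite divr_gt0.
have [N0 H] := pXi_llt a0 b0 c0 d0 ac sum1 K0 e20.
exists (maxn 1 N0) => n l m k; rewrite geq_max => /andP[np nN] el em ek x xn zK.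
have := H n l m k nN el em ek x xn zK; have s0 := sigmacst_gt0 b0 d0 ac sum1; rewrite gauss_localE //.
set g := gauss_at _ _ => /= hg.
have g0 : 0 < g.
  by apply: gauss_at_gt0; rewrite mulr_gt0 ?ltr0n // exprn_gt0.
rewrite -[X in _ - X](divff (lt0r_neq0 g0)) -mulrBl normrM normfV (gtr0_norm g0) ltr_pdivrMr //.
by apply: le_lt_trans hg _; rewrite ltr_pM2r // ltr_pdivrMr // ltr_pMr // ltr1n.
Qed.
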